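(* Let $n\ge 3$ and let $\mathbb{S}^n_+$ be the open upper unit hemisphere of $\mathbb{S}^n\subset\mathbb{R}^{n+1}$ with the standard round metric $g$, $\Delta_g$ its Laplace–Beltrami operator, and $\nu$ the unit outward normal along the boundary $\partial\mathbb{S}^n_+$ (the equator). Let $f:[0,+\infty)\to\mathbb{R}$ and $b:[0,+\infty)\to\mathbb{R}$ be continuous and consider $$-\Delta_g u=f(u)\ \text{ on }\mathbb{S}^n_+,\qquad \frac{\partial u}{\partial\nu}=b(u)\ \text{ on }\partial\mathbb{S}^n_+ .\qquad (\ast)$$ Suppose that $h_1(t):=t^{-\frac{n+2}{n-2}}\left(f(t)+\frac{n(n-2)}{4}t\right)$ is decreasing on $(0,+\infty)$, and $k_1(t):=t^{-\frac{n}{n-2}}b(t)$ is nonincreasing and nonnegative on $(0,+\infty)$. Then: (i) any positive solution $u$ of $(\ast)$ which is continuous on $\overline{\mathbb{S}^n_+}$ is constant on each set $A_r=\{\omega\in\overline{\mathbb{S}^n_+}:\ \operatorname{dist}_{\mathbb{S}^n}(\omega,\partial\mathbb{S}^n_+)=r\}$, $r\in[0,\pi/2]$ (i.e. on each ''circle parallel to the equator''). Moreover, if $b(u(\zeta_0))=0$ for some $\zeta_0\in\partial\mathbb{S}^n_+$, then $u$ is constant on $\mathbb{S}^n_+$. (ii) If $h_1(t)t^{\frac{n+2}{n-2}}$ (that is, $f(t)+\frac{n(n-2)}{4}t$) is nonnegative for $t\ge 0$, then any nonnegative continuous solution of $(\ast)$ is either identically zero or positive on $\overline{\mathbb{S}^n_+}$,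 so the conclusions of (i) hold for it when it is nonzero. Moreover, if $b(t)\ge \frac{n-2}{2}t$ for all $t>0$, then $(\ast)$ has no positive solutions.
   Context: $\operatorname{dist}_{\mathbb{S}^n}$ denotes the geodesic distance on the round sphere $\mathbb{S}^n$. Solutions are classical solutions of the boundary value problem. *)

(* Defs.v *)
From HB Require Import structures.
From mathcomp Require Import all_boot all_order all_algebra.
From mathcomp Require Import all_classical all_reals all_analysis.
Set Implicit Arguments. Unset Strict Implicit. Unset Printing Implicit Defensive.
Import Order.TTheory GRing.Theory Num.Theory.
Import numFieldNormedType.Exports.
Local Open Scope classical_set_scope.
Local Open Scope ring_scope.

Section Sphere.
Variables (R : realType) (n : nat).
Local Notation V := 'rV[R]_(n.+1).

Definition edot (x y : V) : R := \sum_(i < n.+1) x ord0 i * y ord0 i.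
Definition enorm (x : V) : R := Num.sqrt (edot x x).

Definition ebasis (i : 'I_n.+1) : V := delta_mx 0 i.

Definition xlast (x : V) : R := x ord0 ord_max.

Definition sphere : set V := [set x | edot x x = 1].
Definition hemi : set V := [set x | sphere x /\ 0 < xlast x].
Definition hemi_cl : set V := [set x | sphere x /\ 0 <= xlast x].
Definition equator : set V := [set x | sphere x /\ xlast x = 0].

Definition gdist (x y : V) : R := acos (edot x y).
Definition dist_equator (w : V) : R := inf [set gdist w z | z in equator].
Definition Aset (r : R) : set V := [set w | hemi_cl w /\ dist_equator w = r].

Definition ext (u : V -> R) : V -> R := fun x => u ((enorm x)^-1 *: x).

(* Laplace-Beltrami operator of the round sphere: Euclidean Laplacian of
   the 0-homogeneous extension, evaluated on the sphere. *)
Definition LB (u : V -> R) (x : V) : R :=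
  \sum_(i < n.+1) 'D_(ebasis i) ('D_(ebasis i) (ext u)) x.

Definition C2_hemi (u : V -> R) : Prop :=
  forall x, hemi x ->
    (\forall y \near x,
        (forall i, derivable (ext u) y (ebasis i)) /\
        (forall i j, derivable ('D_(ebasis i) (ext u)) y (ebasis j))) /\
    (forall i, {for x, continuous ('D_(ebasis i) (ext u))}) /\
    (forall i j, {for x, continuous ('D_(ebasis j) ('D_(ebasis i) (ext u)))}).

(* outward normal derivative at an equator point z equals c:
   the outward unit normal is nu = - e_{n+1}, and the derivative is one-sided
   (taken from inside the hemisphere). *)
Definition normal_deriv_is (u : V -> R) (z : V) (c : R) : Prop :=
  (fun t : R => (ext u (z + t *: ebasis ord_max) - u z) / t) @ (0 : R)^'+ --> - c.

Definition is_solution (f b : R -> R) (u : V -> R) : Prop :=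
  C2_hemi u /\
  {within hemi_cl, continuous u} /\
  (forall x, hemi x -> - LB u x = f (u x)) /\
  (forall z, equator z -> normal_deriv_is u z (b (u z))).

Definition concl_i (b : R -> R) (u : V -> R) : Prop :=
  (forall r, 0 <= r <= pi / 2 ->
     forall w1 w2, Aset r w1 -> Aset r w2 -> u w1 = u w2) /\
  ((exists z0, equator z0 /\ b (u z0) = 0) ->
     exists c, forall x, hemi x -> u x = c).

End Sphere.

(* Main.v *)
(* Moving spheres on the sphere itself. Write [a = (n-2)/2]. For a unit vector [p]
   (orthogonal to the pole, so that the hemisphere is preserved) and [0 <= mu < 1],
   the conformal involution [kphi mu p] fixes the sphere [x.p = mu], and the
   operator [- Laplacian + n(n-2)/4] is covariant under [u |-> J^a (u o kphi)], with
   [J] the conformal factor. The monotonicity of [h1] and [k1] makes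
   [u - J^a (u o kphi)] satisfy maximum principles on [x.p <= mu], and moving [mu]
   from 1 down to 0 gives [u (x - 2 (x.p) p) <= u x] for [x.p <= 0]. Applied to [p]
   and [- p] this is reflection symmetry for all such [p], hence dependence on the
   height alone. If [b] vanishes at the boundary value, the even extension of [u]
   solves the equation on the whole sphere, where [p] is arbitrary. Positivity is
   the strong maximum principle, and nonexistence is a comparison of [u] with
   [(1 + s)^-a + eps], [s] being the height.

   The regularity used is a second order Taylor expansion at each point: the
   Laplacian of [W] at [x] is read off the expansions of its homogeneous extension
   along the coordinate lines ([has_lap]). *)
Require Import Defs.
From HB Require Import structures.
From mathcomp Require Import all_boot all_order all_algebra.
From mathcomp Require Import all_classical all_reals all_analysis.
From mathcomp Require Import ring lra.
Set Implicit Arguments. Unset Strict Implicit. Unset Printing Implicit Defensive.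
Import Order.TTheory GRing.Theory Num.Theory.
Import numFieldNormedType.Exports.
Local Open Scope classical_set_scope.
Local Open Scope ring_scope.

(** The available regularity shapes the proof: [u] is C^2 only inside and merely continuous up to
    the equator, with a one-sided derivative along one straight line there, while [f] and [b] are
    only continuous. Zero order coefficients must come from the monotone quotients. These compare
    [u x] with a larger value [u (kphi mu p x)]; as the conformal factor is at most 1 on
    [x.p <= mu], that order holds wherever the transform exceeds [u]. The difference vanishes on
    [x.p = mu], so compactness cannot keep it positive there while [mu] moves. A strip next to this
    sphere has its own maximum principle, and compactness is used only off the strip. Near [mu = 1]
    the conformal factor is small away from [p], which starts the motion; for [0 < mu < 1] it is
    below 1 inside the cap, so a contact point contradicts the strict decrease of [h1]. The even
    extension needs a second order expansion at the equator, where the boundary condition gives only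
    a first order one. The rest is extracted from the equation, once [u] is known to depend on the
    height alone. *)

(** * Second order expansions in one variable *)

Section Peano.
Variable R : realType.
Implicit Types (f g q : R -> R).

Lemma cvg_eq_lim (T : Type) (F : set_system T) (f : T -> R) (a b : R) :
  f x @[x --> F] --> a -> a = b -> f x @[x --> F] --> b.
Proof. by move=> h <-. Qed.

(** The remainder is folded into a varying quadratic coefficient [q], so that sums, products and
    composites are ring identities plus limits of [q]. Thus [a2] is half a second derivative. *)
Definition peano f (a0 a1 a2 : R) : Prop :=
  exists2 q, q @ (0 : R) --> a2 & forall t, f t = a0 + a1 * t + q t * t ^+ 2.

Lemma peano_ext f g a0 a1 a2 : f =1 g -> peano f a0 a1 a2 -> peano g a0 a1 a2.
Proof. by move=> fg [q qc qE]; exists q => // t; rewrite -fg. Qed.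

Lemma peano_at0 f a0 a1 a2 : peano f a0 a1 a2 -> f 0 = a0.
Proof. by case=> q _ ->; rewrite mulr0 expr0n mulr0 !addr0. Qed.

Lemma peano_near f g a0 a1 a2 :
  (\forall t \near 0, f t = g t) -> peano f a0 a1 a2 -> peano g a0 a1 a2.
Proof.
move=> fg pf; have f0 := peano_at0 pf; case: pf => q qc qE.
have g0 : g 0 = a0 by rewrite -f0; apply/esym; exact: (nbhs_singleton fg).
(* The limit of [q] is taken over full neighbourhoods of 0, so its value at 0 must be [a2]
   itself. *)
exists (fun t => if t == 0 then a2 else (g t - a0 - a1 * t) / t ^+ 2); last first.
  move=> t; case: eqVneq => [->|t0]; first by rewrite mulr0 expr0n mulr0 !addr0.
  by field.
apply/cvgrPdist_le => e e0.
move/cvgrPdist_le: qc => /(_ _ e0) qc.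
near=> t.
case: eqVneq => [_|t0]; first by rewrite subrr normr0 ltW.
have -> : g t = f t by apply/esym; near: t.
have -> : (f t - a0 - a1 * t) / t ^+ 2 = q t by rewrite qE; field.
by near: t.
Unshelve. all: by end_near. Qed.

Lemma peano_cst c : peano (fun=> c) c 0 0.
Proof. by exists (fun=> 0); [exact: cvg_cst|move=> t; rewrite !mul0r !addr0]. Qed.

Lemma peano_id c d : peano (fun t => c + t * d) c d 0.
Proof. by exists (fun=> 0); [exact: cvg_cst|move=> t; rewrite mul0r addr0 mulrC]. Qed.

Lemma peanoD f g a0 a1 a2 b0 b1 b2 : peano f a0 a1 a2 -> peano g b0 b1 b2 ->
  peano (fun t => f t + g t) (a0 + b0) (a1 + b1) (a2 + b2).
Proof.
move=> [q qc qE] [r rc rE]; exists (fun t => q t + r t); first exact: cvgD.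
by move=> t; rewrite qE rE; ring.
Qed.

Lemma peanoZ c f a0 a1 a2 : peano f a0 a1 a2 ->
  peano (fun t => c * f t) (c * a0) (c * a1) (c * a2).
Proof.
move=> [q qc qE]; exists (fun t => c * q t); first exact: cvgM (cvg_cst _) qc.
by move=> t; rewrite qE; ring.
Qed.

Lemma peanoM f g a0 a1 a2 b0 b1 b2 : peano f a0 a1 a2 -> peano g b0 b1 b2 ->
  peano (fun t => f t * g t)
    (a0 * b0) (a0 * b1 + a1 * b0) (a0 * b2 + a1 * b1 + a2 * b0).
Proof.
move=> [q qc qE] [r rc rE].
exists (fun t => a0 * r t + a1 * b1 + q t * b0
   + t * (a1 * r t + q t * b1) + t * (t * (q t * r t))); last first.
  by move=> t; rewrite qE rE; ring.
apply: (@cvg_eq_lim _ _ _ (a0 * b2 + a1 * b1 + a2 * b0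
   + 0 * (a1 * b2 + a2 * b1) + 0 * (0 * (a2 * b2)))); last by ring.
have tc : t @[t --> (0 : R)] --> (0 : R) by exact: cvg_id.
have cc (c : R) : c @[t --> (0 : R)] --> c by exact: cvg_cst.
exact: (cvgD (cvgD (cvgD (cvgD (cvgM (cc a0) rc) (cc (a1 * b1))) (cvgM qc (cc b0)))
  (cvgM tc (cvgD (cvgM (cc a1) rc) (cvgM qc (cc b1))))) (cvgM tc (cvgM tc (cvgM qc rc)))).
Qed.

Lemma peano_comp (G : R -> R) f (g0 : R) a1 a2 G0 G1 G2 :
  peano (fun h => G (g0 + h)) G0 G1 G2 -> peano f g0 a1 a2 ->
  peano (G \o f) G0 (G1 * a1) (G1 * a2 + G2 * a1 ^+ 2).
Proof.
move=> [Q Qc QE] [q qc qE].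
pose h t := a1 * t + q t * t ^+ 2.
have hc : h @ (0 : R) --> (0 : R).
  apply: (@cvg_eq_lim _ _ _ (a1 * 0 + a2 * (0 * 0))); last by ring.
  apply: cvgD; first by apply: cvgM; [exact: cvg_cst|exact: cvg_id].
  by apply: cvgM => //; apply: cvgM; exact: cvg_id.
exists (fun t => G1 * q t + Q (h t) * (a1 + q t * t) ^+ 2); last first.
  by move=> t /=; rewrite qE -addrA QE /h; ring.
apply: (@cvg_eq_lim _ _ _ (G1 * a2 + G2 * ((a1 + a2 * 0) * (a1 + a2 * 0)))); last by ring.
apply: cvgD; first by apply: cvgM => //; exact: cvg_cst.
apply: cvgM; first exact: (cvg_comp _ _ hc Qc).
by apply: cvgM; (apply: cvgD; first exact: cvg_cst); apply: cvgM => //;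
  exact: cvg_id.
Qed.

Lemma peano_unique f a0 a1 a2 b0 b1 b2 :
  peano f a0 a1 a2 -> peano f b0 b1 b2 -> [/\ a0 = b0, a1 = b1 & a2 = b2].
Proof.
move=> pf pg; have e0 : a0 = b0 by rewrite -(peano_at0 pf) (peano_at0 pg).
case: pf pg => q qc qE [r rc rE].
have eqt t : (a1 - b1) * t = (r t - q t) * t ^+ 2.
  have := qE t; rewrite rE e0 => h; apply/eqP; rewrite -subr_eq0.
  rewrite (_ : _ - _ = (b0 + a1 * t + q t * t ^+ 2) - (b0 + b1 * t + r t * t ^+ 2)); last by ring.
  by rewrite h subrr.
have e1 : a1 = b1.
  apply/eqP; rewrite -subr_eq0; apply/eqP.
  have h : (fun t => (r t - q t) * t) @ (0 : R)^' --> a1 - b1.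
    apply: cvg_near_cst; near=> t.
    have t0 : t != 0 by near: t; exact: nbhs_dnbhs_neq.
    apply/(mulIf t0); rewrite eqt; ring.
  have h2 : (fun t => (r t - q t) * t) @ (0 : R)^' --> (b2 - a2) * 0.
    apply: cvg_within_filter; apply: cvgM; last exact: cvg_id.
    exact: cvgB.
  by rewrite -(cvg_lim _ h)// (cvg_lim _ h2)// mulr0.
split=> //; apply/eqP; rewrite eq_sym -subr_eq0; apply/eqP.
have h : (fun t => r t - q t) @ (0 : R)^' --> (0 : R).
  apply: cvg_near_cst; near=> t.
  have t0 : t ^+ 2 != 0 by rewrite expf_neq0//; near: t; exact: nbhs_dnbhs_neq.
  by apply/(mulIf t0); rewrite -eqt e1 subrr !mul0r.
have h2 : (fun t => r t - q t) @ (0 : R)^' --> b2 - a2.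
  by apply: cvg_within_filter; exact: cvgB.
by rewrite -(cvg_lim _ h2)// (cvg_lim _ h).
Unshelve. all: by end_near. Qed.

Lemma peano_min f a0 a1 a2 : (\forall t \near 0, a0 <= f t) ->
  peano f a0 a1 a2 -> a1 = 0 /\ 0 <= a2.
Proof.
move=> fmin [q qc qE].
have ge0 : \forall t \near 0, 0 <= a1 * t + q t * t ^+ 2.
  by near=> t; rewrite -(lerD2l a0) addr0 addrA -qE; near: t.
have c1 : (fun t => a1 + q t * t) @ (0 : R) --> a1.
  apply: (@cvg_eq_lim _ _ _ (a1 + a2 * 0)); last by ring.
  apply: cvgD; first exact: cvg_cst.
  by apply: cvgM => //; exact: cvg_id.
have a10 : a1 = 0.
  apply/eqP; rewrite eq_le; apply/andP; split.
  - have c1l : (fun t => a1 + q t * t) @ (0 : R)^'- --> a1 by apply: cvg_within_filter.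
    rewrite -(cvg_lim _ c1l)//; apply: limr_le; first by apply/cvg_ex; exists a1.
    near=> t; have t0 : t < 0 by near: t; exact: nbhs_left_lt.
    rewrite -(nmulr_lge0 _ t0) [X in 0 <= X](_ : _ = a1 * t + q t * t ^+ 2); last by ring.
    by near: t; rewrite near_withinE; apply: filterS ge0.
  - have c1l : (fun t => a1 + q t * t) @ (0 : R)^'+ --> a1 by apply: cvg_within_filter.
    rewrite -(cvg_lim _ c1l)//; apply: limr_ge; first by apply/cvg_ex; exists a1.
    near=> t; have t0 : 0 < t by near: t; exact: nbhs_right_gt.
    rewrite -(pmulr_lge0 _ t0) [X in 0 <= X](_ : _ = a1 * t + q t * t ^+ 2); last by ring.
    by near: t; rewrite near_withinE; apply: filterS ge0.
split=> //.
have c2 : q @ (0 : R)^' --> a2 by apply: cvg_within_filter.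
rewrite -(cvg_lim _ c2)//; apply: limr_ge; first by apply/cvg_ex; exists a2.
near=> t; have t0 : t != 0 by near: t; exact: nbhs_dnbhs_neq.
have t2 : 0 < t ^+ 2 by rewrite exprn_even_gt0.
rewrite -(pmulr_lge0 _ t2) [X in 0 <= X](_ : _ = a1 * t + q t * t ^+ 2); last by rewrite a10; ring.
by near: t; rewrite near_withinE; apply: filterS ge0.
Unshelve. all: by end_near. Qed.

Lemma peano_derive2 f (df : R -> R) (x d2 : R) :
  (\forall y \near x, is_derive (y : R) 1 f (df y)) -> is_derive x 1 df d2 ->
  peano (fun h => f (x + h)) (f x) (df x) (d2 / 2).
Proof.
move=> fD dfD.
exists (fun t => if t == 0 then d2 / 2 else (f (x + t) - f x - df x * t) / t ^+ 2);
  last first.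
  move=> t; case: eqVneq => [->|t0].
    by rewrite addr0 mulr0 expr0n mulr0 !addr0.
  by field.
have dfc : (fun h => h^-1 * (df (h + x) - df x)) @ (0 : R)^' --> d2.
  case: dfD => /cvg_ex[l lE] <-; rewrite /derive.
  have e : (fun h => h^-1 * (df (h + x) - df x)) =
     (fun h => h^-1 *: ((df \o shift x) (h *: 1) - df x)).
    by apply/funext => h /=; rewrite /GRing.scale /= mulr1.
  by rewrite e (cvg_lim _ lE).
apply/cvgrPdist_le => /= e e0.
move/cvgrPdist_le: dfc => /(_ _ (e0 : 0 < e)) dfc.
move: dfc; rewrite near_withinE => /nbhs_ballP[r1 r10 hr1].
have /nbhs_ballP[r2 r20 hr2] := fD.
rewrite /= in r10 r20.
have r0 : 0 < Num.min r1 r2 by rewrite lt_min r10.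
apply/nbhs_ballP; exists (Num.min r1 r2) => //= t; rewrite /ball /= sub0r normrN lt_min => /andP[t1 t2].
case: eqVneq => [_|t0]; first by rewrite subrr normr0 ltW.
(* [phi' = o(s)], so the mean value theorem gives [phi t - phi 0 = o(t^2)]. *)
pose phi s := f (x + s) - df x * s - d2 / 2 * s ^+ 2.
pose dphi s := df (x + s) - df x - d2 * s.
have phiD (s : R) : `|s| <= `|t| -> is_derive s 1 phi (dphi s).
  move=> st.
  have fD' : is_derive (x + s) 1 f (df (x + s)).
    by apply: hr2; rewrite /ball /= opprD addNKr normrN (le_lt_trans st).
  have fs : is_derive s 1 (fun s => f (x + s)) (df (x + s)).
    have <- : df (x + s) * 1 = df (x + s) by rewrite mulr1.
    have ds : is_derive s 1 (fun s : R => x + s) 1 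
      by rewrite -[1 in X in is_derive _ _ _ X]add0r; exact: is_deriveD.
    exact: (@is_derive1_comp _ f (fun s => x + s) s _ _ fD' ds).
  rewrite /phi /dphi.
  apply: is_derive_eq; rewrite /GRing.scale/=; by field.
have bnd (s : R) : s != 0 -> `|s| <= `|t| -> `|dphi s| <= e * `|s|.
  move=> s0 st; have := hr1 s; rewrite /ball/= sub0r normrN => /(_ (le_lt_trans st t1)) /(_ s0) h.
  have -> : dphi s = - s * (d2 - s^-1 * (df (s + x) - df x)).
    by rewrite /dphi (addrC s x); field.
  by rewrite normrM normrN mulrC ler_wpM2r.
have key : exists2 s, `|s| <= `|t| & phi t - phi 0 = dphi s * t.
  have cont (a b : R) : (forall s, a <= s <= b -> `|s| <= `|t|) -> {within `[a, b], continuous phi}.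
    move=> h; apply: derivable_within_continuous => s; rewrite in_itv /= => /h /phiD [].
    by [].
  case: (ltgtP t 0) => [tn|tp|t00]; last by rewrite t00 eqxx in t0.
  - have hb s : t <= s <= 0 -> `|s| <= `|t| by move=> /andP[? ?]; rewrite !ler0_norm ?lerN2 // ltW.
    have [] := @MVT R phi dphi t 0 tn.
    + by move=> s; rewrite in_itv /= => /andP[? ?]; apply: phiD; apply: hb; rewrite !ltW.
    + exact: cont.
    + move=> s; rewrite in_itv /= => /andP[? ?] E; exists s; first by apply: hb; rewrite !ltW.
      by rewrite -opprB E; ring.
  - have hb s : 0 <= s <= t -> `|s| <= `|t| by move=> /andP[? ?]; rewrite !ger0_norm // ltW.
    have [] := @MVT R phi dphi 0 t tp.
    + by move=> s; rewrite in_itv /= => /andP[? ?]; apply: phiD; apply: hb; rewrite !ltW.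
    + exact: cont.
    + move=> s; rewrite in_itv /= => /andP[? ?] E; exists s; first by apply: hb; rewrite !ltW.
      by rewrite E; ring.
case: key => s st E.
have dphi0 : dphi 0 = 0 by rewrite /dphi addr0 subrr mulr0 subr0.
have bs : `|dphi s| <= e * `|t|.
  case: (eqVneq s 0) => [->|s0]; first by rewrite dphi0 normr0 mulr_ge0 // ltW.
  by apply: le_trans (bnd _ s0 st) _; rewrite ler_wpM2l // ltW.
have tt : 0 < t ^+ 2 by rewrite exprn_even_gt0.
rewrite (_ : d2 / 2 - _ = - (phi t - phi 0) / t ^+ 2); last first.
  by rewrite /phi addr0; field.
rewrite E normrM normfV (gtr0_norm tt) ler_pdivrMr// normrN normrM.
rewrite -(real_normK (num_real t)) expr2 mulrA.
by rewrite ler_wpM2r.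
Qed.

Lemma peano_powR (x al : R) : 0 < x ->
  peano (fun h => (x + h) `^ al) (x `^ al) (al * x `^ (al - 1))
    (al * (al - 1) / 2 * x `^ (al - 2)).
Proof.
move=> x0.
have -> : al * (al - 1) / 2 * x `^ (al - 2) = (al * (al - 1) * x `^ (al - 2)) / 2 by ring.
apply: (@peano_derive2 (fun y => y `^ al) (fun y => al * y `^ (al - 1))).
  near=> y; apply: is_derive1_powR; near: y; exact: lt_nbhsr.
have h := is_derive1_powR (al - 1) x0.
rewrite (_ : al - 2 = al - 1 - 1); last by ring.
by apply: is_derive_eq; rewrite /GRing.scale /= mulrA.
Unshelve. all: by end_near. Qed.

End Peano.

(** * Euclidean geometry of row vectors: inner product, radial projection, bilinear forms *)

Section Edot.
Variables (R : realType) (n : nat).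
Local Notation V := 'rV[R]_(n.+1).
Implicit Types (x y z k : V) (Q : 'M[R]_(n.+1)) (i j : 'I_n.+1).

Lemma edotC x y : edot x y = edot y x.
Proof. by apply: eq_bigr => i _; rewrite mulrC. Qed.

Lemma edotDl x y z : edot (x + y) z = edot x z + edot y z.
Proof. by rewrite /edot -big_split; apply: eq_bigr => i _; rewrite mxE mulrDl. Qed.

Lemma edotZl a x y : edot (a *: x) y = a * edot x y.
Proof. by rewrite /edot mulr_sumr; apply: eq_bigr => i _; rewrite mxE mulrA. Qed.

Lemma edotDr x y z : edot x (y + z) = edot x y + edot x z.
Proof. by rewrite edotC edotDl !(edotC x). Qed.

Lemma edotZr a x y : edot x (a *: y) = a * edot x y.
Proof. by rewrite edotC edotZl edotC. Qed.

Lemma edotNl x y : edot (- x) y = - edot x y.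
Proof. by rewrite -scaleN1r edotZl mulN1r. Qed.

Lemma edotNr x y : edot x (- y) = - edot x y.
Proof. by rewrite edotC edotNl edotC. Qed.

Lemma edot0l x : edot 0 x = 0.
Proof. by rewrite -(scale0r 0) edotZl mul0r. Qed.

Lemma edot0r x : edot x 0 = 0.
Proof. by rewrite edotC edot0l. Qed.

Definition edotE := (edotDl, edotDr, edotNl, edotNr, edotZl, edotZr).

Lemma edot_basis x i : edot x (ebasis R i) = x ord0 i.
Proof.
rewrite /edot (bigD1 i)//= big1 ?addr0 => [|j ji].
  by rewrite mxE !eqxx mulr1.
by rewrite mxE eqxx (negbTE ji) mulr0.
Qed.

Lemma basis_edot x i : edot (ebasis R i) x = x ord0 i.
Proof. by rewrite edotC edot_basis. Qed.

Lemma edot_basis_diag i : edot (ebasis R i) (ebasis R i) = 1.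
Proof. by rewrite edot_basis mxE !eqxx. Qed.

Lemma edot_ge0 x : 0 <= edot x x.
Proof. by apply: sumr_ge0 => i _; rewrite -expr2 sqr_ge0. Qed.

Lemma edot_eq0 x : edot x x = 0 -> x = 0.
Proof.
move/eqP; rewrite psumr_eq0 => [/allP h|i _]; last by rewrite -expr2 sqr_ge0.
apply/rowP => i; rewrite mxE; apply/eqP.
by have := h i (mem_index_enum i); rewrite mulf_eq0 orbb.
Qed.

Lemma coord_le x i : x ord0 i ^+ 2 <= edot x x.
Proof.
rewrite /edot (bigD1 i)//= expr2 lerDl.
by apply: sumr_ge0 => j _; rewrite -expr2 sqr_ge0.
Qed.

(** The norm behind neighbourhoods and balls is the maximum norm; this comparison lets Euclidean
    estimates control it. *)
Lemma norm_le_edot x : `|x| ^+ 2 <= edot x x.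
Proof.
have [->|x0] := eqVneq x 0; first by rewrite normr0 expr0n edot0l.
have h0 : mx_norm x != 0 by apply: contra_neq x0; exact: mx_norm_eq0.
have [[i j] /=] := mx_norm_neq0 h0; rewrite (ord1 i) => E.
rewrite (_ : `|x| = `|x ord0 j|); last exact: E.
by rewrite real_normK ?num_real// coord_le.
Qed.

Lemma coord_le_norm x i : `|x ord0 i| <= `|x|.
Proof.
rewrite [leRHS](_ : _ = mx_norm x)// mx_normrE; apply/bigmax_geP; right.
by exists (ord0, i).
Qed.

Lemma cvg_edot (T : Type) (F : set_system T) {FF : Filter F} (f g : T -> V) x y :
  f t @[t --> F] --> x -> g t @[t --> F] --> y ->
  edot (f t) (g t) @[t --> F] --> edot x y.
Proof.
move=> fx gy; apply: cvg_big => [|i _]; first exact: add_continuous.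
apply: cvgM; first exact: (cvg_comp _ _ fx (@coord_continuous _ _ _ ord0 i x)).
exact: (cvg_comp _ _ gy (@coord_continuous _ _ _ ord0 i y)).
Qed.

Lemma edot_continuous p : continuous (fun x => edot x p).
Proof. by move=> x; apply: (@cvg_edot _ (nbhs x) _ id (fun=> p)); [exact: cvg_id|exact: cvg_cst]. Qed.

Lemma enormE x : enorm x ^+ 2 = edot x x.
Proof. by rewrite sqr_sqrtr// edot_ge0. Qed.

Lemma enorm_sphere x : sphere x -> enorm x = 1.
Proof. by rewrite /enorm => ->; rewrite sqrtr1. Qed.

Lemma enorm_gt0 x : x != 0 -> 0 < enorm x.
Proof.
move=> x0; rewrite sqrtr_gt0 lt_neqAle edot_ge0 andbT eq_sym.
by apply: contra_neq x0; exact: edot_eq0.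
Qed.

Lemma enormZ a x : 0 <= a -> enorm (a *: x) = a * enorm x.
Proof.
move=> a0; rewrite /enorm edotZl edotZr mulrA -expr2 sqrtrM ?sqr_ge0//.
by rewrite sqrtr_sqr ger0_norm.
Qed.

Lemma cvg_enorm (T : Type) (F : set_system T) {FF : Filter F} (f : T -> V) x :
  f t @[t --> F] --> x -> enorm (f t) @[t --> F] --> enorm x.
Proof.
move=> fx; apply: (cvg_comp _ _ (cvg_edot fx fx)); exact: sqrt_continuous.
Qed.

Definition nrm x : V := (enorm x)^-1 *: x.

Lemma nrm_sphere x : x != 0 -> sphere (nrm x).
Proof.
move=> x0; rewrite /sphere /nrm /= edotZl edotZr -enormE.
by have := enorm_gt0 x0; move: (enorm x) => r r0; field; rewrite gt_eqF.
Qed.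

Lemma nrm_id x : sphere x -> nrm x = x.
Proof. by move=> sx; rewrite /nrm enorm_sphere// invr1 scale1r. Qed.

Lemma sphere_neq0 x : sphere x -> x != 0.
Proof.
rewrite /sphere /= => x1; apply/eqP => x0.
by move: x1; rewrite x0 edot0l => /esym/eqP; rewrite oner_eq0.
Qed.

Lemma nrmZ a x : 0 < a -> nrm (a *: x) = nrm x.
Proof.
move=> a0; rewrite /nrm enormZ ?ltW// scalerA invfM mulrAC mulVf ?gt_eqF//.
by rewrite mul1r.
Qed.

Lemma ext_sphere (u : V -> R) x : sphere x -> ext u x = u x.
Proof. by move=> sx; rewrite /ext -/(nrm x) nrm_id. Qed.

Lemma extE (u : V -> R) x : ext u x = u (nrm x).
Proof. by []. Qed.

Lemma cvg_nrm (T : Type) (F : set_system T) {FF : Filter F} (f : T -> V) x :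
  x != 0 -> f t @[t --> F] --> x -> nrm (f t) @[t --> F] --> nrm x.
Proof.
move=> x0 fx; apply: cvgZ => //; apply: cvgV; last exact: cvg_enorm.
by rewrite gt_eqF// enorm_gt0.
Qed.

Lemma cvg_nrm_sphere (T : Type) (F : set_system T) {FF : Filter F} (f : T -> V) x :
  sphere x -> f t @[t --> F] --> x -> nrm (f t) @[t --> F] --> x.
Proof. by move=> sx fx; rewrite -[X in _ --> X](nrm_id sx); apply: cvg_nrm => //; exact: sphere_neq0. Qed.

Lemma cvg_line x k : x + t *: k @[t --> (0 : R)] --> x.
Proof.
rewrite -[X in _ --> X]addr0 -[X in _ + X](scale0r k).
by apply: cvgD; [exact: cvg_cst|apply: cvgZ; [exact: cvg_id|exact: cvg_cst]].
Qed.

Lemma near_neq0 (T : Type) (F : set_system T) {FF : Filter F} (f : T -> V) x :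
  x != 0 -> f t @[t --> F] --> x -> \forall t \near F, f t != 0.
Proof.
move=> x0 fx.
have x1 : 0 < edot x x.
  by rewrite lt_neqAle edot_ge0 andbT eq_sym; apply: contra_neq x0; exact: edot_eq0.
have : \forall t \near F, 0 < edot (f t) (f t) by exact: cvgr_gt (cvg_edot fx fx) _ x1.
by apply: filterS => t; apply: contraTneq => ->; rewrite edot0l ltxx.
Qed.

Lemma edot_sphere_sub x y : sphere x -> sphere y ->
  edot (x - y) (x - y) = 2 - 2 * edot x y.
Proof. by rewrite /sphere /= => x1 y1; rewrite !edotE x1 y1 (edotC y x); ring. Qed.

Lemma edot_sphere_le x y : sphere x -> sphere y -> edot x y <= 1.
Proof. by move=> x1 y1; have := edot_ge0 (x - y); rewrite edot_sphere_sub//; lra. Qed.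

Lemma edot_sphere_ge x y : sphere x -> sphere y -> -1 <= edot x y.
Proof.
move=> x1 y1; have := @edot_sphere_le x (- y) x1; rewrite edotNr lerNl; apply.
by rewrite /sphere /= edotNl edotNr opprK.
Qed.

Lemma edot_sphere_eq1 x y : sphere x -> sphere y -> edot x y = 1 -> x = y.
Proof.
move=> x1 y1 xy; apply/subr0_eq/edot_eq0; rewrite edot_sphere_sub// xy; ring.
Qed.

Lemma xlastE x : xlast x = edot x (ebasis R ord_max).
Proof. by rewrite edot_basis. Qed.

Lemma sum_coord x y : \sum_(i < n.+1) x ord0 i * y ord0 i = edot x y.
Proof. by []. Qed.

Lemma row_sum_coord (c : V) x : (\sum_(i < n.+1) c ord0 i *: ebasis R i) = c.
Proof. by rewrite [RHS]row_sum_delta. Qed.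

(** [Q] is not taken symmetric: only its quadratic form and its trace carry meaning, and [C2_taylor]
    supplies a triangular one. *)
Definition bf Q x y : R := edot (x *m Q) y.

Lemma bfDl Q x y z : bf Q (x + y) z = bf Q x z + bf Q y z.
Proof. by rewrite /bf mulmxDl edotDl. Qed.
Lemma bfDr Q x y z : bf Q x (y + z) = bf Q x y + bf Q x z.
Proof. by rewrite /bf edotDr. Qed.
Lemma bfZl Q a x y : bf Q (a *: x) y = a * bf Q x y.
Proof. by rewrite /bf -scalemxAl edotZl. Qed.
Lemma bfZr Q a x y : bf Q x (a *: y) = a * bf Q x y.
Proof. by rewrite /bf edotZr. Qed.
Lemma bfZ Q a x y : bf (a *: Q) x y = a * bf Q x y.
Proof. by rewrite /bf -scalemxAr edotZl. Qed.
Lemma bfNl Q x y : bf Q (- x) y = - bf Q x y.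
Proof. by rewrite -scaleN1r bfZl mulN1r. Qed.
Lemma bfNr Q x y : bf Q x (- y) = - bf Q x y.
Proof. by rewrite -scaleN1r bfZr mulN1r. Qed.
Definition bfE := (bfDl, bfDr, bfNl, bfNr, bfZl, bfZr).

Lemma bf_basis Q i j : bf Q (ebasis R i) (ebasis R j) = Q i j.
Proof. by rewrite /bf -rowE edot_basis mxE. Qed.

Lemma trace_bf Q : \tr Q = \sum_(i < n.+1) bf Q (ebasis R i) (ebasis R i).
Proof. by apply: eq_bigr => i _; rewrite bf_basis. Qed.

Lemma bf_suml Q (c : V) y : \sum_(i < n.+1) c ord0 i * bf Q (ebasis R i) y = bf Q c y.
Proof.
rewrite -{2}(row_sum_coord c c) /bf mulmx_suml /edot.
under eq_bigr do rewrite mulr_sumr.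
rewrite exchange_big/=; apply: eq_bigr => i _.
rewrite summxE mulr_suml; apply: eq_bigr => j _.
by rewrite mulrA; congr (_ * _); rewrite -scalemxAl [RHS]mxE.
Qed.

Lemma bf_sumr Q (c : V) x : \sum_(i < n.+1) c ord0 i * bf Q x (ebasis R i) = bf Q x c.
Proof. by rewrite /bf; rewrite /edot; apply: eq_bigr => i _; rewrite -/(edot _ _) edot_basis mulrC. Qed.

End Edot.

(** * Second order expansions in several variables, homogeneity and the Laplacian *)

Section Taylor.
Variables (R : realType) (n : nat).
Local Notation V := 'rV[R]_(n.+1).
Implicit Types (x y z k l p v : V) (Q : 'M[R]_(n.+1)) (i j : 'I_n.+1) (U u W : V -> R).

(** [Q] absorbs the factor 1/2 of the Hessian, so the Laplacian is [2 * \tr Q]. The notion is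
    pointwise, so that it can be verified for the even extension at points of the equator. *)
Definition taylor U y l Q : Prop :=
  exists2 om : V -> R, om k @[k --> (0 : V)] --> (0 : R) &
    forall k, U (y + k) = U y + edot l k + bf Q k k + om k * edot k k.

Lemma taylor_intro U y l Q :
  (forall eps : R, 0 < eps ->
    \forall k \near (0 : V), `|U (y + k) - U y - edot l k - bf Q k k| <= eps * edot k k) ->
  taylor U y l Q.
Proof.
move=> h; exists (fun k => (U (y + k) - U y - edot l k - bf Q k k) / edot k k).
  apply/(@cvgrPdist_le _ _ _ _ (nbhs_filter (0 : V))) => e e0; have he := h e e0; near=> k.
  have hk : `|U (y + k) - U y - edot l k - bf Q k k| <= e * edot k k by near: k.
  rewrite sub0r normrN normrM normfV (ger0_norm (edot_ge0 k)).
  have [->|/eqP k0] := eqVneq (edot k k) 0; first by rewrite invr0 mulr0 ltW.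
  by rewrite ler_pdivrMr// lt_neqAle edot_ge0 andbT eq_sym; apply/eqP.
move=> k; have [k0|k0] := eqVneq (edot k k) 0.
  by rewrite k0 mulr0 (edot_eq0 k0) addr0 !edot0r /bf edot0r; ring.
by field.
Unshelve. all: by end_near. Qed.

Lemma taylor_near U U' y l Q : (\forall x \near y, U x = U' x) ->
  taylor U y l Q -> taylor U' y l Q.
Proof.
move=> UU' [om om0 hom]; apply: taylor_intro => e e0.
have Uy := nbhs_singleton UU'.
have h1 : \forall k \near (0 : V), U (y + k) = U' (y + k).
  have c : y + k @[k --> (0 : V)] --> y + 0 by exact: (cvgD (cvg_cst _) cvg_id).
  by rewrite addr0 in c; exact: (c _ UU').
have h2 : \forall k \near (0 : V), `|0 - om k| <= e by exact: (cvgr_dist_le _ _ om0 _ e0).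
near=> k; have <- : U (y + k) = U' (y + k) by near: k.
rewrite -Uy hom (_ : _ - _ - _ - _ = om k * edot k k); last by ring.
rewrite normrM (ger0_norm (edot_ge0 k)) ler_wpM2r ?edot_ge0// -normrN -sub0r.
by near: k.
Unshelve. all: by end_near. Qed.

(** The displacement along [v] is of order t^2, so it meets only the linear part [l]. Up to positive
    scaling, [kphi] maps coordinate lines to curves of this kind. *)
Lemma taylor_path U y l Q k v (rho : R -> R) (rho2 : R) :
  taylor U y l Q -> peano rho 0 0 rho2 ->
  peano (fun t => U (y + (t *: k + rho t *: v)))
    (U y) (edot l k) (bf Q k k + rho2 * edot l v).
Proof.
move=> [om omc UE] [q qc qE].
pose s t := t * q t.
have sc : s t @[t --> (0 : R)] --> (0 : R).
  by apply: (@cvg_eq_lim _ _ _ _ (0 * rho2)); [apply: cvgM => //; exact: cvg_id|rewrite mul0r].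
pose ka t := t *: (k + s t *: v).
have kaE t : t *: k + rho t *: v = ka t.
  by rewrite /ka /s qE scalerDr scalerA !add0r mul0r add0r; congr (_ + _ *: _); ring.
have kac : ka t @[t --> (0 : R)] --> (0 : V).
  rewrite -[X in _ --> X](scale0r (k + 0 *: v)); apply: cvgZ; first exact: cvg_id.
  by apply: cvgD; [exact: cvg_cst|apply: cvgZ => //; exact: cvg_cst].
pose qu (b0 b1 b2 : R) t := b0 + s t * b1 + s t * (s t * b2).
have quc b0 b1 b2 : qu b0 b1 b2 t @[t --> (0 : R)] --> b0.
  apply: (@cvg_eq_lim _ _ _ _ (b0 + 0 * b1 + 0 * (0 * b2))); last by ring.
  exact: (cvgD (cvgD (cvg_cst _) (cvgM sc (cvg_cst _))) (cvgM sc (cvgM sc (cvg_cst _)))).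
exists (fun t => q t * edot l v + qu (bf Q k k) (bf Q k v + bf Q v k) (bf Q v v) t
   + om (ka t) * qu (edot k k) (2 * edot k v) (edot v v) t).
  apply: (@cvg_eq_lim _ _ _ _ (rho2 * edot l v + bf Q k k + 0 * edot k k)); last by ring.
  apply: cvgD; [apply: cvgD => //; apply: cvgM => //; exact: cvg_cst|apply: cvgM => //].
  exact: (cvg_comp _ _ kac omc).
move=> t; rewrite kaE UE {1 2 4 5}/ka /qu !(edotE, bfE) (edotC v k) {1}/s; ring.
Qed.

Lemma taylor_line U y l Q k : taylor U y l Q ->
  peano (fun t => U (y + t *: k)) (U y) (edot l k) (bf Q k k).
Proof.
move=> tU; have := taylor_path k 0 tU (peano_cst 0).
rewrite mul0r addr0; apply: peano_ext => t; by rewrite scaler0 addr0.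
Qed.

(** Euler's relations for degree 0. The first two come from the constancy of [ext u] along
    [y + t y]. The mixed one compares [y + t p] with its multiple
    [(1 + t)(y + t p) = y + t (y + p) + t^2 p], on which [ext u] takes the same values. *)
Lemma taylor_hom u y l Q : taylor (ext u) y l Q ->
  [/\ edot l y = 0, bf Q y y = 0 &
    forall p, bf Q y p + bf Q p y = - edot l p].
Proof.
move=> tU.
have near_pos : \forall t \near (0 : R), 0 < 1 + t.
  near=> t; rewrite -ltrBlDl sub0r; near: t.
  by apply: nbhs_right_gt_tmp || exact: lt_nbhsr.
have homE t z : 0 < 1 + t -> ext u ((1 + t) *: z) = ext u z.
  by move=> t0; rewrite !extE nrmZ.
have [|_ ly qy] := @peano_unique R _ _ _ _ _ _ _ (taylor_line y tU) (_ : peano _ (ext u y) 0 0).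
  apply: peano_near (peano_cst _); near=> t.
  rewrite -{2}[y]scale1r -scalerDl homE//; near: t; exact: near_pos.
split=> // p.
have pt2 : peano (fun t : R => t * t) 0 0 1.
  by exists (fun=> 1); [exact: cvg_cst|move=> t; ring].
have h1 := taylor_path (y + p) p tU pt2.
have h2 := taylor_line p tU.
have h3 : peano (fun t => ext u (y + t *: p)) (ext u y) (edot l (y + p)) (bf Q (y + p) (y + p) + 1 * edot l p).
  apply: peano_near h1; near=> t.
  rewrite -(homE t (y + t *: p)); last by near: t; exact: near_pos.
  by congr (ext u _); apply/rowP => i; rewrite !mxE; ring.
have [_ _] := peano_unique h3 h2; rewrite !bfE qy mul1r => h.
by apply/eqP; rewrite -subr_eq0 opprK; apply/eqP; rewrite -[RHS](subrr (bf Q p p)) -{1}h; ring.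
Unshelve. all: by end_near. Qed.

Lemma taylor_scale u y l Q (c : R) : 0 < c -> taylor (ext u) y l Q ->
  taylor (ext u) (c *: y) (c^-1 *: l) (c^-2 *: Q).
Proof.
move=> c0 [om omc UE]; have cn0 : c != 0 by rewrite gt_eqF.
exists (fun k => om (c^-1 *: k) * c^-2).
  have h0 : c^-1 *: k @[k --> (0 : V)] --> (0 : V).
    have h := cvgZ (cvg_cst c^-1) (@cvg_id _ (nbhs (0 : V))).
    by rewrite scaler0 in h; exact: h.
  have h1 : om (c^-1 *: k) @[k --> (0 : V)] --> (0 : R) := cvg_comp _ _ h0 omc.
  refine (@cvg_eq_lim _ _ _ _ (0 * c^-2) _ _ (mul0r _)).
  exact: (cvgM h1 (cvg_cst _)).
move=> k; have -> : c *: y + k = c *: (y + c^-1 *: k).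
  by rewrite scalerDr scalerA divff// scale1r.
have homE z : ext u (c *: z) = ext u z by rewrite !extE nrmZ.
by rewrite !homE UE !(edotE, bfE) bfZ; field.
Qed.

Definition refl (e x : V) : V := x - (2 * edot x e) *: e.

Lemma reflD e x y : refl e (x + y) = refl e x + refl e y.
Proof. by rewrite /refl edotDl mulrDr scalerDl opprD addrACA. Qed.

Lemma reflZ e c x : refl e (c *: x) = c *: refl e x.
Proof. by rewrite /refl edotZl scalerBr scalerA; congr (_ - _ *: _); ring. Qed.

Lemma edot_refl e x y : edot e e = 1 -> edot (refl e x) (refl e y) = edot x y.
Proof. by move=> e1; rewrite /refl !edotE e1 (edotC e y); ring. Qed.

Lemma reflK e x : edot e e = 1 -> refl e (refl e x) = x.
Proof.
move=> e1; rewrite /refl !edotE e1; apply/rowP => i; rewrite !mxE; ring.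
Qed.

Lemma cvg_refl (T : Type) (F : set_system T) {FF : Filter F} (f : T -> V) x e :
  f t @[t --> F] --> x -> refl e (f t) @[t --> F] --> refl e x.
Proof.
move=> fx; apply: cvgB => //; apply: cvgZ; last exact: cvg_cst.
by apply: cvgM; [exact: cvg_cst|apply: cvg_edot => //; exact: cvg_cst].
Qed.

Lemma taylor_refl U y l Q e : edot e e = 1 -> taylor U (refl e y) l Q ->
  exists l' Q', taylor (fun x => U (refl e x)) y l' Q' /\ \tr Q' = \tr Q.
Proof.
move=> e1 [om omc UE].
pose A : 'M[R]_(n.+1) := 1%:M - 2 *: (e^T *m e).
have rA x : x *m A = refl e x.
  rewrite /A mulmxBr mulmx1 /refl -scalemxAr mulmxA -scalerA; congr (_ - 2 *: _).
  have -> : x *m e^T = (edot x e)%:M.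
    by apply/matrixP => i j; rewrite !ord1 !mxE eqxx mulr1n; apply: eq_bigr => k _; rewrite mxE.
  by rewrite mul_scalar_mx.
have bfA x z : bf (A *m Q *m A^T) x z = bf Q (refl e x) (refl e z).
  have edotM a b : edot a b = (a *m b^T) ord0 ord0.
    by rewrite mxE; apply: eq_bigr => i _; rewrite mxE.
  by rewrite /bf !edotM -!rA trmx_mul !mulmxA.
exists (refl e l), (A *m Q *m A^T); split.
  exists (fun k => om (refl e k)).
    have h : refl e k @[k --> (0 : V)] --> (0 : V).
      have h := cvg_refl (e := e) (@cvg_id _ (nbhs (0 : V))).
      have r0 : refl e 0 = 0 by rewrite /refl edot0l mulr0 scale0r subr0.
      by rewrite r0 in h; exact: h.
    exact: (cvg_comp _ _ h omc).
  move=> k; rewrite reflD UE bfA edot_refl//; congr (_ + _ + _ + _).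
  by rewrite -(edot_refl l _ e1) reflK.
rewrite !trace_bf; under eq_bigr do rewrite bfA /refl !bfE.
rewrite (eq_bigr (fun i => bf Q (ebasis R i) (ebasis R i)
   - 2 * (e ord0 i * bf Q (ebasis R i) e) - 2 * (e ord0 i * bf Q e (ebasis R i))
   + 4 * (e ord0 i * e ord0 i) * bf Q e e)); last first.
  by move=> i _; rewrite basis_edot; ring.
rewrite !big_split/= !sumrN -!mulr_sumr -mulr_suml -mulr_sumr bf_suml bf_sumr sum_coord e1.
ring.
Qed.

Definition has_lap W x (la : R) : Prop :=
  exists a1 a2 : 'I_n.+1 -> R,
    (forall i, peano (fun t => ext W (x + t *: ebasis R i)) (W x) (a1 i) (a2 i)) /\
    2 * \sum_i a2 i = la.

Lemma taylor_has_lap u x l Q : sphere x -> taylor (ext u) x l Q ->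
  has_lap u x (2 * \tr Q).
Proof.
move=> sx tU; exists (fun i => edot l (ebasis R i)), (fun i => bf Q (ebasis R i) (ebasis R i)).
split=> [i|]; last by rewrite trace_bf.
by rewrite -(ext_sphere u sx); exact: taylor_line.
Qed.

Lemma has_lapD W1 W2 x a b : has_lap W1 x a -> has_lap W2 x b ->
  has_lap (fun y => W1 y + W2 y) x (a + b).
Proof.
move=> [a1 [a2 [h1 <-]]] [b1 [b2 [h2 <-]]].
exists (fun i => a1 i + b1 i), (fun i => a2 i + b2 i); split.
  by move=> i; have := peanoD (h1 i) (h2 i).
by rewrite big_split mulrDr.
Qed.

Lemma has_lapZ c W x a : has_lap W x a -> has_lap (fun y => c * W y) x (c * a).
Proof.
move=> [a1 [a2 [h1 <-]]]; exists (fun i => c * a1 i), (fun i => c * a2 i); split.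
  by move=> i; have := peanoZ c (h1 i).
by rewrite -mulr_sumr; ring.
Qed.

Lemma has_lap_cst c x : has_lap (fun=> c) x 0.
Proof.
exists (fun=> 0), (fun=> 0); split=> [i|]; first exact: peano_cst.
by rewrite big1 ?mulr0.
Qed.

Lemma near_line x k (P : V -> Prop) : sphere x -> (\forall y \near x, P y) ->
  \forall t \near (0 : R), sphere (nrm (x + t *: k)) /\ P (nrm (x + t *: k)).
Proof.
move=> sx nP.
have c : nrm (x + t *: k) @[t --> (0 : R)] --> x.
  by apply: cvg_nrm_sphere sx _; exact: cvg_line.
have cn : \forall t \near (0 : R), P (nrm (x + t *: k)) := c _ nP.
have nz : \forall t \near (0 : R), x + t *: k != 0.
  exact: (@near_neq0 _ _ _ _ _ (fun t => x + t *: k) _ (sphere_neq0 sx) (@cvg_line _ _ x k)).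
near=> t; split; last by near: t.
by apply: nrm_sphere; near: t.
Unshelve. all: by end_near. Qed.

Lemma lap_min W x a : sphere x ->
  (\forall y \near x, sphere y -> W x <= W y) -> has_lap W x a -> 0 <= a.
Proof.
move=> sx ne [a1 [a2 [h1 <-]]].
rewrite mulr_ge0// sumr_ge0// => i _.
have [//|//] := peano_min _ (h1 i).
by apply: filterS (near_line (ebasis R i) sx ne) => t [st]; exact.
Qed.

End Taylor.

(** * Laplacians of functions of one linear coordinate *)

Section SphericalFunctions.
Variables (R : realType) (n : nat).
Local Notation V := 'rV[R]_(n.+1).
Implicit Types (x y z k l p v : V) (Q : 'M[R]_(n.+1)) (i j : 'I_n.+1) (u W : V -> R).

Lemma line_neq0 x k : sphere x -> \forall t \near (0 : R), x + t *: k != 0.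
Proof.
move=> sx.
exact: (@near_neq0 _ _ _ _ _ (fun t => x + t *: k) _ (sphere_neq0 sx) (@cvg_line _ _ x _)).
Qed.

Lemma peano_powR_enorm x i (al : R) : sphere x ->
  peano (fun t => edot (x + t *: ebasis R i) (x + t *: ebasis R i) `^ al)
    1 (al * (2 * x ord0 i)) (al + al * (al - 1) / 2 * (2 * x ord0 i) ^+ 2).
Proof.
move=> sx.
have sq : peano (fun t => edot (x + t *: ebasis R i) (x + t *: ebasis R i))
    1 (2 * x ord0 i) 1.
  exists (fun=> 1); first exact: cvg_cst.
  move=> t; rewrite !edotE basis_edot edot_basis edot_basis_diag.
  by rewrite (_ : edot x x = 1)//; ring.
have := peano_comp (G := fun y : R => y `^ al) (peano_powR al ltr01) sq.
by rewrite !powR1 !mulr1.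
Qed.

Lemma peano_enorm x i : sphere x ->
  peano (fun t => enorm (x + t *: ebasis R i))
    1 (x ord0 i) ((1 - x ord0 i ^+ 2) / 2).
Proof.
move=> sx; have := @peano_powR_enorm x i 2^-1 sx.
rewrite (_ : 2^-1 * (2 * x ord0 i) = x ord0 i); last by field.
rewrite (_ : 2^-1 + _ = (1 - x ord0 i ^+ 2) / 2); last by field.
by apply: peano_ext => t; rewrite powR12_sqrt// edot_ge0.
Qed.

Lemma peano_enormV x i : sphere x ->
  peano (fun t => (enorm (x + t *: ebasis R i))^-1)
    1 (- x ord0 i) ((3 * x ord0 i ^+ 2 - 1) / 2).
Proof.
move=> sx; have := @peano_powR_enorm x i (- 2^-1) sx.
rewrite (_ : - 2^-1 * (2 * x ord0 i) = - x ord0 i); last by field.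
rewrite (_ : - 2^-1 + _ = (3 * x ord0 i ^+ 2 - 1) / 2); last by field.
by apply: peano_ext => t; rewrite powRN powR12_sqrt// edot_ge0.
Qed.

Lemma peano_edot_nrm x p i : sphere x ->
  peano (fun t => edot (nrm (x + t *: ebasis R i)) p) (edot x p)
    (p ord0 i - edot x p * x ord0 i)
    (edot x p * ((3 * x ord0 i ^+ 2 - 1) / 2) - p ord0 i * x ord0 i).
Proof.
move=> sx; have := peanoM (peano_enormV i sx) (peano_id (edot x p) (p ord0 i)).
rewrite mul1r (_ : 1 * p ord0 i + _ = p ord0 i - edot x p * x ord0 i); last by ring.
rewrite (_ : 1 * 0 + _ + _ =
  edot x p * ((3 * x ord0 i ^+ 2 - 1) / 2) - p ord0 i * x ord0 i); last by ring.
by apply: peano_ext => t; rewrite /nrm edotZl edotDl edotZl basis_edot.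
Qed.

(** This is the classical (|p|^2 - tau^2) G'' - n tau G' with tau = x.p, where [G2] stands for
    G''/2. It serves all barriers below. *)
Lemma has_lap_edot (G : R -> R) x p (G1 G2 : R) : sphere x ->
  peano (fun h => G (edot x p + h)) (G (edot x p)) G1 G2 ->
  has_lap (fun y => G (edot y p)) x
    (2 * (G2 * (edot p p - edot x p ^+ 2)) - n%:R * edot x p * G1).
Proof.
move=> sx pG; set tau := edot x p.
exists (fun i => G1 * (p ord0 i - tau * x ord0 i)),
  (fun i => G1 * (tau * ((3 * x ord0 i ^+ 2 - 1) / 2) - p ord0 i * x ord0 i)
            + G2 * (p ord0 i - tau * x ord0 i) ^+ 2).
split; first by move=> i; exact: peano_comp pG (peano_edot_nrm p i sx).
rewrite (eq_bigr (fun i => - (G1 * tau / 2)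
   + (3 / 2 * G1 * tau + G2 * tau ^+ 2) * (x ord0 i * x ord0 i)
   + (- G1 - 2 * G2 * tau) * (x ord0 i * p ord0 i) + G2 * (p ord0 i * p ord0 i)));
  last by move=> i _; field.
rewrite !big_split/= -!mulr_sumr !sum_coord sumr_const card_ord (_ : edot x x = 1)//.
by rewrite -/tau -mulr_natr -natr1; field.
Qed.

End SphericalFunctions.

(** * The conformal involution and the covariance of the Laplacian *)

Section Kelvin.
Variables (R : realType) (n : nat).
Local Notation V := 'rV[R]_(n.+1).
Implicit Types (x y z k l p v : V) (Q : 'M[R]_(n.+1)) (i j : 'I_n.+1) (u W : V -> R).

(** For unit [x] and [p] this is |x - mu p|^2. For [mu > 0], [kphi mu p] is the restriction to the
    sphere of the inversion with centre p / mu and squared radius mu^-2 - 1, whose sphere meets the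
    unit sphere orthogonally; at [mu = 0] it becomes the reflection in the hyperplane orthogonal to
    [p]. *)
Definition kden (mu : R) p x : R := 1 + mu ^+ 2 - 2 * mu * edot x p.
Definition kfac (mu : R) p x : R := (1 - mu ^+ 2) / kden mu p x.
Definition kphi (mu : R) p x : V :=
  (kden mu p x)^-1 *: ((1 - mu ^+ 2) *: x + (2 * (mu - edot x p)) *: p).
Definition kelvin (a mu : R) p u x : R := kfac mu p x `^ a * u (kphi mu p x).

Lemma kden_gt0 mu p x : 0 <= mu < 1 -> sphere p -> sphere x -> 0 < kden mu p x.
Proof.
move=> /andP[m0 m1] sp sx; rewrite /kden.
have t1 := edot_sphere_le sx sp.
have : 2 * mu * edot x p <= 2 * mu * 1 by rewrite ler_wpM2l// mulr_ge0.
have : 0 < (1 - mu) ^+ 2 by rewrite exprn_gt0// subr_gt0.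
lra.
Qed.

Lemma kfac_gt0 mu p x : 0 <= mu < 1 -> sphere p -> sphere x -> 0 < kfac mu p x.
Proof.
move=> mu01 sp sx; rewrite divr_gt0 ?kden_gt0//.
by move: mu01 => /andP[m0 m1]; rewrite subr_gt0 expr_lt1.
Qed.

Lemma kphi_sphere mu p x : 0 <= mu < 1 -> sphere p -> sphere x -> sphere (kphi mu p x).
Proof.
move=> mu01 sp sx; have d0 := kden_gt0 mu01 sp sx.
rewrite /sphere /= /kphi !edotE (_ : edot x x = 1)// (_ : edot p p = 1)// (edotC p x).
have dE : kden mu p x = 1 + mu ^+ 2 - 2 * mu * edot x p by [].
by rewrite dE; move: (edot x p) dE d0 => tau -> d0; field; rewrite gt_eqF.
Qed.

(** The i-th summand in the Laplacian of the Kelvin transform is sorted into this shape, which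
    reduces the sum over coordinates to one identity between scalars. *)
Lemma sum_quad l x p Q (c0 c1 c2 c3 c4 c5 c6 c7 c8 c9 c10 : R) :
  \sum_(i < n.+1) (c0 + c1 * (x ord0 i * x ord0 i) + c2 * (x ord0 i * p ord0 i)
    + c3 * (p ord0 i * p ord0 i) + c4 * (x ord0 i * l ord0 i)
    + c5 * (p ord0 i * l ord0 i) + c6 * bf Q (ebasis R i) (ebasis R i)
    + c7 * (x ord0 i * bf Q (ebasis R i) p) + c8 * (p ord0 i * bf Q (ebasis R i) p)
    + c9 * (x ord0 i * bf Q p (ebasis R i)) + c10 * (p ord0 i * bf Q p (ebasis R i)))
  = n.+1%:R * c0 + c1 * edot x x + c2 * edot x p + c3 * edot p p + c4 * edot x l
    + c5 * edot p l + c6 * \tr Q + c7 * bf Q x p + c8 * bf Q p p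
    + c9 * bf Q p x + c10 * bf Q p p.
Proof.
rewrite !big_split/= -!mulr_sumr !sum_coord !bf_suml !bf_sumr -trace_bf.
by rewrite sumr_const card_ord mulr_natl.
Qed.

Lemma peano_kfac (a mu : R) p x i : 0 <= mu < 1 -> sphere p -> sphere x ->
  let tau := edot x p in let E := kden mu p x in
  peano (fun t => kfac mu p (nrm (x + t *: ebasis R i)) `^ a) (kfac mu p x `^ a)
   (kfac mu p x `^ a * (2 * a * mu / E * (p ord0 i - tau * x ord0 i)))
   (kfac mu p x `^ a * (2 * a * mu / E * (tau * ((3 * x ord0 i ^+ 2 - 1) / 2) - p ord0 i * x ord0 i)
     + 2 * a * (a + 1) * mu ^+ 2 / E ^+ 2 * (p ord0 i - tau * x ord0 i) ^+ 2)).
Proof.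
move=> mu01 sp sx tau E; set m : R := 1 - mu ^+ 2.
have E0 : 0 < E := kden_gt0 mu01 sp sx.
have En : E != 0 by rewrite gt_eqF.
have m0 : 0 < m by move: mu01 => /andP[m0 m1]; rewrite subr_gt0 expr_lt1.
have EE : E = 1 + mu ^+ 2 - 2 * mu * tau by [].
set K := kfac mu p x `^ a.
have pE : peano (fun t => kden mu p (nrm (x + t *: ebasis R i))) E
   (- (2 * mu) * (p ord0 i - tau * x ord0 i))
   (- (2 * mu) * (tau * ((3 * x ord0 i ^+ 2 - 1) / 2) - p ord0 i * x ord0 i)).
  have := peanoD (peano_cst (1 + mu ^+ 2)) (peanoZ (- (2 * mu)) (peano_edot_nrm p i sx)).
  rewrite !add0r (_ : 1 + mu ^+ 2 + - (2 * mu) * edot x p = E); last by rewrite EE -/tau; ring.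
  by apply: peano_ext => t; rewrite /kden; ring.
have := peanoZ (m `^ a) (peano_comp (G := fun y : R => y `^ (- a)) (peano_powR (- a) E0) pE).
have powE (b : nat) : E `^ (- a - b%:R) = E `^ (- a) / E ^+ b.
  by rewrite -(powR_mulrn b (ltW E0)) -powRB// En implybT.
have KE : K = m `^ a * E `^ (- a).
  by rewrite /K /kfac -/E -/m powRM ?invr_ge0 ?ltW// -powR_inv1 ?ltW// -powRrM mulN1r.
rewrite -KE (powE 1%N) (powE 2%N) expr1.
rewrite (_ : m `^ a * _ = K * (2 * a * mu / E * (p ord0 i - tau * x ord0 i))); last by rewrite KE; field.
set f2 := (X in _ -> peano _ _ _ (K * X)).
rewrite (_ : m `^ a * _ = K * f2); last by rewrite KE /f2; field.
have nz := line_neq0 (ebasis R i) sx.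
apply: peano_near; near=> t.
have sn : sphere (nrm (x + t *: ebasis R i)) by apply: nrm_sphere; near: t.
have dn := kden_gt0 mu01 sp sn.
by rewrite /kfac -/m powRM ?invr_ge0 ?ltW// -(powR_inv1 (ltW dn)) -powRrM mulN1r.
Unshelve. all: by end_near. Qed.

(** [ext u] ignores positive factors, so the image point may be multiplied by [d * r / E], with [d]
    the denominator at the moving point and [r] the norm of [x + t e_i]. This clears the
    denominators depending on t, and the only remaining nonlinearity in t is [r]. *)
Lemma kphi_line (mu : R) p u x i : 0 <= mu < 1 -> sphere p -> sphere x ->
  let E := kden mu p x in
  \forall t \near (0 : R), u (kphi mu p (nrm (x + t *: ebasis R i))) =
    ext u (kphi mu p x
      + (t *: (E^-1 *: ((1 - mu ^+ 2) *: ebasis R i + (2 * (mu * x ord0 i - p ord0 i)) *: p))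
      + (enorm (x + t *: ebasis R i) - 1 - t * x ord0 i) *: ((2 * mu / E) *: p))).
Proof.
move=> mu01 sp sx E; set tau := edot x p.
have En : E != 0 by rewrite gt_eqF ?kden_gt0.
have near_nz := line_neq0 (ebasis R i) sx.
near=> t.
have nz : x + t *: ebasis R i != 0 by near: t.
have sn := nrm_sphere nz.
rewrite -(ext_sphere u (kphi_sphere mu01 sp sn)).
have r0 := enorm_gt0 nz; set r := enorm _ in r0 *.
have rE : nrm (x + t *: ebasis R i) = r^-1 *: (x + t *: ebasis R i) by [].
have d0 := kden_gt0 mu01 sp sn.
set d := kden mu p (nrm (x + t *: ebasis R i)) in d0.
have c0 : 0 < d * r / E by rewrite divr_gt0 ?mulr_gt0// kden_gt0.
rewrite -[LHS](_ : ext u ((d * r / E) *: kphi mu p (nrm (x + t *: ebasis R i))) = _);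
  last by rewrite !extE nrmZ.
congr (ext u _); rewrite /kphi -/d -/E -/tau rE edotZl edotDl edotZl basis_edot -/tau.
have rn : r != 0 by rewrite gt_eqF.
have dn : d != 0 by rewrite gt_eqF.
move: (ebasis R i) (x ord0 i) (p ord0 i) => b xi pi'.
by apply/rowP => j; rewrite !mxE; field; rewrite En rn dn.
Unshelve. all: by end_near. Qed.

(* The first-order terms cancel because the weight is the conformal one,
   [n = 2 (a + 1)]. *)
Lemma has_lap_kelvin (a mu : R) p u x l Q : n%:R = 2 * (a + 1) ->
  0 <= mu < 1 -> sphere p -> sphere x -> taylor (ext u) (kphi mu p x) l Q ->
  has_lap (kelvin a mu p u) x
   (kfac mu p x `^ a * (kfac mu p x ^+ 2 * (2 * \tr Q)
      + a * (a + 1) * (1 - kfac mu p x ^+ 2) * u (kphi mu p x))).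
Proof.
move=> na mu01 sp sx tU.
have sy := kphi_sphere mu01 sp sx.
set y := kphi mu p x in tU sy *; set tau := edot x p; set E := kden mu p x.
set m : R := 1 - mu ^+ 2.
have E0 : 0 < E := kden_gt0 mu01 sp sx.
have En : E != 0 by rewrite gt_eqF.
have m0 : 0 < m by move: mu01 => /andP[m0 m1]; rewrite subr_gt0 expr_lt1.
have mn : m != 0 by rewrite gt_eqF.
have EE : E = 1 + mu ^+ 2 - 2 * mu * tau by [].
have [ly _ Qyp] := taylor_hom tU.
pose K := kfac mu p x `^ a.
pose f1 i := 2 * a * mu / E * (p ord0 i - tau * x ord0 i).
pose f2 i := 2 * a * mu / E * (tau * ((3 * x ord0 i ^+ 2 - 1) / 2) - p ord0 i * x ord0 i)
   + 2 * a * (a + 1) * mu ^+ 2 / E ^+ 2 * (p ord0 i - tau * x ord0 i) ^+ 2.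
have pK i : peano (fun t => kfac mu p (nrm (x + t *: ebasis R i)) `^ a) K (K * f1 i) (K * f2 i).
  exact: peano_kfac.
pose k i := E^-1 *: (m *: ebasis R i + (2 * (mu * x ord0 i - p ord0 i)) *: p).
pose v := (2 * mu / E) *: p.
pose g1 i := edot l (k i).
pose g2 i := bf Q (k i) (k i) + (1 - x ord0 i ^+ 2) / 2 * edot l v.
have pU i : peano (fun t => u (kphi mu p (nrm (x + t *: ebasis R i)))) (u y) (g1 i) (g2 i).
  have pr : peano (fun t => enorm (x + t *: ebasis R i) - 1 - t * x ord0 i) 0 0
      ((1 - x ord0 i ^+ 2) / 2).
    have := peanoD (peano_enorm i sx) (peano_id (-1) (- x ord0 i)).
    rewrite !subrr addr0; apply: peano_ext => t; ring.
  have := taylor_path (k i) v tU pr.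
  rewrite (ext_sphere u sy).
  by apply: peano_near; apply: filterS (kphi_line u i mu01 sp sx) => t ->.
exists (fun i => K * g1 i + K * f1 i * u y),
  (fun i => K * g2 i + K * f1 i * g1 i + K * f2 i * u y); split.
  by move=> i; exact: peanoM (pK i) (pU i).
rewrite (eq_bigr (fun i => K * (g2 i + f1 i * g1 i + f2 i * u y))); last by move=> i _; ring.
rewrite -mulr_sumr.
have -> : \sum_i (g2 i + f1 i * g1 i + f2 i * u y) =
  (kfac mu p x ^+ 2 * (2 * \tr Q) + a * (a + 1) * (1 - kfac mu p x ^+ 2) * u y) / 2; last by rewrite -/K; field.
have k1 i : edot l (k i) = E^-1 * (m * l ord0 i + 2 * (mu * x ord0 i - p ord0 i) * edot l p).
  by rewrite /k !edotE edot_basis.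
rewrite (eq_bigr (fun i => (mu / E * edot l p - a * mu * tau / E * u y)
   + (4 * mu ^+ 2 / E ^+ 2 * bf Q p p - mu / E * edot l p
      - 4 * a * mu ^+ 2 * tau / E ^+ 2 * edot l p
      + (3 * a * mu * tau / E + 2 * a * (a + 1) * mu ^+ 2 * tau ^+ 2 / E ^+ 2) * u y)
       * (x ord0 i * x ord0 i)
   + (- (8 * mu) / E ^+ 2 * bf Q p p + 4 * a * mu * (mu + tau) / E ^+ 2 * edot l p
      + (- (2 * a * mu) / E - 4 * a * (a + 1) * mu ^+ 2 * tau / E ^+ 2) * u y)
       * (x ord0 i * p ord0 i)
   + (4 / E ^+ 2 * bf Q p p - 4 * a * mu / E ^+ 2 * edot l p
      + 2 * a * (a + 1) * mu ^+ 2 / E ^+ 2 * u y) * (p ord0 i * p ord0 i)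
   + (- (2 * a * mu * tau * m) / E ^+ 2) * (x ord0 i * l ord0 i)
   + (2 * a * mu * m / E ^+ 2) * (p ord0 i * l ord0 i)
   + (m ^+ 2 / E ^+ 2) * bf Q (ebasis R i) (ebasis R i)
   + (2 * m * mu / E ^+ 2) * (x ord0 i * bf Q (ebasis R i) p)
   + (- (2 * m) / E ^+ 2) * (p ord0 i * bf Q (ebasis R i) p)
   + (2 * m * mu / E ^+ 2) * (x ord0 i * bf Q p (ebasis R i))
   + (- (2 * m) / E ^+ 2) * (p ord0 i * bf Q p (ebasis R i)))); last first.
  move=> i _; rewrite /g2 /g1 k1 /f1 /f2 /v /k !bfE edotZr; field; exact: En.
rewrite sum_quad (_ : edot x x = 1)// (_ : edot p p = 1)// -/tau.
(* As [y] is a combination of [x] and [p], Euler's relations at [y] can be solved for [edot x l] and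
   [bf Q p x]; the remaining quantities are independent and [field] applies. *)
have lx : edot x l = - (2 * (mu - tau) * edot l p) / m.
  have := ly; rewrite /y /kphi -/E -/m -/tau !edotE => /eqP.
  rewrite mulf_eq0 invr_eq0 (negbTE En)/= addr_eq0 => /eqP h.
  by apply: (mulfI mn); rewrite (edotC x l) h; field.
have bpx : bf Q p x = - (E * edot l p + 4 * (mu - tau) * bf Q p p) / m - bf Q x p.
  have := Qyp p; rewrite /y /kphi -/E -/m -/tau !bfE => h.
  have h2 : m * (bf Q x p + bf Q p x) + 4 * (mu - tau) * bf Q p p = - edot l p * E.
    by rewrite -h; field.
  apply: (mulfI mn); have -> : m * bf Q p x = - edot l p * E - 4 * (mu - tau) * bf Q p p - m * bf Q x p.
    by rewrite -h2; ring.
  by field.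
rewrite lx bpx (edotC p l) /kfac -/E -/m -natr1 na.
have tauE : 2 * mu * tau = 1 + mu ^+ 2 - E by rewrite EE; ring.
move: (edot l p) (bf Q p p) (bf Q x p) (\tr Q) (u y) => L B1 B2 T w.
rewrite /m in mn *; rewrite EE in En *; field; by rewrite mn En.
Unshelve. all: by end_near. Qed.

End Kelvin.

(** * Taylor expansion from continuous second partial derivatives *)

Section C2Taylor.
Variables (R : realType) (n : nat).
Local Notation V := 'rV[R]_(n.+1).
Implicit Types (x y k : V) (i j : 'I_n.+1) (g G U : V -> R).

Lemma mvt_bound (g : R -> R) (T M : R) :
  (forall s : R, `|s| <= `|T| -> exists2 d, is_derive s 1 g d & `|d| <= M) ->
  `|g T - g 0| <= M * `|T|.
Proof.
move=> gD.
have gd (s : R) : `|s| <= `|T| -> is_derive s 1 g ('D_1 g s) /\ `|'D_1 g s| <= M.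
  by move=> /gD[d dd dM]; split; [case: dd => dd1 _; exact/derivableP|case: dd => _ ->].
have cont (a b : R) : (forall s, a <= s <= b -> `|s| <= `|T|) ->
    {within `[a, b], continuous g}.
  move=> h; apply: derivable_within_continuous => s; rewrite in_itv /= => /h /gd [[]].
  by [].
have key : exists2 s, `|s| <= `|T| & g T - g 0 = 'D_1 g s * T.
  case: (ltgtP T 0) => [tn|tp|->]; last by exists 0; rewrite ?subrr ?mulr0// normr0.
  - have hb s : T <= s <= 0 -> `|s| <= `|T| by move=> /andP[? ?]; rewrite !ler0_norm ?lerN2 // ltW.
    have [] := @MVT R g ('D_1 g) T 0 tn.
    + by move=> s; rewrite in_itv /= => /andP[? ?]; apply: (gd _ _).1; apply: hb; rewrite !ltW.
    + exact: cont.
    + move=> s; rewrite in_itv /= => /andP[? ?] E; exists s; first by apply: hb; rewrite !ltW.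
      by rewrite -opprB E; ring.
  - have hb s : 0 <= s <= T -> `|s| <= `|T| by move=> /andP[? ?]; rewrite !ger0_norm // ltW.
    have [] := @MVT R g ('D_1 g) 0 T tp.
    + by move=> s; rewrite in_itv /= => /andP[? ?]; apply: (gd _ _).1; apply: hb; rewrite !ltW.
    + exact: cont.
    + move=> s; rewrite in_itv /= => /andP[? ?] E; exists s; first by apply: hb; rewrite !ltW.
      by rewrite E; ring.
case: key => s sT ->; rewrite normrM ler_wpM2r//; exact: (gd _ sT).2.
Qed.

Lemma is_derive_shift0 (g : R -> R) (s d : R) :
  is_derive (0 : R) 1 (fun r => g (s + r)) d -> is_derive s 1 g d.
Proof.
move=> gd.
have sh : is_derive s 1 (fun r : R => r - s) 1.
  by rewrite -[1 in X in is_derive _ _ _ X]subr0; exact: is_deriveB.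
have gd' : is_derive (s - s) 1 (fun r => g (s + r)) d by rewrite subrr.
have := @is_derive1_comp _ (fun r => g (s + r)) (fun r => r - s) s _ _ gd' sh.
rewrite mulr1; congr is_derive.
by apply/funext => r /=; rewrite addrC subrK.
Qed.

Lemma is_derive_line g y v (d : R) :
  is_derive y v g d -> is_derive (0 : R) 1 (fun s => g (y + s *: v)) d.
Proof.
have E : (fun h : R => h^-1 *: (((fun s : R => g (y + s *: v)) \o shift 0) (h *: 1) - g (y + 0 *: v)))
  = (fun h : R => h^-1 *: ((g \o shift y) (h *: v) - g y)).
  apply/funext => h /=; rewrite addr0 scale0r addr0 [y + _]addrC.
  by rewrite (_ : h *: 1 = h)// /GRing.scale /= mulr1.
by move=> [gd <-]; split; rewrite /derivable /derive /= E.
Qed.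

(** The way from [x] to [x + k] is cut into n + 1 legs parallel to the axes. On the i-th leg the
    coordinates beyond i are still 0; the hypothesis records this because the triangular [Q] of
    [C2_taylor] relies on it. *)
Lemma telescope_bound G x (del M : R) : 0 <= M ->
  (forall k i, `|k| <= del -> (forall j, (i < j)%N -> k ord0 j = 0) ->
     exists2 d, is_derive (0 : R) 1 (fun s => G (x + k + s *: ebasis R i)) d & `|d| <= M) ->
  forall k, `|k| <= del -> `|G (x + k) - G x| <= n.+1%:R * (M * `|k|).
Proof.
move=> M0 GD k kd.
pose tr (m : nat) : V := \row_j (if (j < m)%N then k ord0 j else 0).
have step (i : 'I_n.+1) : `|G (x + tr i.+1) - G (x + tr i)| <= M * `|k|.
  have trS : tr i.+1 = tr i + k ord0 i *: ebasis R i.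
    apply/rowP => j; rewrite /ebasis !mxE /= ltnS leq_eqVlt.
    case: (eqVneq j i) => [->|ji]; first by rewrite eqxx ltnn /= mulr1 add0r.
    by rewrite (negbTE (_ : (j : nat) != i))//= mulr0 addr0.
  have := @mvt_bound (fun s => G (x + tr i + s *: ebasis R i)) (k ord0 i) M.
  rewrite scale0r addr0 -addrA -trS => h.
  apply: le_trans (h _) _; last by rewrite ler_wpM2l// coord_le_norm.
  move=> s sk.
  have nrm_ts : `|tr i + s *: ebasis R i| <= `|k|.
    rewrite [leLHS](_ : _ = mx_norm (tr i + s *: ebasis R i))// mx_normrE.
    apply/bigmax_leP; split=> // -[i1 j] _ /=; rewrite (ord1 i1) /ebasis !mxE /=.
    case: (eqVneq j i) => [->|ji].
      by rewrite ltnn add0r mulr1 (le_trans sk)// coord_le_norm.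
    by rewrite mulr0 addr0; case: ifP => _; rewrite ?normr0// coord_le_norm.
  have [|d dd dM] := GD (tr i + s *: ebasis R i) i (le_trans nrm_ts kd).
    move=> j ij; rewrite /ebasis !mxE /= ltnNge (ltnW ij) /= add0r.
    by rewrite (negbTE (_ : j != i)) ?mulr0 ?andbF// neq_ltn ij orbT.
  exists d => //; apply: is_derive_shift0.
  move: dd; congr is_derive; apply/funext => r.
  by rewrite scalerDl !addrA.
have -> : G x = G (x + tr 0%N).
  by congr G; rewrite (_ : tr 0%N = 0) ?addr0//; apply/rowP => j; rewrite !mxE.
have {1}-> : k = tr n.+1 by apply/rowP => j; rewrite !mxE ltn_ord.
suff H m : (m <= n.+1)%N -> `|G (x + tr m) - G (x + tr 0%N)| <= m%:R * (M * `|k|) by exact: H.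
elim: m => [_|m IH mn]; first by rewrite subrr normr0 mul0r.
rewrite -(subrKA (G (x + tr m))) -natr1 mulrDl mul1r.
apply: le_trans (ler_normD _ _) _; rewrite addrC lerD ?IH ?(ltnW mn)//.
exact: (step (Ordinal mn)).
Qed.

Lemma C1_expansion g x : 
  (\forall y \near x, forall j, derivable g y (ebasis R j)) ->
  (forall j, {for x, continuous ('D_(ebasis R j) g)}) ->
  forall e : R, 0 < e -> \forall k \near (0 : V),
    `|g (x + k) - g x - \sum_j 'D_(ebasis R j) g x * k ord0 j| <= e * `|k|.
Proof.
move=> gD gC e e0.
pose c : V := \row_j 'D_(ebasis R j) g x.
have e'0 : 0 < e / n.+1%:R by rewrite divr_gt0.
have near_c : \forall y \near x, forall j, `|'D_(ebasis R j) g x - 'D_(ebasis R j) g y| <= e / n.+1%:R.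
  by apply: (@filter_forall _ _ _ _ (nbhs_filter x)) => j; exact: (cvgr_dist_le _ _ (gC j) _ e'0).
have /nbhs_ballP[r /= r0 hr] := @filterI _ _ (nbhs_filter x) _ _ gD near_c.
apply/nbhs_ballP; exists r => //= k; rewrite -ball_normE /= sub0r normrN => kr.
(* Without its linear part, [g] has partial derivatives at most e / (n + 1) near [x]; the division
   by n + 1 pays for the legs of [telescope_bound]. *)
pose G y := g y - edot c y.
have := @telescope_bound G x `|k| (e / n.+1%:R) (ltW e'0) _ k (lexx _).
rewrite (_ : n.+1%:R * (e / n.+1%:R * `|k|) = e * `|k|); last by field.
rewrite (_ : G (x + k) - G x = g (x + k) - g x - \sum_j 'D_(ebasis R j) g x * k ord0 j).
  apply=> k' i k'k _.
  have [Dk Ck] : (forall j, derivable g (x + k') (ebasis R j)) /\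
      forall j, `|'D_(ebasis R j) g x - 'D_(ebasis R j) g (x + k')| <= e / n.+1%:R.
    by apply: hr; rewrite -ball_normE /= opprD addNKr normrN (le_lt_trans k'k).
  exists ('D_(ebasis R i) g (x + k') - c ord0 i); last by rewrite mxE distrC.
  have -> : (fun s : R => G (x + k' + s *: ebasis R i)) =
     (fun s => g (x + k' + s *: ebasis R i) - (edot c (x + k') + s * c ord0 i)).
    by apply/funext => s; rewrite /G !(edotDr, edotZr) edot_basis.
  apply: is_deriveB; first by apply: is_derive_line; exact: derivableP.
  by apply: is_derive_eq; rewrite /GRing.scale/=; ring.
rewrite /G edotDr (_ : edot c k = \sum_j 'D_(ebasis R j) g x * k ord0 j); first by ring.
by apply: eq_bigr => j _; rewrite mxE.
Qed.

Lemma C2_taylor U x :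
  (\forall y \near x, (forall i, derivable U y (ebasis R i)) /\
     (forall i j, derivable ('D_(ebasis R i) U) y (ebasis R j))) ->
  (forall i j, {for x, continuous ('D_(ebasis R j) ('D_(ebasis R i) U))}) ->
  exists l Q, taylor U x l Q /\
    2 * \tr Q = \sum_i 'D_(ebasis R i) ('D_(ebasis R i) U) x.
Proof.
move=> UD UC.
pose H i j : R := 'D_(ebasis R j) ('D_(ebasis R i) U) x.
pose l : V := \row_i 'D_(ebasis R i) U x.
(* Schwarz's theorem is not needed: any quadratic form with the right diagonal
   and the right lower-triangular sums will do. *)
pose Q : 'M[R]_n.+1 := \matrix_(i, j)
  (if (j < i)%N then H i j else if j == i then H i i / 2 else 0).
exists l, Q; split; last first.
  by rewrite mulr_sumr; apply: eq_bigr => i _; rewrite mxE ltnn eqxx /H; field.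
pose rem k := U (x + k) - U x - edot l k - bf Q k k.
apply: taylor_intro => e e0.
have N0 : (0 : R) < n.+1%:R by [].
have e'0 : 0 < e / n.+1%:R by rewrite divr_gt0.
have near_g : \forall k \near (0 : V), forall i,
   `|'D_(ebasis R i) U (x + k) - 'D_(ebasis R i) U x - \sum_j H i j * k ord0 j| <= e / n.+1%:R * `|k|.
  apply: (@filter_forall _ _ _ _ (nbhs_filter (0 : V))) => i; apply: C1_expansion => //.
  by apply: filterS UD => y [_ h] j; exact: h.
have near_D : \forall k \near (0 : V), forall i, derivable U (x + k) (ebasis R i).
  have cx : x + k @[k --> (0 : V)] --> x.
    have h := cvgD (cvg_cst x) (@cvg_id _ (nbhs (0 : V))).
    by rewrite addr0 in h; exact: h.
  have : \forall y \near x, forall i, derivable U y (ebasis R i).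
    by apply: filterS UD => y [].
  exact: cx.
have /nbhs_ballP[r /= r0 hr] := @filterI _ _ (nbhs_filter (0 : V)) _ _ near_g near_D.
apply/nbhs_ballP; exists r => //= k; rewrite -ball_normE /= sub0r normrN => kr.
apply: le_trans (_ : e * `|k| ^+ 2 <= _); last by rewrite ler_wpM2l ?norm_le_edot// ltW.
pose G y := U y - edot l (y - x) - bf Q (y - x) (y - x).
have := @telescope_bound G x `|k| (e / n.+1%:R * `|k|) _ _ k (lexx _).
rewrite (_ : n.+1%:R * _ = e * `|k| ^+ 2); last by field.
rewrite (_ : G (x + k) - G x = rem k); last first.
  have xk : x + k - x = k by rewrite addrC addKr.
  by rewrite /G /rem subrr xk edot0r /bf edot0r; ring.
apply; first by rewrite mulr_ge0// ltW.
move=> k' i k'k k'0.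
have [gk Dk] : (forall i, `|'D_(ebasis R i) U (x + k') - 'D_(ebasis R i) U x - \sum_j H i j * k' ord0 j| <= e / n.+1%:R * `|k'|) /\ (forall i, derivable U (x + k') (ebasis R i)).
  by apply: hr; rewrite -ball_normE /= sub0r normrN (le_lt_trans k'k).
exists ('D_(ebasis R i) U (x + k') - l ord0 i - (bf Q k' (ebasis R i) + bf Q (ebasis R i) k')).
  have -> : (fun s : R => G (x + k' + s *: ebasis R i)) =
     (fun s => U (x + k' + s *: ebasis R i) - (edot l k' + s * l ord0 i)
       - (bf Q k' k' + s * (bf Q k' (ebasis R i) + bf Q (ebasis R i) k')
          + s * s * bf Q (ebasis R i) (ebasis R i))).
    apply/funext => s; rewrite /G (_ : x + k' + _ - x = k' + s *: ebasis R i); last first.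
      by apply/rowP => j; rewrite !mxE; ring.
    by rewrite !(edotDr, edotZr, bfE) edot_basis; ring.
  apply: is_deriveB; last by apply: is_derive_eq; rewrite /GRing.scale/=; ring.
  apply: is_deriveB; first by apply: is_derive_line; exact: derivableP.
  by apply: is_derive_eq; rewrite /GRing.scale/=; ring.
(* For j < i only [Q i j] is nonzero, for j = i the two halves add up, and for j > i the coordinate
   of [k'] vanishes. *)
have -> : bf Q k' (ebasis R i) + bf Q (ebasis R i) k' = \sum_j H i j * k' ord0 j.
  rewrite -bf_suml -(bf_sumr Q k' (ebasis R i)) -big_split; apply: eq_bigr => j _ /=.
  rewrite !bf_basis !mxE.
  case: (ltngtP j i) => [ji|ij|/val_inj->].
  - by rewrite (negbTE (_ : i != j)) ?neq_ltn ?ji ?orbT//; ring.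
  - by rewrite k'0// !mul0r mulr0 addr0.
  - by rewrite eqxx; move: (H i i) => h; field.
rewrite /l mxE; apply: le_trans (gk i) _.
by rewrite ler_wpM2l// ltW.
Qed.

Lemma C2_hemi_taylor (u : V -> R) x : C2_hemi u -> hemi x ->
  exists l Q, taylor (ext u) x l Q /\ 2 * \tr Q = LB u x.
Proof. by move=> C2 hx; have [nD [_ cD]] := C2 x hx; exact: C2_taylor. Qed.

End C2Taylor.

(** * Interior oscillation estimate under a bound on the Laplacian *)

Section Oscillation.
Variables (R : realType) (n : nat).
Local Notation V := 'rV[R]_(n.+1).
Implicit Types (x y z k l p v e : V) (Q : 'M[R]_(n.+1)) (i j : 'I_n.+1) (u U W : V -> R).

Lemma edot_diag_continuous : continuous (fun x : V => edot x x).
Proof. by move=> x; exact: (cvg_edot (@cvg_id _ (nbhs x)) (@cvg_id _ (nbhs x))). Qed.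

Lemma taylor_continuous U y l Q : taylor U y l Q -> {for y, continuous U}.
Proof.
move=> [om omc UE].
have c0 : k @[k --> (0 : V)] --> (0 : V) by exact: cvg_id.
have ce : edot k k @[k --> (0 : V)] --> edot 0 (0 : V) by exact: (cvg_edot c0 c0).
have cl : edot l k @[k --> (0 : V)] --> edot l 0 by exact: (cvg_edot (cvg_cst l) c0).
have cQ : k *m Q @[k --> (0 : V)] --> (0 : V) *m Q.
  have bq z : z *m Q = \sum_i z ord0 i *: (ebasis R i *m Q).
    rewrite -{1}(row_sum_coord z z) mulmx_suml.
    by apply: eq_bigr => i _; rewrite scalemxAl.
  rewrite bq (_ : (fun z => z *m Q) = fun z => \sum_i z ord0 i *: (ebasis R i *m Q)); last exact/funext.
  apply: (@cvg_big _ _ _ _ _ _ _ (nbhs (0 : V)) _ _ _ (nbhs_filter (0 : V))) => [|i _]; first exact: add_continuous.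
  exact: (cvgZ (@coord_continuous _ _ _ ord0 i 0) (cvg_cst _)).
have cb : bf Q k k @[k --> (0 : V)] --> bf Q 0 (0 : V) by exact: (cvg_edot cQ c0).
have h : U y + edot l k + bf Q k k + om k * edot k k @[k --> (0 : V)] --> U y.
  have := cvgD (cvgD (cvgD (cvg_cst (U y)) cl) cb) (cvgM omc ce).
  by rewrite /bf !edot0r !addr0 mul0r addr0; exact.
have sh : x - y @[x --> y] --> (0 : V).
  have h1 := cvgB (@cvg_id _ (nbhs y)) (cvg_cst y).
  by rewrite subrr in h1; exact: h1.
pose F x := U y + edot l (x - y) + bf Q (x - y) (x - y) + om (x - y) * edot (x - y) (x - y).
have h2 : F x @[x --> y] --> U y := cvg_comp _ _ sh h.
have E : F = U by apply/funext => x; rewrite /F -UE addrC subrK.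
by rewrite E in h2.
Qed.

Lemma taylor_translate U y0 k l Q : taylor U (y0 + k) l Q ->
  taylor (fun k => U (y0 + k)) k l Q.
Proof. by move=> [om omc UE]; exists om => // h; rewrite addrA UE. Qed.

Lemma half_ball_compact (e : V) (r : R) :
  compact [set k : V | edot k k <= r /\ 0 <= edot k e].
Proof.
apply: bounded_closed_compact.
  exists (Num.sqrt r + 1); split; first exact: num_real.
  move=> M rM k [kr _] /=.
  have k2 : `|k| ^+ 2 <= r by rewrite (le_trans _ kr)// norm_le_edot.
  apply: le_trans (ltW rM); rewrite ler_wpDr//.
  by rewrite -(ger0_norm (normr_ge0 k)) -sqrtr_sqr ler_wsqrtr.
have -> : [set k : V | edot k k <= r /\ 0 <= edot k e] =
   (fun k => edot k k) @^-1` [set t | t <= r] `&` (fun k => edot k e) @^-1` [set t | 0 <= t].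
  by apply/seteqP; split.
apply: closedI; apply: closed_comp; rewrite ?closed_le ?closed_ge//.
- by move=> k _; exact: edot_diag_continuous.
- by move=> k _; exact: edot_continuous.
Qed.

(** A gradient estimate by comparison on a half ball, for [U] minus its reflection. This difference
    vanishes on the flat face and is at most 2M on the round part, where [2 * M / r ^+ 2 * edot k k]
    equals 2M and [D * r * t - D * t^2], with t = k.e, is nonnegative. [D] is chosen so that [Phi]
    has Laplacian at least 2, which excludes an interior maximum. *)
Lemma osc_bound_pos U p0 e (r M C h c : R) : edot e e = 1 -> 0 < r -> 0 <= h <= r ->
  (forall k, edot k k <= r ^+ 2 -> `|U (p0 + k) - c| <= M) ->
  (forall k, edot k k <= r ^+ 2 ->
     exists l Q, taylor U (p0 + k) l Q /\ `|2 * \tr Q| <= C) ->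
  U (p0 + h *: e) - U (p0 - h *: e) <=
    (C + 2 * M * n.+1%:R / r ^+ 2 + 1) * r * h + 2 * M / r ^+ 2 * h ^+ 2.
Proof.
move=> e1 r0 /andP[h0 hr] UM UT.
pose D := C + 2 * M * n.+1%:R / r ^+ 2 + 1.
have M0 : 0 <= M by rewrite (le_trans _ (UM 0 _))// edot0l sqr_ge0.
have C0 : 0 <= C.
  by have [|l [Q [_]]] := UT 0; [rewrite edot0l sqr_ge0|apply: le_trans].
have D0 : 0 <= D by rewrite !addr_ge0// divr_ge0 ?sqr_ge0// !mulr_ge0.
have r2 : 0 < r ^+ 2 by rewrite exprn_gt0.
pose Phi k := U (p0 + k) - U (p0 + refl e k) - D * r * edot k e
  + D * (edot k e * edot k e) - 2 * M / r ^+ 2 * edot k k.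
pose K := [set k : V | edot k k <= r ^+ 2 /\ 0 <= edot k e].
have Kc : {within K, continuous Phi}.
  apply: continuous_in_subspaceT => k /set_mem [kr ke].
  have [l [Q [tk _]]] := UT k kr.
  have [|l' [Q' [tk' _]]] := UT (refl e k); first by rewrite edot_refl.
  have c1 := taylor_continuous (taylor_translate tk).
  have [l2 [Q2 [tk2 _]]] := taylor_refl e1 (taylor_translate tk').
  have c2 := taylor_continuous tk2.
  have ce : {for k, continuous (fun k => edot k e)} by exact: edot_continuous.
  have ck : {for k, continuous (fun k : V => edot k k)} by exact: edot_diag_continuous.
  exact: (cvgB (cvgD (cvgB (cvgB c1 c2) (cvgM (cvg_cst _) ce))
    (cvgM (cvg_cst _) (cvgM ce ce))) (cvgM (cvg_cst _) ck)).
have [|k0 /set_mem [k0r k0e] kmax] := compact_EVT_max (_ : K !=set0) (@half_ball_compact e (r ^+ 2)) Kc.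
  by exists 0; rewrite /K /= !edot0l sqr_ge0.
have Phi0 : Phi k0 <= 0.
  rewrite leNgt; apply/negP => Pp.
  have Uk0 : U (p0 + k0) - U (p0 + refl e k0) <= 2 * M.
    have := UM k0 k0r; have := UM (refl e k0); rewrite edot_refl// => /(_ k0r).
    by rewrite !ler_norml; lra.
  have ke_r : edot k0 e <= r.
    rewrite -(ger0_norm k0e) -sqrtr_sqr -(ger0_norm (ltW r0)) -sqrtr_sqr ler_wsqrtr//.
    rewrite (le_trans _ k0r)//.
    have := edot_ge0 (k0 - edot k0 e *: e); rewrite !edotE e1 (edotC e k0).
    by lra.
  have k0e' : 0 < edot k0 e.
    rewrite lt_neqAle k0e andbT; apply/eqP => E; move: Pp.
    have rk : refl e k0 = k0 by rewrite /refl -E mulr0 scale0r subr0.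
    have g : 0 <= 2 * M / r ^+ 2 * edot k0 k0.
      by rewrite mulr_ge0 ?edot_ge0// divr_ge0 ?mulr_ge0// ltW.
    by rewrite /Phi rk -E; lra.
  have k0r' : edot k0 k0 < r ^+ 2.
    rewrite lt_neqAle k0r andbT; apply/eqP => E; move: Pp; rewrite /Phi E.
    have -> : 2 * M / r ^+ 2 * r ^+ 2 = 2 * M by field; rewrite gt_eqF.
    have : D * (edot k0 e * edot k0 e) <= D * r * edot k0 e.
      by rewrite mulrA ler_wpM2r// ler_wpM2l.
    by lra.
  have [l [Q [tk Cq]]] := UT k0 k0r.
  have [|l' [Q' [tk' Cq']]] := UT (refl e k0); first by rewrite edot_refl.
  have [l2 [Q2 [tk2 trQ2]]] := taylor_refl e1 (taylor_translate tk').
  have tk1 := taylor_translate tk.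
  have a2 i : 0 <= - (bf Q (ebasis R i) (ebasis R i) - bf Q2 (ebasis R i) (ebasis R i)
      + D * (e ord0 i * e ord0 i) - 2 * M / r ^+ 2).
    pose ps := peanoD (peanoD (peanoD (peanoD (taylor_line (ebasis R i) tk1)
         (peanoZ (-1) (taylor_line (ebasis R i) tk2)))
         (peanoZ (- (D * r)) (peano_id (edot k0 e) (e ord0 i))))
         (peanoZ D (peanoM (peano_id (edot k0 e) (e ord0 i)) (peano_id (edot k0 e) (e ord0 i)))))
         (peanoZ (- (2 * M / r ^+ 2)) (peanoD (peano_id (edot k0 k0) (2 * k0 ord0 i))
            (peanoM (peano_id 0 1) (peano_id 0 1)))).
    have [|_] := peano_min _ (peanoZ (-1) ps).
      have cl : k0 + t *: ebasis R i @[t --> (0 : R)] --> k0 := @cvg_line _ _ k0 (ebasis R i).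
      have n1 : \forall t \near (0 : R), edot (k0 + t *: ebasis R i) (k0 + t *: ebasis R i) < r ^+ 2.
        by apply: (cvgr_lt _ (cvg_edot cl cl)).
      have n2 : \forall t \near (0 : R), 0 < edot (k0 + t *: ebasis R i) e.
        by apply: (cvgr_gt _ (cvg_edot cl (cvg_cst e))).
      near=> t.
      have tK : k0 + t *: ebasis R i \in K.
        by apply/mem_set; split; apply: ltW; near: t.
      have E1 : edot (k0 + t *: ebasis R i) e = edot k0 e + t * e ord0 i.
        by rewrite edotDl edotZl basis_edot.
      have E2 : edot (k0 + t *: ebasis R i) (k0 + t *: ebasis R i)
          = edot k0 k0 + t * (2 * k0 ord0 i) + t * t.
        by rewrite !(edotDl, edotDr, edotZl, edotZr) basis_edot edot_basis edot_basis_diag; ring.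
      have := kmax _ tK; rewrite /Phi E1 E2 /=; lra.
    by lra.
  have : \sum_i - (bf Q (ebasis R i) (ebasis R i) - bf Q2 (ebasis R i) (ebasis R i)
      + D * (e ord0 i * e ord0 i) - 2 * M / r ^+ 2) >= 0 by rewrite sumr_ge0.
  rewrite sumrN !big_split/= !sumrN -!trace_bf -mulr_sumr sum_coord e1 sumr_const card_ord trQ2.
  rewrite -mulr_natr; move: Cq Cq'; rewrite !ler_norml /D.
  have -> : 2 * M * n.+1%:R / r ^+ 2 = 2 * M / r ^+ 2 * n.+1%:R by ring.
  by lra.
have hK : h *: e \in K.
  apply/mem_set; split; rewrite /= !(edotZl, edotZr) e1 mulr1 ?mulr1//.
  by rewrite -expr2 ler_sqr ?nnegrE// ltW.
have := le_trans (kmax _ hK) Phi0.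
rewrite /Phi (_ : refl e (h *: e) = - (h *: e)); last first.
  by apply/rowP => i; rewrite /refl edotZl e1 !mxE; ring.
rewrite !(edotZl, edotZr) e1 !mulr1 -/D.
have : 0 <= D * (h * h) by rewrite mulr_ge0// mulr_ge0.
have -> : 2 * M / r ^+ 2 * h ^+ 2 = 2 * M / r ^+ 2 * (h * h) by rewrite expr2.
by lra.
Unshelve. all: by end_near. Qed.

Lemma osc_bound U p0 e (r M C h c : R) : edot e e = 1 -> 0 < r -> `|h| <= r ->
  (forall k, edot k k <= r ^+ 2 -> `|U (p0 + k) - c| <= M) ->
  (forall k, edot k k <= r ^+ 2 ->
     exists l Q, taylor U (p0 + k) l Q /\ `|2 * \tr Q| <= C) ->
  `|U (p0 + h *: e) - U (p0 - h *: e)| <=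
    (C + 2 * M * n.+1%:R / r ^+ 2 + 1) * r * `|h| + 2 * M / r ^+ 2 * h ^+ 2.
Proof.
move=> e1 r0 hr UM UT.
have e1' : edot (- e) (- e) = 1 by rewrite edotNl edotNr opprK.
have [h0|h0] := leP 0 h.
- have hr' : 0 <= h <= r by rewrite h0 -(ger0_norm h0).
  rewrite (ger0_norm h0); have A := osc_bound_pos e1 r0 hr' UM UT.
  have B := osc_bound_pos e1' r0 hr' UM UT.
  by rewrite ler_norml A andbT lerNl opprB; move: B; rewrite !scalerN opprK.
- have hr' : 0 <= - h <= r by rewrite oppr_ge0 ltW//= -(ltr0_norm h0).
  rewrite [`|h|](ltr0_norm h0); have A := osc_bound_pos e1 r0 hr' UM UT.
  have B := osc_bound_pos e1' r0 hr' UM UT.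
  move: A B; rewrite !scalerN !scaleNr !opprK sqrrN => A B.
  by rewrite ler_norml B andbT lerNl opprB.
Qed.

End Oscillation.

(** * The one-sided normal derivative along curves *)

Section NormalDerivative.
Variables (R : realType) (n : nat).
Local Notation V := 'rV[R]_(n.+1).
Local Notation eN := (ebasis R (@ord_max n)).
Implicit Types (x y z k l p v e : V) (Q : 'M[R]_(n.+1)) (i j : 'I_n.+1) (u U W : V -> R).

Lemma xlastD x y : xlast (x + y) = xlast x + xlast y.
Proof. by rewrite /xlast mxE. Qed.

Lemma xlastZ (a : R) x : xlast (a *: x) = a * xlast x.
Proof. by rewrite /xlast mxE. Qed.

Lemma xlast_pole : xlast eN = 1.
Proof. by rewrite xlastE edot_basis_diag. Qed.

Lemma sphere_pole : sphere eN.
Proof. by rewrite /sphere /= edot_basis_diag. Qed.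

(** The derivative points inward, so [normal_deriv_is u z c] is [nd u z (- c)], and [nd] is
    nonnegative at a minimum on the equator. *)
Definition nd W z (d : R) : Prop :=
  (ext W (z + t *: eN) - W z) / t @[t --> (0 : R)^'+] --> d.

Lemma near_pos_scale (P : R -> Prop) (c : R) : 0 < c ->
  (\forall t \near (0 : R)^'+, P t) -> \forall t \near (0 : R)^'+, P (t * c).
Proof.
move=> c0; rewrite !near_withinE => /nbhs_ballP[r /= r0 hr].
apply/nbhs_ballP; exists (r / c); first by rewrite /= divr_gt0.
move=> t; rewrite /ball /= sub0r normrN => tr t0.
apply: hr; last by rewrite mulr_gt0.
by rewrite /ball /= sub0r normrN normrM (gtr0_norm c0) -ltr_pdivlMr.
Qed.

(** Carries bounds from the sphere to a full neighbourhood in the upper half space. By homogeneity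
    the Laplacian at [x] is that at [nrm x] times [(enorm x)^-2], which is below 4 where
    [enorm x > 1/2]. *)
Lemma ext_near_boundary u y (C : R) : sphere y ->
  (forall e : R, 0 < e -> \forall x \near y, hemi_cl x -> `|u x - u y| <= e) ->
  (\forall x \near y, hemi x -> exists l Q, taylor (ext u) x l Q /\ `|2 * \tr Q| <= C) ->
  forall e : R, 0 < e -> \forall x \near y, 0 < xlast x ->
    `|ext u x - u y| <= e /\ exists l Q, taylor (ext u) x l Q /\ `|2 * \tr Q| <= 4 * C.
Proof.
move=> sy hc hT e e0.
have cn : nrm x @[x --> y] --> y.
  by exact: (cvg_nrm_sphere sy (@cvg_id _ (nbhs y))).
have ce : enorm x @[x --> y] --> (1 : R).
  rewrite -(enorm_sphere sy); exact: (cvg_enorm (@cvg_id _ (nbhs y))).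
have n1 : \forall x \near y, hemi_cl (nrm x) -> `|u (nrm x) - u y| <= e by exact: (cn _ (hc e e0)).
have n2 : \forall x \near y, hemi (nrm x) -> exists l Q, taylor (ext u) (nrm x) l Q /\ `|2 * \tr Q| <= C by exact: (cn _ hT).
have n3 : \forall x \near y, 2^-1 < enorm x.
  by apply: (cvgr_gt _ ce); rewrite invf_lt1 ?ltr1n.
near=> x => x0.
have xn0 : x != 0 by apply: contraTneq x0 => ->; rewrite /xlast mxE ltxx.
have r0 := enorm_gt0 xn0.
have r12 : 2^-1 < enorm x by near: x.
have hx : hemi (nrm x).
  split; first exact: nrm_sphere.
  by rewrite /nrm /xlast mxE mulr_gt0// invr_gt0.
have hx' : hemi_cl (nrm x) by case: hx => ? /ltW.
split; first by rewrite extE; move: hx'; near: x.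
have [l [Q [tl tQ]]] : exists l Q, taylor (ext u) (nrm x) l Q /\ `|2 * \tr Q| <= C.
  by move: hx; near: x.
exists ((enorm x)^-1 *: l), ((enorm x)^-2 *: Q); split.
  have {1}-> : x = enorm x *: nrm x by rewrite /nrm scalerA divff ?gt_eqF// scale1r.
  exact: taylor_scale.
rewrite mxtraceZ mulrCA normrM ger0_norm ?invr_ge0 ?sqr_ge0//.
apply: ler_pM => //; first by rewrite invr_ge0 sqr_ge0.
rewrite -[4]invrK lef_pV2 ?posrE ?exprn_gt0// ?invr_gt0//.
rewrite (_ : 4^-1 = 2^-1 ^+ 2); last by field.
by rewrite lerXn2r ?nnegrE ?(ltW r0) ?(ltW r12)// invr_ge0.
Unshelve. all: by end_near. Qed.

(* Along a curve tangent to the normal up to O(t^2): since [u] is only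
   continuous up to the boundary, the interior oscillation estimate is needed
   to compare it with the straight line. *)
Lemma nd_curve u y v (d ka r2 C : R) (rho : R -> R) : sphere y -> 0 <= xlast y ->
  0 < ka -> xlast v = 0 -> peano rho 0 0 r2 ->
  (forall e : R, 0 < e -> \forall x \near y, hemi_cl x -> `|u x - u y| <= e) ->
  (\forall x \near y, hemi x -> exists l Q, taylor (ext u) x l Q /\ `|2 * \tr Q| <= C) ->
  nd u y d ->
  (ext u (y + (t *: (ka *: eN) + rho t *: v)) - u y) / t @[t --> (0 : R)^'+] --> ka * d.
Proof.
move=> sy y0 ka0 v0 [q qc qE] hc hT hd.
have d1 : (ext u (y + t *: (ka *: eN)) - u y) / t @[t --> (0 : R)^'+] --> ka * d.
  apply/cvgrPdist_le => e e0.
  have e'0 : 0 < e / ka by rewrite divr_gt0.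
  have hd' : \forall s \near (0 : R)^'+, `|d - (ext u (y + s *: eN) - u y) / s| <= e / ka.
    by exact: (cvgr_dist_le _ _ hd _ e'0).
  have hd2 := near_pos_scale ka0 hd'.
  near=> t.
  have t0 : 0 < t by near: t; exact: nbhs_right_gt.
  have h : `|d - (ext u (y + (t * ka) *: eN) - u y) / (t * ka)| <= e / ka by near: t.
  rewrite scalerA (_ : ka * d - _ = ka * (d - (ext u (y + (t * ka) *: eN) - u y) / (t * ka))); last first.
    by field; rewrite ?gt_eqF.
  by rewrite normrM (gtr0_norm ka0) mulrC -ler_pdivlMr.
suff d2 : (ext u (y + (t *: (ka *: eN) + rho t *: v)) - ext u (y + t *: (ka *: eN))) / t
    @[t --> (0 : R)^'+] --> (0 : R).
  rewrite -[X in _ --> X]addr0.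
  rewrite (_ : (fun t => _) = fun t => (ext u (y + t *: (ka *: eN)) - u y) / t
    + (ext u (y + (t *: (ka *: eN) + rho t *: v)) - ext u (y + t *: (ka *: eN))) / t).
    by exact: (cvgD d1 d2).
  by apply/funext => t /=; rewrite -mulrDl; congr (_ / _); ring.
case: (eqVneq v 0) => [->|vn0].
  rewrite (_ : (fun t => _) = fun=> 0); first exact: cvg_cst.
  by apply/funext => t; rewrite scaler0 addr0 subrr mul0r.
have nv := enorm_gt0 vn0; set nu := enorm v in nv.
set e := nrm v; have se : edot e e = 1 := nrm_sphere vn0.
have ve : v = nu *: e by rewrite /e /nrm scalerA divff ?gt_eqF// scale1r.
have eN0 : xlast e = 0 by rewrite /e /nrm /xlast mxE -/(xlast v) v0 mulr0.
clearbody e.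
pose B : R := (`|r2| + 1) * nu / 2.
have B0 : 0 < B by rewrite divr_gt0// mulr_gt0// ltr_wpDl.
have N0 : (0 : R) < n.+1%:R by [].
suff key (eps : R) : 0 < eps -> \forall t \near (0 : R)^'+,
    `|0 - (ext u (y + (t *: (ka *: eN) + rho t *: v)) - ext u (y + t *: (ka *: eN))) / t| <= eps.
  by apply/cvgrPdist_le => eps eps0; exact: key.
move=> eps0.
(* With radius [ka * t / 2] and half distance at most [B * t ^+ 2], the bound of [osc_bound] divided
   by t is [rest t + eta * c1]. The first term tends to 0; the second is made [eps / 2] through
   [eta], the oscillation of [u] near [y]. *)
pose c1 : R := 4 * n.+1%:R * B / ka.
have c10 : 0 < c1 by rewrite divr_gt0// !mulr_gt0.
pose eta : R := eps / 2 / c1.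
have eta0 : 0 < eta by apply: divr_gt0 => //; apply: divr_gt0.
have /nbhs_ballP[del /= del0 hdel] := ext_near_boundary sy hc hT eta0.
pose rest t := (4 * C + 1) * ka * B / 2 * (t * t) + 8 * eta * B ^+ 2 / ka ^+ 2 * t.
have rest0 : rest t @[t --> (0 : R)] --> (0 : R).
  refine (@cvg_eq_lim _ _ _ _ ((4 * C + 1) * ka * B / 2 * (0 * 0) + 8 * eta * B ^+ 2 / ka ^+ 2 * 0) _ _ _).
    have ci : t @[t --> (0 : R)] --> (0 : R) by exact: cvg_id.
    exact: (cvgD (cvgM (cvg_cst _) (cvgM ci ci)) (cvgM (cvg_cst _) ci)).
  by rewrite !mulr0 addr0.
have near_rest : \forall t \near (0 : R)^'+, rest t <= eps / 2.
  have r1 : \forall t \near (0 : R), rest t < eps / 2.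
    by apply: (cvgr_lt _ rest0); rewrite divr_gt0.
  by rewrite near_withinE; apply: filterS r1 => t /ltW.
have near_q : \forall t \near (0 : R)^'+, `|q t| <= `|r2| + 1.
  rewrite near_withinE.
  have q1 : \forall t \near (0 : R), `|r2 - q t| <= 1 by exact: (cvgr_dist_le _ _ qc _ ltr01).
  apply: filterS q1 => t qt _.
  have := ler_normD (q t - r2) r2; rewrite subrK distrC.
  by move/le_trans; apply; rewrite addrC lerD2l.
near=> t.
have t0 : 0 < t by near: t; exact: nbhs_right_gt.
have tB : t * B <= ka / 2.
  rewrite -ler_pdivlMr//; near: t; apply: nbhs_right_le; by apply: divr_gt0 => //; apply: divr_gt0.
have tdel : t * (2 * ka) < del.
  rewrite -ltr_pdivlMr ?mulr_gt0//; near: t; apply: nbhs_right_lt; by apply: divr_gt0 => //; apply: mulr_gt0.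
have qt : `|q t| <= `|r2| + 1 by near: t.
have restt : rest t <= eps / 2 by near: t.
pose h := rho t * nu / 2.
have hB : `|h| <= B * t ^+ 2.
  have nt : 0 <= nu * t ^+ 2 / 2 by rewrite divr_ge0 ?mulr_ge0 ?sqr_ge0// ltW.
  have -> : h = q t * (nu * t ^+ 2 / 2) by rewrite /h qE; field.
  have -> : B * t ^+ 2 = (`|r2| + 1) * (nu * t ^+ 2 / 2) by rewrite /B; field.
  by rewrite normrM (ger0_norm nt) ler_wpM2r.
(* The two points to compare are [p0 + h e] and [p0 - h e]. As [p0] has height at least [ka * t],
   the ball of radius [r] about it stays strictly above the equator. *)
pose r := ka * t / 2.
have r0 : 0 < r by rewrite divr_gt0// mulr_gt0.
have hr : `|h| <= r.
  rewrite (le_trans hB)// (_ : B * t ^+ 2 = t * (t * B)); last by ring.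
  rewrite (_ : r = t * (ka / 2)); last by rewrite /r; field.
  by rewrite ler_wpM2l// ltW.
pose p0 := y + t *: (ka *: eN) + h *: e.
have hin k : edot k k <= r ^+ 2 -> 0 < xlast (p0 + k) /\ `|p0 + k - y| < del.
  move=> kr.
  have kn : `|k| <= r.
    rewrite -(ger0_norm (normr_ge0 k)) -sqrtr_sqr -(ger0_norm (ltW r0)) -sqrtr_sqr.
    by rewrite ler_wsqrtr// (le_trans _ kr)// norm_le_edot.
  split.
    rewrite /p0 !xlastD !xlastZ eN0 xlast_pole mulr0 addr0 mulr1.
    have := coord_le_norm k ord_max; rewrite -/(xlast k) => kl.
    have : - r <= xlast k by have := le_trans kl kn; rewrite ler_norml => /andP[].
    have : 0 < r by []; rewrite /r; lra.
  rewrite (_ : p0 + k - y = t *: (ka *: eN) + h *: e + k); last first.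
    by rewrite /p0; apply/rowP => i; rewrite !mxE; ring.
  have e_le : `|e| <= 1.
    by rewrite -(@ler_pXn2r _ 2)// ?nnegrE// expr1n -se norm_le_edot.
  have eN_le : `|eN : V| <= 1.
    by rewrite -(@ler_pXn2r _ 2)// ?nnegrE// expr1n -(edot_basis_diag R (@ord_max n)) norm_le_edot.
  apply: le_lt_trans (ler_normD _ _) _.
  apply: le_lt_trans (_ : t * ka + r + r < _); last by rewrite /r; lra.
  rewrite lerD// (le_trans (ler_normD _ _))// lerD//.
    rewrite !normrZ (gtr0_norm t0) (gtr0_norm ka0) ler_wpM2l ?(ltW t0)//.
    by rewrite -[leRHS]mulr1 ler_wpM2l// ltW.
  by rewrite normrZ (le_trans _ hr)// -[leRHS]mulr1 ler_wpM2l.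
have hU k : edot k k <= r ^+ 2 -> `|ext u (p0 + k) - u y| <= eta /\
    exists l Q, taylor (ext u) (p0 + k) l Q /\ `|2 * \tr Q| <= 4 * C.
  move=> /hin[k1 k2]; apply: hdel => //.
  by rewrite -ball_normE /= distrC.
have := osc_bound se r0 hr (fun k kr => (hU k kr).1) (fun k kr => (hU k kr).2).
rewrite (_ : p0 + h *: e = y + (t *: (ka *: eN) + rho t *: v)); last first.
  rewrite /p0 ve /h; apply/rowP => i; rewrite !mxE; by field.
rewrite (_ : p0 - h *: e = y + t *: (ka *: eN)); last by rewrite /p0 addrK.
move=> osc.
rewrite sub0r normrN normrM normfV (gtr0_norm t0) ler_pdivrMr//.
apply: le_trans osc _.
have C0 : 0 <= 4 * C.
  by have [|_ [l [Q [_]]]] := hU 0; [rewrite edot0l sqr_ge0|apply: le_trans].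
have h2 : h ^+ 2 <= (B * t ^+ 2) ^+ 2.
  have Bt : 0 <= B * t ^+ 2 by rewrite mulr_ge0 ?sqr_ge0 ?(ltW B0).
  by rewrite -(real_normK (num_real h)) lerXn2r ?nnegrE.
apply: (@le_trans _ _ ((4 * C + 2 * eta * n.+1%:R / r ^+ 2 + 1) * r * (B * t ^+ 2)
   + 2 * eta / r ^+ 2 * (B * t ^+ 2) ^+ 2)).
  have eta_r : 0 <= 2 * eta / r ^+ 2 by rewrite divr_ge0 ?sqr_ge0// mulr_ge0// ltW.
  rewrite lerD//; last by rewrite ler_wpM2l.
  rewrite ler_wpM2l// mulr_ge0 ?(ltW r0)// !addr_ge0//.
  by rewrite mulrAC mulr_ge0.
have -> : (4 * C + 2 * eta * n.+1%:R / r ^+ 2 + 1) * r * (B * t ^+ 2)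
   + 2 * eta / r ^+ 2 * (B * t ^+ 2) ^+ 2 = (rest t + eta * c1) * t.
  by rewrite /rest /c1 /r; field; rewrite !gt_eqF.
have -> : eta * c1 = eps / 2 by rewrite /eta; field; rewrite gt_eqF.
by rewrite ler_wpM2r ?(ltW t0)//; lra.
Unshelve. all: by end_near. Qed.

End NormalDerivative.

(** * Calculus of normal derivatives, including the Kelvin transform *)

Section NormalDerivativeRules.
Variables (R : realType) (n : nat).
Local Notation V := 'rV[R]_(n.+1).
Local Notation eN := (ebasis R (@ord_max n)).
Implicit Types (x y z k l p v e : V) (Q : 'M[R]_(n.+1)) (i j : 'I_n.+1) (u U W : V -> R).

Lemma nd_peano W z a0 a1 a2 : sphere z ->
  peano (fun t => ext W (z + t *: eN)) a0 a1 a2 -> nd W z a1.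
Proof.
move=> sz pW; have W0 : W z = a0.
  by rewrite -(peano_at0 pW) scale0r addr0 ext_sphere.
have [q qc qE] := pW.
have h : a1 + q t * t @[t --> (0 : R)^'+] --> a1.
  apply: cvg_within_filter; refine (@cvg_eq_lim _ _ _ _ (a1 + a2 * 0) _ _ _).
    exact: (cvgD (cvg_cst _) (cvgM qc cvg_id)).
  by rewrite mulr0 addr0.
apply: cvg_trans h; apply: near_eq_cvg; near=> t.
have t0 : t != 0 by rewrite gt_eqF//; near: t; exact: nbhs_right_gt.
by rewrite qE W0; field.
Unshelve. all: by end_near. Qed.

Lemma ndD W1 W2 z d1 d2 : nd W1 z d1 -> nd W2 z d2 ->
  nd (fun x => W1 x + W2 x) z (d1 + d2).
Proof.
rewrite /nd => h1 h2.
rewrite (_ : (fun t => _) = fun t => (ext W1 (z + t *: eN) - W1 z) / t + (ext W2 (z + t *: eN) - W2 z) / t).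
  exact: (cvgD h1 h2).
by apply/funext => t; rewrite -mulrDl; congr (_ / _); rewrite /ext; ring.
Qed.

Lemma ndZ (c : R) W z d : nd W z d -> nd (fun x => c * W x) z (c * d).
Proof.
rewrite /nd => h1.
rewrite (_ : (fun t => _) = fun t => c * ((ext W (z + t *: eN) - W z) / t)).
  exact: (cvgM (cvg_cst _) h1).
by apply/funext => t; rewrite mulrA; congr (_ / _); rewrite /ext; ring.
Qed.

Lemma nd_edot (G : R -> R) z p (G1 G2 : R) : equator z ->
  peano (fun h => G (edot z p + h)) (G (edot z p)) G1 G2 ->
  nd (fun x => G (edot x p)) z (G1 * xlast p).
Proof.
move=> [sz z0] pG.
have := @nd_peano (fun x => G (edot x p)) z _ _ _ sz
  (peano_comp (G := G) pG (peano_edot_nrm p ord_max sz)).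
by rewrite -/(xlast z) z0 mulr0 subr0.
Qed.

Lemma nd_cst (c : R) z : nd (fun=> c) z 0.
Proof.
rewrite /nd (_ : (fun t => _) = fun=> 0); first exact: cvg_cst.
by apply/funext => t; rewrite /ext subrr mul0r.
Qed.

Lemma nd_min W z d : equator z ->
  (\forall x \near z, hemi_cl x -> W z <= W x) -> nd W z d -> 0 <= d.
Proof.
move=> [sz z0] nW hd.
have nl := near_line eN sz nW.
have nl' : \forall t \near (0 : R)^'+, sphere (nrm (z + t *: eN)) /\
    (hemi_cl (nrm (z + t *: eN)) -> W z <= W (nrm (z + t *: eN))).
  by rewrite near_withinE; apply: filterS nl.
rewrite -(cvg_lim _ hd)//; apply: limr_ge; first by apply/cvg_ex; exists d.
near=> t.
have t0 : 0 < t by near: t; exact: nbhs_right_gt.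
have [st Wt] : sphere (nrm (z + t *: eN)) /\
    (hemi_cl (nrm (z + t *: eN)) -> W z <= W (nrm (z + t *: eN))) by near: t.
rewrite divr_ge0 ?(ltW t0)// subr_ge0 extE Wt//; split=> //.
by rewrite xlastZ xlastD z0 add0r xlastZ xlast_pole mulr1 mulr_ge0 ?(ltW t0)// invr_ge0 sqrtr_ge0.
Unshelve. all: by end_near. Qed.

Lemma xlast_kphi (mu : R) p x : xlast p = 0 -> xlast (kphi mu p x) = kfac mu p x * xlast x.
Proof. by move=> p0; rewrite /kphi xlastZ xlastD !xlastZ p0 mulr0 addr0 /kfac; ring. Qed.

(** [kphi] preserves the equator and sends the normal line, up to scaling, to a curve with velocity
    [kfac mu p z] times the normal. As [p] and [z] have no last coordinate, the weight [kfac ^ a] is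
    stationary along this line, so only the derivative of [u] contributes. *)
Lemma nd_kelvin (a mu C d : R) p u z : 0 <= mu < 1 -> sphere p -> xlast p = 0 -> equator z ->
  let y := kphi mu p z in
  (forall e : R, 0 < e -> \forall x \near y, hemi_cl x -> `|u x - u y| <= e) ->
  (\forall x \near y, hemi x -> exists l Q, taylor (ext u) x l Q /\ `|2 * \tr Q| <= C) ->
  nd u y d ->
  nd (kelvin a mu p u) z (kfac mu p z `^ a * (kfac mu p z * d)).
Proof.
move=> mu01 sp p0 [sz z0] y hc hT hd.
have zN : z ord0 ord_max = 0 by exact: z0.
have pN : p ord0 ord_max = 0 by exact: p0.
have sy : sphere y := kphi_sphere mu01 sp sz.
set E := kden mu p z; set K := kfac mu p z `^ a.
have pr : peano (fun t => enorm (z + t *: eN) - 1 - t * z ord0 ord_max) 0 0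
    ((1 - z ord0 ord_max ^+ 2) / 2).
  have := peanoD (peano_enorm ord_max sz) (peano_id (-1) (- z ord0 ord_max)).
  rewrite !subrr addr0; apply: peano_ext => t; ring.
have v0 : xlast ((2 * mu / E) *: p) = 0 by rewrite xlastZ p0 mulr0.
have y0 : 0 <= xlast y by rewrite xlast_kphi// z0 mulr0.
have k0 := kfac_gt0 mu01 sp sz.
have := nd_curve sy y0 k0 v0 pr hc hT hd.
set g := (X in X @ _ --> _) => gc.
have [q qc qE] := peano_kfac a ord_max mu01 sp sz.
rewrite -/K zN pN !mulr0 subrr !mulr0 in qE.
have Kt : K + q t * (t * t) @[t --> (0 : R)^'+] --> K.
  apply: cvg_within_filter; refine (@cvg_eq_lim _ _ _ _ (K + _ * (0 * 0)) _ _ _).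
    exact: (cvgD (cvg_cst _) (cvgM qc (cvgM cvg_id cvg_id))).
  by rewrite !mulr0 addr0.
have qt : q t * t @[t --> (0 : R)^'+] --> (0 : R).
  apply: cvg_within_filter; refine (@cvg_eq_lim _ _ _ _ (_ * 0) _ _ _).
    exact: (cvgM qc cvg_id).
  by rewrite mulr0.
have h : (K + q t * (t * t)) * g t + u y * (q t * t) @[t --> (0 : R)^'+] --> K * (kfac mu p z * d).
  refine (@cvg_eq_lim _ _ _ _ (K * (kfac mu p z * d) + u y * 0) _ _ _).
    exact: (cvgD (cvgM Kt gc) (cvgM (cvg_cst _) qt)).
  by rewrite mulr0 addr0.
apply: cvg_trans h; apply: near_eq_cvg.
have kl := kphi_line u ord_max mu01 sp sz.
have kl' : \forall t \near (0 : R)^'+, u (kphi mu p (nrm (z + t *: eN))) =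
    ext u (y + (t *: (E^-1 *: ((1 - mu ^+ 2) *: eN + (2 * (mu * z ord0 ord_max - p ord0 ord_max)) *: p))
      + (enorm (z + t *: eN) - 1 - t * z ord0 ord_max) *: ((2 * mu / E) *: p))).
  by rewrite near_withinE; apply: filterS kl.
near=> t.
have t0 : t != 0 by rewrite gt_eqF//; near: t; exact: nbhs_right_gt.
rewrite extE /kelvin qE mul0r addr0.
have -> : u (kphi mu p (nrm (z + t *: eN))) =
    ext u (y + (t *: (kfac mu p z *: eN) + (enorm (z + t *: eN) - 1 - t * z ord0 ord_max) *: ((2 * mu / E) *: p))).
  rewrite (_ : kfac mu p z *: eN = E^-1 *: ((1 - mu ^+ 2) *: eN + (2 * (mu * z ord0 ord_max - p ord0 ord_max)) *: p)).
    by near: t.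
  by rewrite zN pN mulr0 subrr mulr0 scale0r addr0 scalerA mulrC.
rewrite /g -/K -/y; by field.
Unshelve. all: by end_near. Qed.

End NormalDerivativeRules.

(** * Linear bounds from the monotone quotients *)

Section Nonlinearity.
Variable R : realType.
Implicit Types (f b : R -> R).

(** 5 is the largest value of (n + 2) / (n - 2) for n >= 3. Comparison with the fifth power, which
    factors through [th - 1], treats all real exponents at once. *)
Lemma powR_sub1_le (q th T : R) : 0 <= q <= 5 -> 1 <= th <= T ->
  th `^ q - 1 <= 5 * T ^+ 4 * (th - 1).
Proof.
move=> /andP[q0 q5] /andP[th1 thT].
have h : th `^ q <= th ^+ 5.
  by rewrite -powR_mulrn ?(le_trans ler01)//; exact: ler_powR.
apply: le_trans (_ : th ^+ 5 - 1 <= _); first by rewrite lerD2r.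
have -> : th ^+ 5 - 1 = (th ^+ 4 + th ^+ 3 + th ^+ 2 + th + 1) * (th - 1) by ring.
rewrite ler_wpM2r ?subr_ge0//.
have th0 : 0 <= th by rewrite (le_trans ler01).
have T1 : 1 <= T by rewrite (le_trans th1).
have T0 : 0 <= T by rewrite (le_trans ler01).
have pw k : (k <= 4)%N -> th ^+ k <= T ^+ 4.
  move=> k4; apply: (@le_trans _ _ (T ^+ k)); first by rewrite lerXn2r.
  exact: ler_weXn2l.
have := pw 4%N isT; have := pw 3%N isT; have := pw 2%N isT; have := pw 1%N isT; have := pw 0%N isT.
by rewrite expr0 expr1; lra.
Qed.

Lemma powR_sub1_ge (q th : R) : 0 <= q <= 5 -> 0 < th <= 1 ->
  1 - th `^ q <= 5 * (1 - th).
Proof.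
move=> /andP[q0 q5] /andP[th0 th1].
have h : th ^+ 5 <= th `^ q.
  by rewrite -powR_mulrn ?(ltW th0)//; apply: ger_powR => //; rewrite th0.
apply: le_trans (_ : 1 - th ^+ 5 <= _); first by rewrite lerD2l lerN2.
have -> : 1 - th ^+ 5 = (th ^+ 4 + th ^+ 3 + th ^+ 2 + th + 1) * (1 - th) by ring.
rewrite ler_wpM2r ?subr_ge0//.
have pw k : th ^+ k <= 1 by rewrite exprn_ile1// ltW.
have := pw 4%N; have := pw 3%N; have := pw 2%N; lra.
Qed.

(* Transfers a decreasing quotient [t^-q f t] to the rescaled value [J^a y]. *)
Lemma decreasing_quotient_lt (a q J s t : R) F : 0 < a -> 0 < J -> 0 < s -> 0 < t ->
  t `^ (- q) * F t < s `^ (- q) * F s ->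
  J `^ (a * q) * F t < F s * (J `^ a * t / s) `^ q.
Proof.
move=> a0 J0 s0 t0; rewrite !powRN => h.
have tq : 0 < t `^ q by rewrite powR_gt0.
have sq : 0 < s `^ q by rewrite powR_gt0.
have Jq : 0 < J `^ (a * q) by rewrite powR_gt0.
rewrite powRM ?mulr_ge0 ?powR_ge0 ?invr_ge0 ?(ltW t0) ?(ltW s0)// powRM ?powR_ge0 ?(ltW t0)//.
rewrite -powRrM -powR_inv1 ?(ltW s0)// powRAC powR_inv1 ?powR_ge0//.
rewrite (_ : F s * _ = J `^ (a * q) * (t `^ q * ((s `^ q)^-1 * F s))); last by ring.
rewrite ltr_pM2l// -(ltr_pM2l (x := (t `^ q)^-1)) ?invr_gt0//.
by rewrite [ltRHS]mulrA mulVf ?mul1r// gt_eqF.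
Qed.

Lemma decreasing_quotient_le (a q J s t : R) F : 0 < a -> 0 < J -> 0 < s -> 0 < t ->
  t `^ (- q) * F t <= s `^ (- q) * F s ->
  J `^ (a * q) * F t <= F s * (J `^ a * t / s) `^ q.
Proof.
move=> a0 J0 s0 t0; rewrite !powRN => h.
have tq : 0 < t `^ q by rewrite powR_gt0.
have sq : 0 < s `^ q by rewrite powR_gt0.
have Jq : 0 < J `^ (a * q) by rewrite powR_gt0.
rewrite powRM ?mulr_ge0 ?powR_ge0 ?invr_ge0 ?(ltW t0) ?(ltW s0)// powRM ?powR_ge0 ?(ltW t0)//.
rewrite -powRrM -powR_inv1 ?(ltW s0)// powRAC powR_inv1 ?powR_ge0//.
rewrite (_ : F s * _ = J `^ (a * q) * (t `^ q * ((s `^ q)^-1 * F s))); last by ring.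
rewrite ler_pM2l// -(ler_pM2l (x := (t `^ q)^-1)) ?invr_gt0//.
by rewrite [leRHS]mulrA mulVf ?mul1r// gt_eqF.
Qed.

Section Conformal.
Variables (n : nat) (f b : R -> R).
Hypothesis n3 : (3 <= n)%N.
Let a : R := (n%:R - 2) / 2.
Let q1 : R := (n%:R + 2) / (n%:R - 2).
Let q2 : R := n%:R / (n%:R - 2).
Let c0 : R := n%:R * (n%:R - 2) / 4.
Hypothesis h1_decr : forall s t : R, 0 < s -> s < t ->
  t `^ (- q1) * (f t + c0 * t) < s `^ (- q1) * (f s + c0 * s).
Hypothesis k1_nincr : forall s t : R, 0 < s -> s < t ->
  t `^ (- q2) * b t <= s `^ (- q2) * b s.
Hypothesis k1_ge0 : forall t : R, 0 < t -> 0 <= t `^ (- q2) * b t.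

Lemma dim_ge3 : 3 <= n%:R :> R.
Proof. by rewrite ler_nat. Qed.

Lemma weight_gt0 : 0 < a.
Proof. by have := dim_ge3; rewrite /a; lra. Qed.

Lemma weight_dim : n%:R = 2 * (a + 1) :> R.
Proof. by rewrite /a; field. Qed.

Lemma c0_weight : c0 = a * (a + 1).
Proof. by rewrite /c0 /a; field. Qed.

Lemma c0_gt0 : 0 < c0.
Proof. by rewrite c0_weight; have := weight_gt0 => ?; rewrite mulr_gt0// addr_gt0. Qed.

Lemma q1_bounds : 0 <= q1 <= 5.
Proof.
have := dim_ge3 => n3'; rewrite /q1 divr_ge0/=; [|lra|lra].
by rewrite ler_pdivrMr; lra.
Qed.

Lemma q2_bounds : 0 <= q2 <= 5.
Proof.
have := dim_ge3 => n3'; rewrite /q2 divr_ge0/=; [|lra|lra].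
by rewrite ler_pdivrMr; lra.
Qed.

(** This and [weight_q2] say that the exponents are critical: J^(a q1) = J^a J^2 and J^(a q2) = J^a
    J are the factors that the Kelvin transform puts on the Laplacian and on the normal
    derivative. *)
Lemma weight_q1 : a * q1 = a + 2.
Proof.
have nn : n%:R - 2 != 0 :> R by rewrite subr_eq0 gt_eqF// ltr_nat.
by rewrite /a /q1; field.
Qed.

Lemma weight_q2 : a * q2 = a + 1.
Proof.
have nn : n%:R - 2 != 0 :> R by rewrite subr_eq0 gt_eqF// ltr_nat.
by rewrite /a /q2; field.
Qed.

Lemma b_ge0 t : 0 < t -> 0 <= b t.
Proof.
by move=> t0; have := k1_ge0 t0; rewrite pmulr_rge0// powR_gt0.
Qed.

(** With s = u x, t = u (kphi mu p x) and J the conformal factor, the left side is the Laplacian of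
    the difference between [u] and its transform; the order s < t is what makes [h1_decr]
    applicable. *)
Lemma lap_difference_lt (J s t : R) : 0 < J -> 0 < s -> s < t ->
  - f s - J `^ a * (J ^+ 2 * - f t + a * (a + 1) * (1 - J ^+ 2) * t) <
  (f s + c0 * s) * ((J `^ a * t / s) `^ q1 - 1) + c0 * (s - J `^ a * t).
Proof.
move=> J0 s0 st.
have := decreasing_quotient_lt (F := fun t => f t + c0 * t) weight_gt0 J0 s0 (lt_trans s0 st) (h1_decr s0 st).
rewrite weight_q1 powRD ?(gt_eqF J0) ?implybT// powR_mulrn ?(ltW J0)// -c0_weight.
by move: (J `^ a) => K; lra.
Qed.

Lemma nd_difference_le (J s t : R) : 0 < J -> 0 < s -> s < t ->
  - b s - J `^ a * (J * - b t) <= b s * ((J `^ a * t / s) `^ q2 - 1).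
Proof.
move=> J0 s0 st.
have := decreasing_quotient_le (F := b) weight_gt0 J0 s0 (lt_trans s0 st) (k1_nincr s0 st).
rewrite weight_q2 powRD ?(gt_eqF J0) ?implybT// powRr1 ?(ltW J0)//.
by move: (J `^ a) => K; lra.
Qed.

Lemma value_le_of_kelvin_ge (J s t : R) : 0 < J <= 1 -> 0 < t -> s < J `^ a * t -> s < t.
Proof.
move=> /andP[J0 J1] t0; move/lt_le_trans; apply.
rewrite -[leRHS]mul1r ler_wpM2r ?(ltW t0)//.
by rewrite -(powRr0 J); apply: ger_powR; rewrite ?J0// (ltW weight_gt0).
Qed.

(* The estimates used where [u < V = J^a t]; [m] and [M] bound [u] from below
   and above, [B] bounds the nonlinearity. *)
Lemma lap_difference_neg (J s t m M B : R) : 0 < J <= 1 -> 0 < m -> m <= s -> t <= M ->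
  s < J `^ a * t -> `|f s + c0 * s| <= B -> 0 < t ->
  - f s - J `^ a * (J ^+ 2 * - f t + a * (a + 1) * (1 - J ^+ 2) * t)
   <= B * (5 * (M / m) ^+ 4) / m * (J `^ a * t - s).
Proof.
move=> J01 m0 ms tM sV FB t0; have /andP[J0 J1] := J01.
have s0 : 0 < s := lt_le_trans m0 ms.
have st := value_le_of_kelvin_ge J01 t0 sV.
apply: le_trans (ltW (lap_difference_lt J0 s0 st)) _.
set V := J `^ a * t in sV *.
have VM : V <= M.
  apply: le_trans tM; rewrite -[leRHS]mul1r ler_wpM2r ?(ltW t0)//.
  by rewrite -(powRr0 J); apply: ger_powR; rewrite ?J0// (ltW weight_gt0).
have th : 1 <= V / s <= M / m.
  rewrite ler_pdivlMr// mul1r (ltW sV)/=.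
  apply: ler_pM => //; [exact: le_trans (ltW s0) (ltW sV)|by rewrite invr_ge0 ltW|].
  by rewrite lef_pV2 ?posrE.
have T1 : 0 <= M / m by case/andP: th => h1 h2; rewrite (le_trans _ h2)// (le_trans _ h1).
have := powR_sub1_le q1_bounds th.
have th0 : 0 <= (V / s) `^ q1 - 1.
  rewrite subr_ge0 -(powRr0 (V / s)); apply: ler_powR; first by case/andP: th.
  by case/andP: q1_bounds.
set X := (V / s) `^ q1 - 1 in th0 *; move=> XT.
have : c0 * (s - V) <= 0 by rewrite nmulr_lle0 ?ltW ?c0_gt0// ?subr_lt0// mulr_ge0_le0 // ?ltW ?c0_gt0 // subr_lt0.
have h1 : (f s + c0 * s) * X <= B * X.
  by rewrite ler_wpM2r// (le_trans (ler_norm _)).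
have B0 : 0 <= B by rewrite (le_trans _ FB).
have h2 : B * X <= B * (5 * (M / m) ^+ 4 * (V / s - 1)) by rewrite ler_wpM2l.
have h3 : V / s - 1 <= (V - s) / m.
  rewrite (_ : V / s - 1 = (V - s) / s); last by field; rewrite gt_eqF.
  by rewrite ler_wpM2l ?subr_ge0 ?(ltW sV)// lef_pV2 ?posrE.
have h4 : B * (5 * (M / m) ^+ 4 * (V / s - 1)) <= B * (5 * (M / m) ^+ 4 * ((V - s) / m)).
  by rewrite ler_wpM2l// ler_wpM2l// mulr_ge0// exprn_ge0.
rewrite (_ : B * (5 * (M / m) ^+ 4) / m * (V - s) = B * (5 * (M / m) ^+ 4 * ((V - s) / m))); last by field; rewrite gt_eqF.
by lra.
Qed.

Lemma nd_difference_neg (J s t m M B : R) : 0 < J <= 1 -> 0 < m -> m <= s -> t <= M ->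
  s < J `^ a * t -> b s <= B -> 0 < t ->
  - b s - J `^ a * (J * - b t) <= B * (5 * (M / m) ^+ 4) / m * (J `^ a * t - s).
Proof.
move=> J01 m0 ms tM sV FB t0; have /andP[J0 J1] := J01.
have s0 : 0 < s := lt_le_trans m0 ms.
have st := value_le_of_kelvin_ge J01 t0 sV.
apply: le_trans (nd_difference_le J0 s0 st) _.
set V := J `^ a * t in sV *.
have VM : V <= M.
  apply: le_trans tM; rewrite -[leRHS]mul1r ler_wpM2r ?(ltW t0)//.
  by rewrite -(powRr0 J); apply: ger_powR; rewrite ?J0// (ltW weight_gt0).
have th : 1 <= V / s <= M / m.
  rewrite ler_pdivlMr// mul1r (ltW sV)/=.
  apply: ler_pM => //; [exact: le_trans (ltW s0) (ltW sV)|by rewrite invr_ge0 ltW|].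
  by rewrite lef_pV2 ?posrE.
have T1 : 0 <= M / m by case/andP: th => h1 h2; rewrite (le_trans _ h2)// (le_trans _ h1).
have := powR_sub1_le q2_bounds th.
have th0 : 0 <= (V / s) `^ q2 - 1.
  rewrite subr_ge0 -(powRr0 (V / s)); apply: ler_powR; first by case/andP: th.
  by case/andP: q2_bounds.
set X := (V / s) `^ q2 - 1 in th0 *; move=> XT.
have h1 : b s * X <= B * X by rewrite ler_wpM2r.
have B0 : 0 <= B by rewrite (le_trans _ FB)// b_ge0.
have h2 : B * X <= B * (5 * (M / m) ^+ 4 * (V / s - 1)) by rewrite ler_wpM2l.
have h3 : V / s - 1 <= (V - s) / m.
  rewrite (_ : V / s - 1 = (V - s) / s); last by field; rewrite gt_eqF.
  by rewrite ler_wpM2l ?subr_ge0 ?(ltW sV)// lef_pV2 ?posrE.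
have h4 : B * (5 * (M / m) ^+ 4 * (V / s - 1)) <= B * (5 * (M / m) ^+ 4 * ((V - s) / m)).
  by rewrite ler_wpM2l// ler_wpM2l// mulr_ge0// exprn_ge0.
rewrite (_ : B * (5 * (M / m) ^+ 4) / m * (V - s) = B * (5 * (M / m) ^+ 4 * ((V - s) / m))); last by field; rewrite gt_eqF.
by lra.
Qed.

(** At a contact point both terms on the right of [lap_difference_lt] vanish, and its strictness
    remains. *)
Lemma lap_difference_zero (J s t : R) : 0 < J -> 0 < s -> s < t -> s = J `^ a * t ->
  - f s - J `^ a * (J ^+ 2 * - f t + a * (a + 1) * (1 - J ^+ 2) * t) < 0.
Proof.
move=> J0 s0 st sV; apply: lt_le_trans (lap_difference_lt J0 s0 st) _.
by rewrite -sV divff ?gt_eqF// powR1 subrr mulr0 subrr mulr0 addr0.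
Qed.

(** The companion estimate where the transform lies below [u]; it has the form that [strong_min]
    asks for. *)
Lemma lap_difference_pos (J s t m B : R) : 0 < J -> 0 < m -> m <= s -> s < t ->
  J `^ a * t <= s -> `|f s + c0 * s| <= B ->
  - f s - J `^ a * (J ^+ 2 * - f t + a * (a + 1) * (1 - J ^+ 2) * t)
   <= (5 * B / m + c0) * (s - J `^ a * t).
Proof.
move=> J0 m0 ms st Vs FB.
have s0 : 0 < s := lt_le_trans m0 ms.
apply: le_trans (ltW (lap_difference_lt J0 s0 st)) _.
have V0 : 0 < J `^ a * t by rewrite mulr_gt0 ?powR_gt0// (lt_trans s0).
set V := J `^ a * t in Vs V0 *.
have th : 0 < V / s <= 1 by rewrite divr_gt0//= ler_pdivrMr// mul1r.
have := powR_sub1_ge q1_bounds th.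
have th0 : 0 <= 1 - (V / s) `^ q1.
  have /andP[q0 _] := q1_bounds.
  by rewrite subr_ge0 -(powRr0 (V / s)); apply: ger_powR.
set X := (V / s) `^ q1 in th0 *; move=> XT.
have B0 : 0 <= B by rewrite (le_trans _ FB).
have h1 : (f s + c0 * s) * (X - 1) <= B * (1 - X).
  have h : - B <= f s + c0 * s by move: FB; rewrite ler_norml => /andP[].
  have := ler_wpM2r th0 h; lra.
have h2 : B * (1 - X) <= B * (5 * (1 - V / s)) by rewrite ler_wpM2l.
have h3 : 1 - V / s <= (s - V) / m.
  rewrite (_ : 1 - V / s = (s - V) / s); last by field; rewrite gt_eqF.
  by rewrite ler_wpM2l ?subr_ge0// lef_pV2 ?posrE.
have h4 : B * (5 * (1 - V / s)) <= B * (5 * ((s - V) / m)).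
  by rewrite ler_wpM2l// ler_wpM2l.
rewrite (_ : (5 * B / m + c0) * (s - V) = B * (5 * ((s - V) / m)) + c0 * (s - V)); last by field; rewrite gt_eqF.
by lra.
Qed.

Lemma nd_difference_pos (J s t : R) : 0 < J -> 0 < s -> s < t ->
  J `^ a * t <= s -> - b s - J `^ a * (J * - b t) <= 0.
Proof.
move=> J0 s0 st Vs; apply: le_trans (nd_difference_le J0 s0 st) _.
have V0 : 0 < J `^ a * t by rewrite mulr_gt0 ?powR_gt0// (lt_trans s0).
rewrite mulr_ge0_le0 ?b_ge0// subr_le0 -(powRr0 (J `^ a * t / s)).
have /andP[q0 _] := q2_bounds; apply: ger_powR => //.
by rewrite divr_gt0//= ler_pdivrMr// mul1r.
Qed.

End Conformal.
End Nonlinearity.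

(** * Hemisphere and sphere treated together, and tests at minima *)

Section Domains.
Variables (R : realType) (n : nat).
Local Notation V := 'rV[R]_(n.+1).
Local Notation eN := (ebasis R (@ord_max n)).
Implicit Types (x y z p : V) (u W w g : V -> R) (D K : set V) (be : bool).

(* [be = true] is the closed hemisphere with its equator as boundary,
   [be = false] the whole sphere, which has no boundary. *)
Definition dom be : set V := [set x | sphere x /\ (be -> 0 <= xlast x)].
Definition idom be : set V := [set x | sphere x /\ (be -> 0 < xlast x)].

Definition cont_on D W : Prop :=
  forall x, D x -> W y @[y --> within D (nbhs x)] --> W x.

Lemma cont_on_min D W : compact D -> D !=set0 -> cont_on D W ->
  exists2 x, D x & forall y, D y -> W x <= W y.
Proof.
move=> cD D0 cW.
have cW' : {within D, continuous W} by apply/subspace_continuousP.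
have [x /set_mem Dx xmin] := compact_EVT_min D0 cD cW'.
by exists x => // y Dy; apply: xmin; exact/mem_set.
Qed.

Lemma cont_onW D D' W : D' `<=` D -> cont_on D W -> cont_on D' W.
Proof.
move=> DD cW x /DD Dx; apply: cvg_trans (cW _ Dx).
move=> P; rewrite /nbhs /= => h.
exact: (@filterS _ (nbhs x) _ _ _ (fun y hy Dy => hy (DD y Dy)) h).
Qed.

Lemma cont_onD D W1 W2 : cont_on D W1 -> cont_on D W2 ->
  cont_on D (fun x => W1 x + W2 x).
Proof. by move=> c1 c2 x Dx; exact: (cvgD (c1 x Dx) (c2 x Dx)). Qed.

Lemma cont_onZ D (c : R) W : cont_on D W -> cont_on D (fun x => c * W x).
Proof. by move=> c1 x Dx; exact: (cvgM (cvg_cst _) (c1 x Dx)). Qed.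

Lemma cont_onT D W : continuous W -> cont_on D W.
Proof. by move=> c x Dx; apply: cvg_within_filter; exact: c. Qed.

Lemma cont_on_comp D W (G : R -> R) : cont_on D W ->
  (forall x, D x -> {for W x, continuous G}) -> cont_on D (fun x => G (W x)).
Proof. by move=> cW cG x Dx; exact: (cvg_comp _ _ (cW x Dx) (cG x Dx)). Qed.

Lemma cont_on_near D W x (P : R -> Prop) : cont_on D W -> D x ->
  (\forall t \near W x, P t) -> \forall y \near x, D y -> P (W y).
Proof. by move=> cW Dx nP; exact: (cW x Dx _ nP). Qed.

Lemma sphere_closed : closed (@sphere R n).
Proof.
have -> : @sphere R n = (fun x : V => edot x x) @^-1` [set t | t = 1] by [].
by apply: closed_comp; [move=> x _; exact: edot_diag_continuous|exact: closed_eq].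
Qed.

Lemma closed_edot_le p (c : R) : closed [set x : V | edot x p <= c].
Proof.
have -> : [set x : V | edot x p <= c] = (fun x : V => edot x p) @^-1` [set t | t <= c] by [].
by apply: closed_comp; [move=> x _; exact: edot_continuous|exact: closed_le].
Qed.

Lemma closed_edot_ge p (c : R) : closed [set x : V | c <= edot x p].
Proof.
have -> : [set x : V | c <= edot x p] = (fun x : V => edot x p) @^-1` [set t | c <= t] by [].
by apply: closed_comp; [move=> x _; exact: edot_continuous|exact: closed_ge].
Qed.

Lemma dom_compact be : compact (dom be).
Proof.
have cS : compact (@sphere R n).
  apply: bounded_closed_compact; last exact: sphere_closed.
  exists 1; split; first exact: num_real.
  move=> M M1 k kS /=; apply: le_trans (ltW M1).
  by rewrite -(@ler_pXn2r _ 2)// ?nnegrE// expr1n -(kS : edot k k = 1) norm_le_edot.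
case: be; last first.
  rewrite (_ : dom false = @sphere R n)//.
  by apply/seteqP; split => [x []|x sx]//; split.
rewrite (_ : dom true = @sphere R n `&` [set x : V | 0 <= edot x eN]).
  by apply: compact_closedI => //; exact: closed_edot_ge.
apply/seteqP; split => x [sx h]; split => //; rewrite ?xlastE//.
  by rewrite /= -xlastE; exact: h.
Qed.

Lemma idom_dom be x : idom be x -> dom be x.
Proof. by move=> [sx h]; split=> // /h /ltW. Qed.

Lemma dom_true x : dom true x <-> hemi_cl x.
Proof. by split=> -[sx h]; split=> //; exact: h. Qed.

Lemma dom_cases be x : dom be x -> idom be x \/ (be /\ equator x).
Proof.
move=> [sx h]; case: be h => h; last by left; split.
have := h isT; rewrite le_eqVlt => /orP[/eqP e|]; last by left; split.
by right; split=> //; split=> //; rewrite -e.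
Qed.

Lemma near_idom be x : idom be x -> \forall y \near x, sphere y -> idom be y.
Proof.
move=> [sx]; case: be => h; last by near=> y => sy; split.
have x0 : 0 < edot x eN by rewrite -xlastE; exact: h.
have nx : \forall y \near x, 0 < edot y eN.
  by apply: (cvgr_gt _ (@edot_continuous _ _ eN x)).
near=> y => sy; split=> // _; rewrite xlastE; by near: y.
Unshelve. all: by end_near. Qed.

(* At a minimum of [w / g] both tests apply to [w - (w x0 / g x0) g]. *)
Lemma min_ratio be K w g : K `<=` dom be -> compact K -> K !=set0 ->
  cont_on K w -> cont_on K g -> (forall x, K x -> 0 < g x) ->
  exists x0, [/\ K x0, forall x, K x -> w x0 / g x0 * g x <= w x &
    (\forall y \near x0, dom be y -> K y) ->
    (forall l1 l2, idom be x0 -> has_lap w x0 l1 -> has_lap g x0 l2 ->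
       0 <= l1 - w x0 / g x0 * l2) /\
    (forall d1 d2, be -> equator x0 -> nd w x0 d1 -> nd g x0 d2 ->
       0 <= d1 - w x0 / g x0 * d2)].
Proof.
move=> Kd cK K0 cw cg g0.
have cr : cont_on K (fun x => w x / g x).
  move=> x Kx; apply: (cvgM (cw x Kx)); apply: cvgV; last exact: cg.
  by rewrite gt_eqF// g0.
have [x0 Kx0 xmin] := cont_on_min cK K0 cr.
have le0 x : K x -> w x0 / g x0 * g x <= w x.
  by move=> Kx; rewrite -ler_pdivlMr ?g0//; exact: xmin.
exists x0; split=> // nK.
set z0 := w x0 / g x0 in le0 *.
have W0 : w x0 + - z0 * g x0 = 0.
  by rewrite /z0 mulNr divfK ?subrr// gt_eqF// g0.
have Wge x : K x -> w x0 + - z0 * g x0 <= w x + - z0 * g x.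
  by move=> Kx; rewrite W0 mulNr subr_ge0; exact: le0.
split=> [l1 l2 ix0 h1 h2|d1 d2 bt ex0 h1 h2].
  have [sx0 _] := ix0.
  have := has_lapD h1 (has_lapZ (- z0) h2); rewrite mulNr; apply: lap_min => //.
  have ni := near_idom ix0.
  by near=> y => sy; apply: Wge; have : dom be y; [apply: idom_dom; move: sy; near: y|near: y].
have := ndD h1 (ndZ (c := - z0) h2); rewrite mulNr; apply: nd_min => //.
near=> y => -[sy hy]; apply: Wge.
by have : dom be y by []; near: y.
Unshelve. all: by end_near. Qed.

End Domains.

Lemma powR_continuous (R : realType) (al x : R) : 0 < x -> {for x, continuous (fun y : R => y `^ al)}.
Proof.
move=> x0; have [d _] := is_derive1_powR al x0.
by apply: differentiable_continuous; exact/derivable1_diffP.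
Qed.


(** * Bounds on the conformal factor and joint continuity of the transform *)

Section KelvinTransform.
Variables (R : realType) (n : nat).
Local Notation V := 'rV[R]_(n.+1).
Local Notation eN := (ebasis R (@ord_max n)).
Implicit Types (x y z p : V) (u W w g : V -> R) (D K : set V) (be : bool) (mu : R).

Lemma kfac_le1 mu p x : 0 <= mu < 1 -> sphere p -> sphere x ->
  edot x p <= mu -> kfac mu p x <= 1.
Proof.
move=> mu01 sp sx t; have d0 := kden_gt0 mu01 sp sx; have /andP[m0 m1] := mu01.
rewrite /kfac ler_pdivrMr// mul1r /kden.
have : 2 * mu * edot x p <= 2 * mu * mu by rewrite ler_wpM2l// mulr_ge0.
by lra.
Qed.

Lemma kfac_lt1 mu p x : 0 < mu < 1 -> sphere p -> sphere x ->
  edot x p < mu -> kfac mu p x < 1.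
Proof.
move=> /andP[m0 m1] sp sx t; have d0 : 0 < kden mu p x by rewrite kden_gt0 ?(ltW m0).
rewrite /kfac ltr_pdivrMr// mul1r /kden.
have : 2 * mu * edot x p < 2 * mu * mu by rewrite ltr_pM2l// mulr_gt0.
by lra.
Qed.

Lemma kelvin_fixed (a : R) mu p u x : 0 <= mu < 1 -> edot x p = mu -> kelvin a mu p u x = u x.
Proof.
move=> /andP[m0 m1] t.
have kd : kden mu p x = 1 - mu ^+ 2 by rewrite /kden t; ring.
have m2 : 1 - mu ^+ 2 != 0 by rewrite subr_eq0 eq_sym lt_eqF// expr_lt1.
rewrite /kelvin /kfac /kphi kd t subrr mulr0 scale0r addr0 divff// powR1 mul1r.
by rewrite scalerA mulVf// scale1r.
Qed.

Lemma kelvin0 (a : R) p u x : kelvin a 0 p u x = u (x - (2 * edot x p) *: p).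
Proof.
rewrite /kelvin /kfac /kphi /kden expr0n mulr0 mul0r !subr0 addr0 divr1 powR1 mul1r.
by rewrite invr1 !scale1r sub0r mulrN scaleNr.
Qed.

Lemma dom_kphi be mu p x : 0 <= mu < 1 -> sphere p -> (be -> xlast p = 0) ->
  dom be x -> dom be (kphi mu p x).
Proof.
move=> mu01 sp pb [sx h]; split; first exact: kphi_sphere.
by move=> b; rewrite xlast_kphi ?pb// mulr_ge0 ?h// ltW// kfac_gt0.
Qed.

Lemma idom_kphi be mu p x : 0 <= mu < 1 -> sphere p -> (be -> xlast p = 0) ->
  idom be x -> idom be (kphi mu p x).
Proof.
move=> mu01 sp pb [sx h]; split; first exact: kphi_sphere.
by move=> b; rewrite xlast_kphi ?pb// mulr_gt0 ?h// kfac_gt0.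
Qed.

Lemma cvg_to_within (T : Type) (F : set_system T) {FF : Filter F} (g : T -> V) z D :
  g t @[t --> F] --> z -> (\forall t \near F, D (g t)) ->
  g t @[t --> F] --> within D (nbhs z).
Proof.
move=> gz gD P nP.
have h : \forall t \near F, D (g t) -> P (g t) by exact: (gz _ nP).
exact: (@filterS2 _ F FF _ _ _ (fun t ht dt => ht dt) h gD).
Qed.

Lemma cvg_kden (T : Type) (F : set_system T) {FF : Filter F} (m : T -> R) (g : T -> V) mu x p :
  m t @[t --> F] --> mu -> g t @[t --> F] --> x ->
  kden (m t) p (g t) @[t --> F] --> kden mu p x.
Proof.
move=> mc gc; have tc : edot (g t) p @[t --> F] --> edot x p by exact: (cvg_edot gc (cvg_cst p)).
rewrite /kden.
have -> : (fun t => 1 + m t ^+ 2 - 2 * m t * edot (g t) p) =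
  fun t => 1 + m t * m t - 2 * m t * edot (g t) p by [].
exact: (cvgB (cvgD (cvg_cst _) (cvgM mc mc)) (cvgM (cvgM (cvg_cst _) mc) tc)).
Qed.

(** An arbitrary filter covers three uses: continuity in [x], limits in [mu] at fixed [x], and joint
    continuity for the compactness argument. *)
Lemma cvg_kelvin be (a : R) (T : Type) (F : set_system T) {FF : Filter F}
    (m : T -> R) (g : T -> V) mu x p u :
  sphere p -> (be -> xlast p = 0) -> cont_on (dom be) u ->
  0 <= mu < 1 -> dom be x -> m t @[t --> F] --> mu -> g t @[t --> F] --> x ->
  (\forall t \near F, 0 <= m t < 1 /\ dom be (g t)) ->
  kelvin a (m t) p u (g t) @[t --> F] --> kelvin a mu p u x.
Proof.
move=> sp pb uc mu01 dx mc gc nD.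
have [sx _] := dx.
have d0 := kden_gt0 mu01 sp sx; have dn : kden mu p x != 0 by rewrite gt_eqF.
have dc : kden (m t) p (g t) @[t --> F] --> kden mu p x by exact: (cvg_kden mc gc).
have tc : edot (g t) p @[t --> F] --> edot x p by exact: (cvg_edot gc (cvg_cst p)).
have mc2 : 1 - m t ^+ 2 @[t --> F] --> 1 - mu ^+ 2.
  by exact: (cvgB (cvg_cst _) (cvgM mc mc)).
have fc : kfac (m t) p (g t) @[t --> F] --> kfac mu p x.
  by exact: (cvgM mc2 (cvgV dn dc)).
have k0 := kfac_gt0 mu01 sp sx.
have pc : kfac (m t) p (g t) `^ a @[t --> F] --> kfac mu p x `^ a.
  have pcont : {for kfac mu p x, continuous (fun y : R => y `^ a)} by exact: powR_continuous.
  exact: (cvg_comp _ _ fc pcont).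
have yc : kphi (m t) p (g t) @[t --> F] --> kphi mu p x.
  by exact: (cvgZ (cvgV dn dc) (cvgD (cvgZ mc2 gc) (cvgZ (cvgM (cvg_cst _) (cvgB mc tc)) (cvg_cst p)))).
have yd : \forall t \near F, dom be (kphi (m t) p (g t)).
  by apply: filterS nD => t [mt dt]; exact: dom_kphi.
have yw : kphi (m t) p (g t) @[t --> F] --> within (dom be) (nbhs (kphi mu p x)).
  by exact: (cvg_to_within yc yd).
exact: (cvgM pc (cvg_comp _ _ yw (uc _ (dom_kphi mu01 sp pb dx)))).
Qed.

Lemma cont_on_kelvin be (a : R) mu p u : sphere p -> (be -> xlast p = 0) ->
  cont_on (dom be) u -> 0 <= mu < 1 -> cont_on (dom be) (kelvin a mu p u).
Proof.
move=> sp pb uc mu01 x dx.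
apply: (@cvg_kelvin be a _ (within (dom be) (nbhs x)) _ (fun=> mu) id mu x p u) => //.
- exact: cvg_cst.
- exact: cvg_within.
- by rewrite near_withinE; near=> y.
Unshelve. all: by end_near. Qed.

End KelvinTransform.

(** * Strong maximum principle with Hopf's lemma *)

Section StrongMinimum.
Variables (R : realType) (n : nat).
Local Notation V := 'rV[R]_(n.+1).
Local Notation eN := (ebasis R (@ord_max n)).
Implicit Types (x y z p : V) (u W w g : V -> R).

Lemma peano_exprn (c : R) (k : nat) : 0 < c ->
  peano (fun h => (c + h) ^+ k.+2) (c ^+ k.+2) (k.+2%:R * c ^+ k.+1)
    (k.+2%:R * k.+1%:R / 2 * c ^+ k).
Proof.
move=> c0; have := peano_powR k.+2%:R c0.
have e1 : k.+2%:R - 1 = k.+1%:R :> R by rewrite -(natr1 k.+1); ring.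
have e2 : k.+2%:R - 2 = k%:R :> R by rewrite -(natr1 k.+1) -(natr1 k); ring.
rewrite e1 e2 !powR_mulrn ?(ltW c0)//; apply: peano_near.
have n1 : \forall h \near (0 : R), - c < h by apply: lt_nbhsr; rewrite oppr_lt0.
by near=> h; rewrite powR_mulrn// -lerBlDl sub0r ltW//; near: h.
Unshelve. all: by end_near. Qed.

(* The barrier [(x.x1 - tau0)^k] with a center [x1] inside the hemisphere has a
   positive normal derivative on the equator: one comparison yields the
   strong maximum principle and Hopf's boundary lemma at once. *)
Lemma strong_min W x1 (tau0 C : R) : hemi x1 -> -1 <= tau0 < 1 -> 0 <= C ->
  let K := [set x : V | dom true x /\ tau0 <= edot x x1] in
  cont_on K W -> (forall x, K x -> 0 <= W x) -> 0 < W x1 ->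
  (forall x, K x -> idom true x -> exists2 l, has_lap W x l & l <= C * W x) ->
  (forall z, K z -> equator z -> exists2 d, nd W z d & d <= 0) ->
  forall x, K x -> tau0 < edot x x1 -> 0 < W x.
Proof.
move=> [sx1 x1_gt0] /andP[t0_ge t0_lt] C0 K Wc W0 Wx1 Wlap Wnd.
have Kx1 : K x1.
  by split; [split=> // _; exact: ltW|rewrite (_ : edot x1 x1 = 1) ?ltW].
have [r r0 hr] : exists2 r : R, 0 < r & forall y, K y -> `|x1 - y| < r -> W x1 / 2 < W y.
  have h : \forall t \near W x1, W x1 / 2 < t.
    by apply: lt_nbhsr; rewrite ltr_pdivrMr// ltr_pMr// ltr1n.
  have /nbhs_ballP[r /= r0 hr] := cont_on_near Wc Kx1 h.
  by exists r => // y Ky yr; apply: hr => //; rewrite -ball_normE.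
(* If x.x1 >= tau1 then |x - x1|^2 <= r^2 / 2, so the cap about [x1] lies where [W] exceeds
   [W x1 / 2]. *)
pose tau1 : R := 1 - r ^+ 2 / 4.
have r2 : 0 < r ^+ 2 by rewrite exprn_gt0.
have tau1_lt : 0 < 1 - tau1 by rewrite /tau1 opprB addrC subrK divr_gt0.
have far x : K x -> tau1 <= edot x x1 -> W x1 / 2 < W x.
  move=> Kx tx; apply: hr => //.
  rewrite -(@ltr_pXn2r _ 2)// ?nnegrE ?(ltW r0)//.
  apply: le_lt_trans (norm_le_edot _) _.
  have [[sx _] _] := Kx.
  by rewrite edot_sphere_sub// (edotC x1); rewrite /tau1 in tx; lra.
clearbody tau1.
(* Outside that cap 1 - tau^2 >= c (1 - tau1) with c = tau - tau0. The second derivative of the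
   barrier carries this factor times k, which must outweigh the first order term and [C] times the
   barrier. *)
pose k := Num.bound ((n%:R + 2 * C + 1) / (1 - tau1)).
have kE : n%:R + 2 * C + 1 <= k%:R * (1 - tau1).
  rewrite -ler_pdivrMr//; apply/ltW/archi_boundP.
  by rewrite divr_ge0 ?(ltW tau1_lt)// !addr_ge0// mulr_ge0.
pose m : R := W x1 / 2; have m0 : 0 < m by rewrite divr_gt0.
pose bet x : R := (edot x x1 - tau0) ^+ k.+2.
(* Since [edot x x1 - tau0 <= 2], the scaled barrier stays below [W x1 / 2], hence below [W] on the
   inner cap. *)
pose eps : R := m / 2 ^+ k.+2.
have eps0 : 0 < eps by rewrite divr_gt0// exprn_gt0.
have tau_le x : K x -> 0 <= edot x x1 - tau0 <= 2.
  move=> [[sx _] tx]; rewrite subr_ge0 tx/=.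
  by have := edot_sphere_le sx sx1; lra.
have bet_ge0 x : K x -> 0 <= bet x by move=> /tau_le /andP[h _]; exact: exprn_ge0.
have bet_le x : K x -> eps * bet x <= m.
  move=> /tau_le /andP[h1 h2]; rewrite /eps mulrAC ler_pdivrMr ?exprn_gt0//.
  by rewrite ler_wpM2l ?(ltW m0)// /bet lerXn2r ?nnegrE.
have cK : compact K.
  have -> : K = dom true `&` [set x | tau0 <= edot x x1] by [].
  by apply: compact_closedI; [exact: dom_compact|exact: closed_edot_ge].
have Kd : K `<=` dom true by move=> x [].
pose w x := W x + - eps * bet x.
have wc : cont_on K w.
  apply: cont_onD => //; apply: cont_onZ; apply: cont_onT => x.
  have ec : edot y x1 - tau0 @[y --> x] --> edot x x1 - tau0.
    by exact: (cvgB (@edot_continuous R n x1 x) (cvg_cst _)).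
  exact: (cvg_comp _ _ ec (@exprn_continuous _ k.+2 _)).
have oc : cont_on K (fun=> 1 : R) by apply: cont_onT; exact: cst_continuous.
(* With the constant 1 as comparison function this is an ordinary minimum of [w]. *)
have [x0 [Kx0 x0min test]] := min_ratio Kd cK (ex_intro _ x1 Kx1) wc oc (fun _ _ => ltr01).
suff w0 : 0 <= w x0.
  move=> x Kx tx; have := x0min x Kx; rewrite divr1 mulr1 => /(le_trans w0).
  rewrite /w mulNr subr_ge0; apply: lt_le_trans.
  by rewrite mulr_gt0// exprn_gt0// subr_gt0.
rewrite leNgt; apply/negP => wneg.
have Wlt : W x0 < eps * bet x0 by move: wneg; rewrite /w mulNr subr_lt0.
have [dx0 tx0] := Kx0; have [sx0 _] := dx0.
have t_gt : tau0 < edot x0 x1.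
  rewrite lt_neqAle tx0 andbT; apply/eqP => E; move: Wlt.
  by rewrite /bet -E subrr expr0n mulr0 ltNge W0.
have t_lt : edot x0 x1 < tau1.
  rewrite ltNge; apply/negP => /(far _ Kx0) h.
  by have := lt_le_trans Wlt (bet_le _ Kx0); rewrite ltNge ltW.
have [|tl tn] := test.
  have t1 : \forall y \near x0, tau0 < edot y x1.
    by apply: (cvgr_gt _ (@edot_continuous R n x1 x0)).
  by near=> y => dy; split=> //; apply: ltW; near: y.
set c := edot x0 x1 - tau0; have c0 : 0 < c by rewrite subr_gt0.
have c2 : c <= 2 by have /andP[] := tau_le _ Kx0.
have pG : peano (fun h => (fun t => (t - tau0) ^+ k.+2) (edot x0 x1 + h)) ((edot x0 x1 - tau0) ^+ k.+2)
    (k.+2%:R * c ^+ k.+1) (k.+2%:R * k.+1%:R / 2 * c ^+ k).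
  have := peano_exprn k c0; apply: peano_ext => h.
  by rewrite /c addrAC.
have [ix0|[_ ex0]] := dom_cases dx0.
- have [l hl lC] := Wlap _ Kx0 ix0.
  have hb := has_lap_edot (G := fun t => (t - tau0) ^+ k.+2) sx0 pG.
  have := tl _ _ ix0 (has_lapD hl (has_lapZ (- eps) hb)) (has_lap_cst 1 x0).
  rewrite mulr0 subr0 (_ : edot x1 x1 = 1)// leNgt => /negP; apply.
  set tau := edot x0 x1.
  have lb : C * c ^+ k.+2 < 2 * (k.+2%:R * k.+1%:R / 2 * c ^+ k * (1 - tau ^+ 2)) - n%:R * tau * (k.+2%:R * c ^+ k.+1).
    have ck : 0 < c ^+ k by rewrite exprn_gt0.
    rewrite [ltLHS](_ : _ = c ^+ k * (c * (C * c))); last by rewrite !exprS; ring.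
    rewrite [ltRHS](_ : _ = c ^+ k * (k.+2%:R * (k.+1%:R * (1 - tau ^+ 2) - n%:R * tau * c))); last first.
      by rewrite !exprS; field.
    rewrite ltr_pM2l//.
    have tau_le1 : tau <= 1 := edot_sphere_le sx0 sx1.
    have h1 : c * (1 - tau1) <= 1 - tau ^+ 2.
      rewrite (_ : 1 - tau ^+ 2 = (1 + tau) * (1 - tau)); last by ring.
      apply: ler_pM; rewrite ?(ltW c0) ?(ltW tau1_lt)// /c -/tau.
        by rewrite addrC lerD2r; lra.
      by move: (ltW t_lt); rewrite -/tau; lra.
    have h2 : k%:R * (c * (1 - tau1)) <= k.+1%:R * (1 - tau ^+ 2).
      apply: ler_pM => //; first by rewrite mulr_ge0 ?ltW.
      by rewrite ler_nat.
    have h3 : c * (n%:R + 2 * C + 1) <= k.+1%:R * (1 - tau ^+ 2).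
      apply: le_trans h2; rewrite mulrCA; by rewrite ler_wpM2l ?(ltW c0).
    have h4 : n%:R * tau * c <= n%:R * c.
      by rewrite -[n%:R * tau * c]mulrA ler_wpM2l// -[leRHS]mul1r ler_wpM2r// ltW.
    have h5 : c * (2 * C + 1) <= k.+1%:R * (1 - tau ^+ 2) - n%:R * tau * c by lra.
    have h6 : 1 * (c * (2 * C + 1)) <= k.+2%:R * (k.+1%:R * (1 - tau ^+ 2) - n%:R * tau * c).
      apply: ler_pM => //; last by rewrite ler1n.
      by rewrite mulr_ge0 ?(ltW c0)// addr_ge0// mulr_ge0.
    apply: lt_le_trans h6; rewrite mul1r ltr_pM2l//.
    have : C * c <= C * 2 by rewrite ler_wpM2l.
    by lra.
  set lbet := _ - _ in lb *.
  have h1 : l <= C * (eps * bet x0) by apply: le_trans lC _; rewrite ler_wpM2l// ltW.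
  have h2 : eps * (C * bet x0) < eps * lbet by rewrite ltr_pM2l.
  by lra.
- have [d hd d0] := Wnd _ Kx0 ex0.
  have hb := nd_edot (G := fun t => (t - tau0) ^+ k.+2) ex0 pG.
  have := tn _ _ isT ex0 (ndD hd (ndZ (c := - eps) hb)) (nd_cst 1 x0).
  rewrite mulr0 subr0 leNgt => /negP; apply.
  have : 0 < eps * (k.+2%:R * c ^+ k.+1 * xlast x1).
    have ck : 0 < c ^+ k.+1 by rewrite exprn_gt0.
    by apply: mulr_gt0 => //; apply: mulr_gt0 => //; exact: mulr_gt0.
  by lra.
Unshelve. all: by end_near. Qed.

End StrongMinimum.

(** * Moving spheres in a fixed direction [p] *)

Section MovingSpheres.
Variables (R : realType) (n : nat) (f b : R -> R) (be : bool).
Local Notation V := 'rV[R]_(n.+1).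
Local Notation eN := (ebasis R (@ord_max n)).
Implicit Types (x y z : V) (W w g : V -> R) (D K : set V) (mu : R).
Hypothesis n3 : (3 <= n)%N.
Let a : R := (n%:R - 2) / 2.
Let q1 : R := (n%:R + 2) / (n%:R - 2).
Let q2 : R := n%:R / (n%:R - 2).
Let c0 : R := n%:R * (n%:R - 2) / 4.
Hypothesis h1_decr : forall s t : R, 0 < s -> s < t ->
  t `^ (- q1) * (f t + c0 * t) < s `^ (- q1) * (f s + c0 * s).
Hypothesis k1_nincr : forall s t : R, 0 < s -> s < t ->
  t `^ (- q2) * b t <= s `^ (- q2) * b s.
Hypothesis k1_ge0 : forall t : R, 0 < t -> 0 <= t `^ (- q2) * b t.

Variables (u : V -> R) (um uM B1 B2 : R).
Hypothesis u_cont : cont_on (dom be) u.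
Hypothesis um_gt0 : 0 < um.
Hypothesis u_bounds : forall x, dom be x -> um <= u x <= uM.
Hypothesis F_bound : forall x, dom be x -> `|f (u x) + c0 * u x| <= B1.
Hypothesis b_bound : forall x, dom be x -> b (u x) <= B2.
Hypothesis u_lap : forall x, idom be x ->
  exists l Q, taylor (ext u) x l Q /\ 2 * \tr Q = - f (u x).
Hypothesis u_nd : be -> forall z, equator z -> nd u z (- b (u z)).

Variable p : V.
Hypothesis sp : sphere p.
Hypothesis pb : be -> xlast p = 0.

Let diff mu : V -> R := fun x => u x + -1 * kelvin a mu p u x.

Lemma u_gt0 x : dom be x -> 0 < u x.
Proof. by move=> /u_bounds /andP[h _]; exact: lt_le_trans h. Qed.

Lemma lap_diff mu x : 0 <= mu < 1 -> idom be x ->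
  has_lap (diff mu) x (- f (u x) - kfac mu p x `^ a *
    (kfac mu p x ^+ 2 * - f (u (kphi mu p x))
      + a * (a + 1) * (1 - kfac mu p x ^+ 2) * u (kphi mu p x))).
Proof.
move=> mu01 ix; have [sx _] := ix.
have [l [Q [tl tQ]]] := u_lap ix.
have [l' [Q' [tl' tQ']]] := u_lap (idom_kphi mu01 sp pb ix).
have := has_lapD (taylor_has_lap sx tl)
  (has_lapZ (-1) (has_lap_kelvin (weight_dim R n) mu01 sp sx tl')).
by rewrite tQ tQ' mulN1r.
Qed.

Lemma nd_diff mu z : 0 <= mu < 1 -> be -> equator z ->
  nd (diff mu) z (- b (u z) - kfac mu p z `^ a * (kfac mu p z * - b (u (kphi mu p z)))).
Proof.
move=> mu01 bt ez; have [sz z0] := ez.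
have ey : equator (kphi mu p z).
  by split; [exact: kphi_sphere|rewrite xlast_kphi ?pb// z0 mulr0].
have dy : dom be (kphi mu p z) by split; [case: ey|move=> _; case: ey => _ ->].
have hc (e : R) : 0 < e -> \forall x \near kphi mu p z, hemi_cl x -> `|u x - u (kphi mu p z)| <= e.
  move=> e0.
  have h : \forall t \near u (kphi mu p z), `|t - u (kphi mu p z)| <= e.
    have := cvgr_dist_le _ _ (@cvg_id _ (nbhs (u (kphi mu p z)))) _ e0.
    by move=> h; near=> t; rewrite distrC; near: t; exact: h.
  have := cont_on_near u_cont dy h; apply: filterS => x hx [sx x0].
  by apply: hx; split.
have hT : \forall x \near kphi mu p z, hemi x ->
    exists l Q, taylor (ext u) x l Q /\ `|2 * \tr Q| <= B1 + c0 * uM.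
  near=> x => -[sx x0].
  have ix : idom be x by split.
  have [l [Q [tl tQ]]] := u_lap ix; exists l, Q; split=> //; rewrite tQ normrN.
  have := F_bound (idom_dom ix).
  have /andP[_ uxM] := u_bounds (idom_dom ix).
  have ux0 := u_gt0 (idom_dom ix).
  have c00 : 0 < c0 := c0_gt0 R n3.
  have h1 : c0 * u x <= c0 * uM by rewrite ler_wpM2l// ltW.
  have h2 : 0 < c0 * u x by rewrite mulr_gt0.
  by rewrite !ler_norml => /andP[k1 k2]; apply/andP; split; lra.
have := ndD (u_nd bt ez) (ndZ (c := -1)
  (nd_kelvin (a := a) mu01 sp (pb bt) ez hc hT (u_nd bt ey))).
by rewrite mulN1r.
Unshelve. all: by end_near. Qed.

Lemma cont_diff mu : 0 <= mu < 1 -> cont_on (dom be) (diff mu).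
Proof.
move=> mu01; apply: cont_onD => //; apply: cont_onZ; exact: cont_on_kelvin.
Qed.

Lemma has_lap_linear (M c q : R) x q' : sphere x ->
  has_lap (fun y => M * (edot y q' - c) + q) x (- n%:R * edot x q' * M).
Proof.
move=> sx.
have pG : peano (fun h => (fun t => M * (t - c) + q) (edot x q' + h)) (M * (edot x q' - c) + q) M 0.
  by exists (fun=> 0); [exact: cvg_cst|move=> t /=; ring].
have := has_lap_edot (G := fun t => M * (t - c) + q) sx pG.
by rewrite mul0r mulr0 sub0r !mulNr.
Qed.

Definition Good mu : Prop :=
  forall x, dom be x -> edot x p <= mu -> 0 <= diff mu x.

(* A maximum principle in thin strips next to the sphere [x.p = mu]: the
   monotonicity of the quotients bounds the zero order coefficients, and
   [g = 2 + M (x.p - mu) - c s + (c s)^2], with [s] the last coordinate, is a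
   positive strict supersolution there. *)
Lemma thin_strip mu0 : 0 < mu0 <= 1 -> exists2 e : R, 0 < e < mu0 &
  forall mu, 0 < mu < 1 -> mu <= mu0 ->
    (forall x, dom be x -> edot x p <= mu0 - e -> edot x p <= mu -> 0 <= diff mu x) -> Good mu.
Proof.
move=> /andP[mu0_gt0 mu01].
pose T := 5 * (uM / um) ^+ 4.
(* [c] serves the equator: there [g <= 2] and the inward derivative of [g] is [- c], so [c] beats
   [C2 * g]. *)
pose C1 := `|B1| * T / um; pose C2 := `|B2| * T / um; pose c := 2 * C2 + 1.
have uMm x : dom be x -> 0 <= uM / um.
  move=> dx; have /andP[h1 h2] := u_bounds dx.
  by rewrite divr_ge0 ?(ltW um_gt0)// (le_trans _ h2)// (le_trans (ltW um_gt0)).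
have T0 : 0 <= T.
  by rewrite mulr_ge0// -[4%N]/(2 * 2)%N exprM sqr_ge0.
have C10 : 0 <= C1 by rewrite divr_ge0 ?(ltW um_gt0)// mulr_ge0.
have C20 : 0 <= C2 by rewrite divr_ge0 ?(ltW um_gt0)// mulr_ge0.
have c_ge1 : 1 <= c by rewrite /c; lra.
have C1E : `|B1| * (5 * (uM / um) ^+ 4) / um = C1 by [].
have C2E : `|B2| * (5 * (uM / um) ^+ 4) / um = C2 by [].
have cE : c = 2 * C2 + 1 by [].
clearbody c C1 C2.
have cge0 : 0 <= c := le_trans ler01 c_ge1.
have n1 : 1 <= n%:R :> R by rewrite ler1n (leq_trans _ n3).
(* Upper bound for [C1 * g] plus the part of the Laplacian of [g] due to the height. *)
pose S := C1 * (2 + c + c ^+ 2) + 2 * c ^+ 2 + n%:R * c.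
have SE : S = C1 * (2 + c + c ^+ 2) + 2 * c ^+ 2 + n%:R * c by [].
have S0 : 0 <= S by rewrite SE !addr_ge0// mulr_ge0// ?addr_ge0 ?sqr_ge0.
clearbody S.
(* The linear part of [g] contributes [- n M (x.p)] to its Laplacian, and x.p >= mu0 / 2 in the
   strip, so this outweighs [S]. *)
pose M := 1 + S * (2 / mu0).
have M1 : 1 <= M by rewrite /M lerDl mulr_ge0// divr_ge0// ltW.
have ME : M = 1 + S * (2 / mu0) by [].
clearbody M.
have M0 : 0 < M by apply: lt_le_trans M1.
(* The first bound keeps the strip in x.p >= mu0 / 2; the second keeps [M (x.p - mu)] at least -1,
   whence [g >= 1 - c s + (c s)^2 > 0]. *)
pose e := Num.min (mu0 / 2) (M^-1).
have e0 : 0 < e by rewrite lt_min divr_gt0//= invr_gt0.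
have e_mu : e <= mu0 / 2 by rewrite ge_min lexx.
have e_M : M * e <= 1.
  by rewrite -(divff (lt0r_neq0 M0)) ler_wpM2l ?(ltW M0)// ge_min lexx orbT.
exists e; first by rewrite e0 (le_lt_trans e_mu)// ltr_pdivrMr// ltr_pMr// ltr1n.
move=> mu mu01' mumu0 outside x dx xmu.
have mu01w : 0 <= mu < 1 by move: mu01' => /andP[/ltW -> ->].
rewrite leNgt; apply/negP => wneg.
pose K : set V := [set y | dom be y /\ (mu0 - e <= edot y p <= mu)].
have Kx : K x.
  split=> //; rewrite xmu andbT leNgt; apply/negP => xe.
  by move: wneg; rewrite ltNge outside// ltW.
have cK : compact K.
  have -> : K = dom be `&` ([set y | mu0 - e <= edot y p] `&` [set y | edot y p <= mu]).
    by apply/seteqP; split => [y [dy /andP[]]|y [dy [y1 y2]]]//; split=> //; apply/andP.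
  apply: compact_closedI; first exact: dom_compact.
  by apply: closedI; [exact: closed_edot_ge|exact: closed_edot_le].
pose g1 (t : R) := M * (t - mu) + 2.
pose g2 (t : R) := - c * t + c ^+ 2 * (t * t).
pose g y := g1 (edot y p) + g2 (edot y eN).
have Kd : K `<=` dom be by move=> y [].
have gc : cont_on K g.
  apply: cont_onT => y; rewrite /g /g1 /g2.
  have c1 := @edot_continuous R n p y; have c2 := @edot_continuous R n eN y.
  exact: (cvgD (cvgD (cvgM (cvg_cst _) (cvgB c1 (cvg_cst _))) (cvg_cst _))
    (cvgD (cvgM (cvg_cst _) c2) (cvgM (cvg_cst _) (cvgM c2 c2)))).
have Mt y : K y -> -1 <= M * (edot y p - mu) <= 0.
  move=> [_ /andP[y1 y2]]; apply/andP; split; last by rewrite mulr_ge0_le0 ?(ltW M0)// subr_le0.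
  have : M * (- e) <= M * (edot y p - mu) by rewrite ler_wpM2l ?(ltW M0)//; lra.
  by rewrite mulrN; lra.
have g_gt0 y : K y -> 0 < g y.
  move=> /Mt /andP[h _]; rewrite /g /g1 /g2.
  have : 0 <= (c * edot y eN - 2^-1) ^+ 2 by exact: sqr_ge0.
  by rewrite expr2; lra.
have [x0 [Kx0 x0min test]] := min_ratio Kd cK (ex_intro _ x Kx)
   (cont_onW Kd (cont_diff mu01w)) gc g_gt0.
have gx0 := g_gt0 _ Kx0.
set z0 := diff mu x0 / g x0 in x0min test.
have z0neg : z0 < 0.
  rewrite ltNge; apply/negP => z00.
  have := x0min x Kx; rewrite leNgt => /negP; apply.
  by apply: lt_le_trans wneg _; rewrite mulr_ge0// ltW// g_gt0.
have wx0 : diff mu x0 = z0 * g x0 by rewrite /z0 divfK// gt_eqF.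
have wx0neg : diff mu x0 < 0 by rewrite wx0 nmulr_rlt0.
have [dx0 /andP[x0l x0r]] := Kx0; have [sx0 _] := dx0.
have x0l' : mu0 - e < edot x0 p.
  rewrite lt_neqAle x0l andbT; apply/eqP => E.
  by move: wx0neg; rewrite ltNge outside// -E.
have x0r' : edot x0 p < mu.
  rewrite lt_neqAle x0r andbT; apply/eqP => E.
  by move: wx0neg; rewrite /diff kelvin_fixed// mulN1r subrr ltxx.
have [|test_lap test_nd] := test.
  have t1 : \forall y \near x0, mu0 - e < edot y p.
    by apply: (cvgr_gt _ (@edot_continuous R n p x0)).
  have t2 : \forall y \near x0, edot y p < mu.
    by apply: (cvgr_lt _ (@edot_continuous R n p x0)).
  near=> y => dy; split=> //; apply/andP; split; apply: ltW; by near: y.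
set J := kfac mu p x0; set y0 := kphi mu p x0.
have J01 : 0 < J <= 1 by rewrite kfac_gt0//= kfac_le1// ltW.
have dy0 : dom be y0 by exact: dom_kphi.
have wE : diff mu x0 = u x0 - J `^ a * u y0 by rewrite /diff mulN1r.
have sV : u x0 < J `^ a * u y0 by move: wx0neg; rewrite wE subr_lt0.
have /andP[umx uMx] := u_bounds dx0; have /andP[umy uMy] := u_bounds dy0.
have tau0 : mu0 / 2 <= edot x0 p by lra.
have [ix0|[bt ex0]] := dom_cases dx0.
- have lg1 : has_lap (fun y => g1 (edot y p)) x0 (- n%:R * edot x0 p * M).
    exact: has_lap_linear.
  have pG2 : peano (fun h => g2 (edot x0 eN + h)) (g2 (edot x0 eN))
     (- c + 2 * c ^+ 2 * edot x0 eN) (c ^+ 2).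
    by exists (fun=> c ^+ 2); [exact: cvg_cst|move=> t; rewrite /g2; ring].
  have lg := has_lapD lg1 (has_lap_edot sx0 pG2).
  have := test_lap _ _ ix0 (lap_diff mu01w ix0) lg.
  rewrite leNgt => /negP; apply.
  have hl := lap_difference_neg n3 h1_decr J01 um_gt0 umx uMy sV
     (le_trans (F_bound dx0) (ler_norm _)) (u_gt0 dy0).
  rewrite -/J -/y0; move: hl; rewrite C1E.
  set lw := - f (u x0) - _ => hl.
  rewrite edot_basis_diag.
  set s := edot x0 eN.
  have s1 : -1 <= s <= 1.
    have sN : sphere eN by rewrite /sphere /= edot_basis_diag.
    by rewrite edot_sphere_ge// edot_sphere_le.
  set lg' := - n%:R * edot x0 p * M + _.
  have hl2 : lw <= - C1 * diff mu x0 by rewrite wE; lra.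
  (* Since [diff mu x0 = z0 * g x0] with [z0 < 0], the minimum test reduces to [g] being a strict
     supersolution. *)
  suff : C1 * g x0 + lg' < 0.
    move=> key; apply: le_lt_trans (_ : - C1 * diff mu x0 - z0 * lg' < _).
      by rewrite lerD2r.
    rewrite wx0 (_ : _ - _ = - z0 * (C1 * g x0 + lg')); last by ring.
    by rewrite pmulr_rlt0// oppr_gt0.
  have gle : g x0 <= 2 + c + c ^+ 2.
    have /andP[_ h] := Mt _ Kx0; rewrite /g /g1 /g2 -/s.
    have h1 : - c * s <= c by have /andP[s1' _] := s1; have := ler_wpM2l (le_trans ler01 c_ge1) s1'; lra.
    have h2 : c ^+ 2 * (s * s) <= c ^+ 2 * 1.
      rewrite ler_wpM2l ?sqr_ge0//; move: s1 => /andP[h3 h4].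
      have : 0 <= (1 - s) * (1 + s) by rewrite mulr_ge0//; lra.
      by lra.
    by lra.
  have h1 : C1 * g x0 <= C1 * (2 + c + c ^+ 2) by rewrite ler_wpM2l.
  have h2 : lg' <= - n%:R * edot x0 p * M + 2 * c ^+ 2 + n%:R * c.
    rewrite /lg' -/s -!addrA lerD2l.
    have k1 : 0 <= c ^+ 2 * s ^+ 2 by rewrite mulr_ge0 ?sqr_ge0.
    have k2 : n%:R * (s * c) <= n%:R * c.
      rewrite ler_wpM2l// -[leRHS]mul1r ler_wpM2r ?(le_trans ler01 c_ge1)//.
      by case/andP: s1.
    have k3 : 0 <= n%:R * (c ^+ 2 * s ^+ 2) by rewrite mulr_ge0.
    have -> : n%:R * s * (- c + 2 * c ^+ 2 * s) = - (n%:R * (s * c)) + 2 * (n%:R * (c ^+ 2 * s ^+ 2)) by ring.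
    have -> : c ^+ 2 * (1 - s ^+ 2) = c ^+ 2 - c ^+ 2 * s ^+ 2 by ring.
    by lra.
  have h3 : S < n%:R * edot x0 p * M.
    apply: (@lt_le_trans _ _ (1 * (mu0 / 2) * M)).
      rewrite mul1r ME mulrDr mulr1 (_ : mu0 / 2 * (S * (2 / mu0)) = S).
        by rewrite ltrDr divr_gt0.
      by field; rewrite gt_eqF.
    rewrite ler_wpM2r ?(ltW M0)//; apply: ler_pM => //.
    by rewrite divr_ge0// ltW.
  by rewrite SE in h3; lra.
- have ng1 : nd (fun y => g1 (edot y p)) x0 (M * xlast p).
    apply: (@nd_edot _ _ g1 x0 p M 0 ex0).
    by exists (fun=> 0); [exact: cvg_cst|move=> t; rewrite /g1; ring].
  have pG2 : peano (fun h => g2 (edot x0 eN + h)) (g2 (edot x0 eN))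
     (- c + 2 * c ^+ 2 * edot x0 eN) (c ^+ 2).
    by exists (fun=> c ^+ 2); [exact: cvg_cst|move=> t; rewrite /g2; ring].
  have := test_nd _ _ bt ex0 (nd_diff mu01w bt ex0) (ndD ng1 (nd_edot ex0 pG2)).
  rewrite leNgt => /negP; apply.
  have hl := nd_difference_neg n3 k1_nincr k1_ge0 J01 um_gt0 umx uMy sV
     (le_trans (b_bound dx0) (ler_norm _)) (u_gt0 dy0).
  rewrite -/J -/y0; move: hl; rewrite C2E.
  set dw := - b (u x0) - _ => hl.
  have x00 : edot x0 eN = 0 by rewrite -xlastE; case: ex0.
  rewrite pb// mulr0 x00 mulr0 addr0 xlast_pole mulr1 add0r.
  have gle : g x0 <= 2.
    by have /andP[_ h] := Mt _ Kx0; rewrite /g /g1 /g2 x00 !mulr0; lra.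
  have hl2 : dw <= - C2 * diff mu x0 by rewrite wE; lra.
  apply: le_lt_trans (_ : - C2 * diff mu x0 + z0 * c < _); first by lra.
  rewrite wx0 (_ : _ + _ = z0 * (c - C2 * g x0)); last by ring.
  rewrite nmulr_rlt0// cE.
  have : C2 * g x0 <= C2 * 2 by rewrite ler_wpM2l.
  by lra.
Unshelve. all: by end_near. Qed.

Lemma diff_cvg (T : Type) (F : set_system T) {FF : Filter F} (m : T -> R) (g : T -> V) mu x :
  0 <= mu < 1 -> dom be x -> m t @[t --> F] --> mu ->
  g t @[t --> F] --> within (dom be) (nbhs x) ->
  (\forall t \near F, 0 <= m t < 1 /\ dom be (g t)) ->
  diff (m t) (g t) @[t --> F] --> diff mu x.
Proof.
move=> mu01 dx mc gc nD.
have gx : g t @[t --> F] --> x by apply: cvg_trans gc _; exact: cvg_within.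
have kc := cvg_kelvin (a := a) sp pb u_cont mu01 dx mc gx nD.
have {}kc := kc FF.
exact: (cvgD (cvg_comp _ _ gc (u_cont dx)) (cvgM (cvg_cst _) kc)).
Qed.

Lemma good_limit mu0 : 0 <= mu0 < 1 ->
  (forall mu, mu0 < mu < 1 -> Good mu) -> Good mu0.
Proof.
move=> mu01 good x dx tx.
have /andP[m0 m1] := mu01.
have n1 : \forall mu \near mu0^'+, mu0 < mu < 1.
  near=> mu; apply/andP; split; near: mu; first exact: nbhs_right_gt.
  exact: nbhs_right_lt.
have c : diff mu x @[mu --> mu0^'+] --> diff mu0 x.
  apply: (@diff_cvg _ _ _ id (fun=> x)) => //.
  - by apply: cvg_within_filter; exact: cvg_id.
  - by apply: cvg_to_within; [exact: cvg_cst|near=> mu].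
  - near=> mu; split=> //; have /andP[h ->] : mu0 < mu < 1 by near: mu.
    by rewrite andbT (le_trans m0)// ltW.
rewrite -(cvg_lim _ c)//; apply: limr_ge; first by apply/cvg_ex; exists (diff mu0 x).
near=> mu; apply: good => //; first by near: mu.
apply: le_trans tx _; apply: ltW; near: mu; exact: nbhs_right_gt.
Unshelve. all: by end_near. Qed.

(** On x.p <= 1 - e the denominator [kden] stays above [e] while 1 - mu^2 tends to 0. Once the
    conformal factor is below [th], the transform is at most [um]. *)
Lemma good_start (e : R) : 0 < e -> exists2 del : R, 0 < del < 1 &
  forall mu, 1 - del < mu < 1 ->
    forall x, dom be x -> edot x p <= 1 - e -> 0 <= diff mu x.
Proof.
move=> e0; have a0 : 0 < a := weight_gt0 R n3.
pose th := (um / `|uM|) `^ a^-1.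
have [uMn|uMp] := leP uM 0.
  exists 2^-1; first by rewrite invr_gt0 ltr0n invf_lt1 ?ltr1n// ltr0n.
  move=> mu _ x dx _; have /andP[h1 h2] := u_bounds dx.
  by have := lt_le_trans um_gt0 (le_trans h1 (le_trans h2 uMn)); rewrite ltxx.
have th0 : 0 < th by rewrite powR_gt0// divr_gt0// normr_gt0 gt_eqF.
pose del := Num.min (2^-1) (th * e / 2).
have del0 : 0 < del by rewrite lt_min invr_gt0 ltr0n divr_gt0// mulr_gt0.
have del12 : del <= 2^-1 by rewrite ge_min lexx.
have delth : del <= th * e / 2 by rewrite ge_min lexx orbT.
clearbody del.
exists del; first by rewrite del0 (le_lt_trans del12)// invf_lt1 ?ltr1n.
move=> mu /andP[mu1 mu2] x dx tx; have [sx _] := dx.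
have mu_half : 2^-1 <= mu.
  have -> : 2^-1 = 1 - 2^-1 :> R by field.
  by apply: le_trans (ltW mu1); rewrite lerD2l lerN2.
have mu0 : 0 <= mu by rewrite (le_trans _ mu_half)// invr_ge0.
have mu01 : 0 <= mu < 1 by rewrite mu0.
have kd : e <= kden mu p x.
  rewrite /kden.
  have h1 : 2 * mu * edot x p <= 2 * mu * (1 - e) by rewrite ler_wpM2l// mulr_ge0.
  have h2 : e <= 2 * mu * e by rewrite -[leLHS]mul1r ler_wpM2r ?(ltW e0)//; lra.
  have : 0 <= (1 - mu) ^+ 2 by exact: sqr_ge0.
  by rewrite expr2; lra.
have J0 := kfac_gt0 mu01 sp sx.
have Jth : kfac mu p x <= th.
  rewrite /kfac ler_pdivrMr ?kden_gt0//.
  apply: (@le_trans _ _ (th * e)); last by rewrite ler_wpM2l ?(ltW th0).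
  have : (1 - mu) * (1 + mu) <= del * 2 by apply: ler_pM; lra.
  by rewrite (_ : 1 - mu ^+ 2 = (1 - mu) * (1 + mu)); [lra|ring].
have /andP[h1 _] := u_bounds dx.
have dy := dom_kphi mu01 sp pb dx.
have /andP[_ h2] := u_bounds dy.
rewrite /diff mulN1r subr_ge0 /kelvin.
apply: le_trans h1; apply: (@le_trans _ _ (um / uM * uM)); last by rewrite divfK// gt_eqF.
apply: ler_pM => //; rewrite ?powR_ge0 ?(ltW (u_gt0 dy))//.
have -> : um / uM = th `^ a.
  rewrite /th -powRrM mulVf ?gt_eqF// powRr1 (gtr0_norm uMp)// divr_ge0 ?ltW//.
by apply: ge0_ler_powR; rewrite ?nnegrE ?(ltW J0) ?(ltW th0)// ltW.
Qed.

Lemma diff_eq0 mu x : 0 < mu < 1 -> dom be x -> edot x p < mu -> diff mu x = 0 ->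
  u x = kfac mu p x `^ a * u (kphi mu p x) /\ u x < u (kphi mu p x).
Proof.
move=> mu01 dx tx E; have [sx _] := dx.
have mu01w : 0 <= mu < 1 by move: mu01 => /andP[/ltW -> ->].
have dy := dom_kphi mu01w sp pb dx.
have J1 := kfac_lt1 mu01 sp sx tx; have J0 := kfac_gt0 mu01w sp sx.
have sV : u x = kfac mu p x `^ a * u (kphi mu p x).
  by apply/eqP; rewrite -subr_eq0 -[_ - _]/(u x - kelvin a mu p u x) -mulN1r -/(diff mu x) E.
split=> //; rewrite sV -[ltRHS]mul1r ltr_pM2r ?u_gt0//.
have : kfac mu p x `^ a < 1 `^ a.
  by apply: gt0_ltr_powR; rewrite ?nnegrE ?(ltW J0)// weight_gt0.
by rewrite powR1.
Qed.

(** A zero would be an interior minimum of the difference, where [lap_difference_zero] makes the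
    Laplacian strictly negative. *)
Lemma good_strict_interior mu x : 0 < mu < 1 -> Good mu -> idom be x ->
  edot x p < mu -> 0 < diff mu x.
Proof.
move=> mu01 good ix tx; have [sx _] := ix; have dx := idom_dom ix.
have mu01w : 0 <= mu < 1 by move: mu01 => /andP[/ltW -> ->].
rewrite lt_neqAle good ?(ltW tx)// andbT; apply/eqP => E.
have [sV st] := diff_eq0 mu01 dx tx (esym E).
have J0 := kfac_gt0 mu01w sp sx.
have := lap_difference_zero n3 h1_decr J0 (u_gt0 dx) st sV.
rewrite ltNge => /negP; apply.
apply: (lap_min sx _ (lap_diff mu01w ix)); rewrite -E.
have ni := near_idom ix.
have nt : \forall y \near x, edot y p < mu.
  by apply: (cvgr_lt _ (@edot_continuous R n p x)).
near=> y => sy; apply: good; last by apply: ltW; near: y.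
by apply: idom_dom; move: sy; near: y.
Unshelve. all: by end_near. Qed.

(** [k1] is only nonincreasing, so at a contact point on the equator the normal derivative test is
    not strict. Instead [strong_min] is applied in a cap about a nearby interior point, small enough
    that [u x < u (kphi mu p x)] persists, as the quotient comparisons require. *)
Lemma good_strict_boundary mu z : 0 < mu < 1 -> Good mu -> be -> equator z ->
  edot z p < mu -> 0 < diff mu z.
Proof.
move=> mu01 good bt ez tz; have [sz z0] := ez.
have mu01w : 0 <= mu < 1 by move: mu01 => /andP[/ltW -> ->].
have dz : dom be z by split=> // _; rewrite z0.
have dE : @dom R n be = dom true by rewrite bt.
rewrite lt_neqAle good ?(ltW tz)// andbT; apply/eqP => E.
have [sV st] := diff_eq0 mu01 dz tz (esym E).
(* With weight [0] the transform is the composite of [u] with [kphi mu p]. *)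
have cst : cont_on (dom be) (fun x => u x + -1 * kelvin 0 mu p u x).
  by apply: cont_onD => //; apply: cont_onZ; exact: cont_on_kelvin.
have n1 : \forall x \near z, dom be x -> u x + -1 * kelvin 0 mu p u x < 0.
  have h : u z + -1 * kelvin 0 mu p u z < 0 by rewrite /kelvin powRr0 mul1r mulN1r subr_lt0.
  exact: (cont_on_near (P := fun t => t < 0) cst dz (cvgr_lt _ (@cvg_id _ (nbhs _)) _ h)).
have n2 : \forall x \near z, edot x p < mu.
  by apply: (cvgr_lt _ (@edot_continuous R n p z)).
have n12 : \forall x \near z, (dom be x -> u x + -1 * kelvin 0 mu p u x < 0) /\ edot x p < mu.
  by near=> x; split; near: x.
have /nbhs_ballP[r /= r0 hr] := n12.
have c1 : nrm (z + t *: eN) @[t --> (0 : R)] --> z.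
  by exact: (cvg_nrm_sphere sz (@cvg_line _ _ z eN)).
have c2 : edot (nrm (z + t *: eN)) z @[t --> (0 : R)] --> (1 : R).
  rewrite -[X in _ --> X](_ : edot z z = 1)//.
  exact: (cvg_edot c1 (cvg_cst z)).
(* Unit vectors with inner product at least 1 - r^2 / 16 satisfy |x - y|^2 <= r^2 / 8 < (r / 2)^2.
   Two such steps, from the cap to its centre and on to [z], stay in the ball of radius r. *)
have lt1 : Num.max 0 (1 - r ^+ 2 / 16) < 1 by rewrite gt_max ltr01/= ltrBlDr ltrDl divr_gt0// exprn_gt0.
have n3' : \forall t \near (0 : R)^'+, Num.max 0 (1 - r ^+ 2 / 16) < edot (nrm (z + t *: eN)) z.
  have c2' : edot (nrm (z + t *: eN)) z @[t --> (0 : R)^'+] --> (1 : R) by exact: cvg_within_filter.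
  exact: (cvgr_gt _ c2' _ lt1).
have n4 : \forall t \near (0 : R)^'+, hemi (nrm (z + t *: eN)).
  have nz := line_neq0 eN sz.
  have nz' : \forall t \near (0 : R)^'+, z + t *: eN != 0 by rewrite near_withinE; apply: filterS nz.
  near=> t; split; first by apply: nrm_sphere; near: t.
  have zn : z + t *: eN != 0 by near: t.
  rewrite /nrm xlastZ xlastD z0 add0r xlastZ xlast_pole mulr1 mulr_gt0 ?invr_gt0 ?enorm_gt0//.
have [t [ht3 ht4]] : exists t, Num.max 0 (1 - r ^+ 2 / 16) < edot (nrm (z + t *: eN)) z /\ hemi (nrm (z + t *: eN)).
  have : \forall t \near (0 : R)^'+, Num.max 0 (1 - r ^+ 2 / 16) < edot (nrm (z + t *: eN)) z /\ hemi (nrm (z + t *: eN)).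
    by near=> t; split; near: t.
  by move=> /(@filter_ex _ _ (at_right_proper_filter 0)).
set x1 := nrm (z + t *: eN) in ht3 ht4.
have [sx1 x1_gt0] := ht4.
pose tau0 : R := Num.max 0 (1 - r ^+ 2 / 16).
rewrite -/tau0 in ht3 lt1.
have tau0_ge : 1 - r ^+ 2 / 16 <= tau0 by rewrite le_max lexx orbT.
have near_ball x y : sphere x -> sphere y -> tau0 <= edot x y -> `|x - y| < r / 2.
  move=> sx sy txy; rewrite -(@ltr_pXn2r _ 2)// ?nnegrE ?divr_ge0 ?(ltW r0)//.
  apply: le_lt_trans (norm_le_edot _) _; rewrite edot_sphere_sub//.
  have : 0 < r ^+ 2 by rewrite exprn_gt0.
  have -> : (r / 2) ^+ 2 = r ^+ 2 / 4 by field.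
  by lra.
have inball x : sphere x -> tau0 <= edot x x1 -> ball z r x.
  move=> sx tx; rewrite -ball_normE /=.
  have h1 := near_ball _ _ sx sx1 tx.
  have h2 := near_ball _ _ sx1 sz (ltW ht3).
  rewrite distrC -(subrKA x1); apply: le_lt_trans (ler_normD _ _) _.
  by lra.
have tau01 : -1 <= tau0 < 1.
  by rewrite lt1 andbT (le_trans _ (_ : 0 <= tau0))// ?le_max ?lexx// lerN10.
have Cge0 : 0 <= 5 * `|B1| / um + c0.
  by rewrite addr_ge0 ?(ltW (c0_gt0 R n3))// divr_ge0 ?(ltW um_gt0)// mulr_ge0.
suff : 0 < diff mu z by rewrite -E ltxx.
apply: (strong_min ht4 tau01 Cge0).
- by apply: cont_onW (cont_diff mu01w) => x []; rewrite dE.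
- move=> x [dx tx]; have [sx _] := dx; rewrite -dE in dx.
  by have [_ h] := hr _ (inball _ sx tx); apply: good => //; exact: ltW.
- have t11 : tau0 <= edot x1 x1 by rewrite (_ : edot x1 x1 = 1)// ltW.
  have [_ h] := hr _ (inball _ sx1 t11).
  by apply: good_strict_interior.
- move=> x [dx tx] ix; have [sx _] := dx; rewrite -dE in dx.
  have {}ix : idom be x by rewrite bt.
  have [h1 h2] := hr _ (inball _ sx tx).
  exists (- f (u x) - kfac mu p x `^ a *
    (kfac mu p x ^+ 2 * - f (u (kphi mu p x))
      + a * (a + 1) * (1 - kfac mu p x ^+ 2) * u (kphi mu p x))); first exact: (lap_diff mu01w ix).
  have := good x dx (ltW h2); rewrite /diff mulN1r subr_ge0 /kelvin => Vs.
  have /andP[umx _] := u_bounds dx.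
  have lt_u : u x < u (kphi mu p x).
    by have := h1 dx; rewrite /kelvin powRr0 mul1r mulN1r subr_lt0.
  exact: (lap_difference_pos n3 h1_decr (kfac_gt0 mu01w sp sx) um_gt0 umx lt_u Vs
    (le_trans (F_bound dx) (ler_norm _))).
- move=> x [dx tx] ex; have [sx _] := dx; rewrite -dE in dx.
  have [h1 h2] := hr _ (inball _ sx tx).
  have := good x dx (ltW h2); rewrite /diff mulN1r subr_ge0 /kelvin => Vs.
  exists (- b (u x) - kfac mu p x `^ a * (kfac mu p x * - b (u (kphi mu p x)))).
    exact: nd_diff.
  have lt_u : u x < u (kphi mu p x).
    by have := h1 dx; rewrite /kelvin powRr0 mul1r mulN1r subr_lt0.
  exact: (nd_difference_pos n3 k1_nincr k1_ge0 (kfac_gt0 mu01w sp sx) (u_gt0 dx) lt_u Vs).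
- by split; [rewrite -dE|rewrite edotC; exact: ltW].
- by rewrite edotC.
Unshelve. all: by end_near. Qed.

(** Off the strip the difference is strictly positive on a compact set, and joint continuity yields
    one neighbourhood of [mu0] valid for all its points. *)
Lemma good_near mu0 (e : R) : 0 < mu0 < 1 -> Good mu0 -> 0 < e ->
  \forall mu \near mu0, 0 <= mu < 1 ->
    forall x, dom be x -> edot x p <= mu0 - e -> 0 <= diff mu x.
Proof.
move=> mu01 good e0; have mu01w : 0 <= mu0 < 1 by move: mu01 => /andP[/ltW -> ->].
pose K : set V := dom be `&` [set x | edot x p <= mu0 - e].
have cK : compact K by apply: compact_closedI; [exact: dom_compact|exact: closed_edot_le].
have pos x : K x -> 0 < diff mu0 x.
  move=> [dx tx]; have tx' : edot x p < mu0 by apply: le_lt_trans tx _; rewrite ltrBlDr ltrDl.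
  case: (dom_cases dx) => [ix|[bt ex]]; first exact: good_strict_interior.
  exact: good_strict_boundary.
have cov := (compact_near_coveringP K).1 cK R (nbhs mu0)
  (fun mu x => 0 <= mu < 1 -> dom be x -> 0 <= diff mu x) (nbhs_filter mu0).
apply: filterS (cov _) => [mu h m01 x dx tx|x Kx]; first by apply: h.
have [dx _] := Kx.
pose A := [set q : V * R | dom be q.1 /\ 0 <= q.2 < 1].
  have c : diff q.2 q.1 @[q --> within A (filter_prod (nbhs x) (nbhs mu0))] --> diff mu0 x.
    have nA : \forall q \near within A (filter_prod (nbhs x) (nbhs mu0)), A q.
      exact: withinT.
    apply: (@diff_cvg _ _ _ snd fst) => //.
    + by apply: cvg_within_filter; exact: cvg_snd.
    + apply: cvg_to_within; first by apply: cvg_within_filter; exact: cvg_fst.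
      by apply: filterS nA => q [].
    + by apply: filterS nA => q [].
  have h : \forall q \near within A (filter_prod (nbhs x) (nbhs mu0)), 0 < diff q.2 q.1.
    exact: (cvgr_gt _ c _ (pos x Kx)).
  move: h; rewrite near_withinE => h.
  apply: filterS h => -[y mu] /= h m01 dy.
  by apply/ltW/h.
Qed.

(** Let s be the supremum of the bad parameters. [thin_strip] at s leaves only x.p <= s - e to check
    for parameters just below s. There [good_start] applies if s = 1; otherwise s is good, as a
    limit of good parameters from above, and [good_near] applies. Bad parameters close to s are thus
    impossible. *)
Lemma all_good mu : 0 < mu < 1 -> Good mu.
Proof.
move=> mu01; apply: contrapT => bad.
pose S : set R := [set m | 0 < m < 1 /\ ~ Good m].
have S0 : S !=set0 by exists mu.
have Sub : ubound S 1 by move=> m [/andP[_ /ltW]].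
have Ssup : has_sup S by split=> //; exists 1.
pose s := sup S.
have s_gt0 : 0 < s.
  by case/andP: (mu01) => m0 _; apply: lt_le_trans m0 _; apply: ub_le_sup => //; exists 1.
have s_le1 : s <= 1 by exact: ge_sup.
have s01 : 0 < s <= 1 by rewrite s_gt0.
have [e /andP[e0 es] strip] := thin_strip s01.
have [del del0 hdel] : exists2 del : R, 0 < del & forall m, s - del < m <= s -> 0 < m < 1 ->
    forall x, dom be x -> edot x p <= s - e -> 0 <= diff m x.
  move: s_le1; rewrite le_eqVlt => /orP[/eqP s1|s1].
    have [del /andP[del0 _] h] := good_start e0.
    exists del => // m /andP[m1 _] /andP[_ m2] x dx; rewrite s1; apply: h => //.
    by rewrite -{1}s1 m1.
  have gs : Good s.
    apply: good_limit; first by rewrite (ltW s_gt0).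
    move=> m /andP[m1 m2]; apply: contrapT => badm.
    have : m <= s by apply: ub_le_sup; [exists 1|split=> //; rewrite m2 (lt_trans s_gt0)].
    by rewrite leNgt m1.
  have s01' : 0 < s < 1 by rewrite s_gt0.
  have /nbhs_ballP[del /= del0 h] := good_near s01' gs e0.
  exists del => // m /andP[m1 m2] /andP[m3 m4]; apply: h; last by rewrite (ltW m3).
  by rewrite /ball /= ger0_norm ?subr_ge0// ltrBlDr -ltrBlDl.
have [m [m01 badm] ms] := sup_adherent del0 Ssup.
have ms' : m <= s by apply: ub_le_sup; [exists 1|split].
apply: badm; apply: strip => // x dx tx _.
by apply: (hdel m); rewrite // ms.
Qed.

Lemma reflection_le x : dom be x -> edot x p <= 0 -> u (x - (2 * edot x p) *: p) <= u x.
Proof.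
move=> dx tx; have : Good 0 by apply: good_limit => [|mu]; [rewrite lexx ltr01|exact: all_good].
by move=> /(_ x dx tx); rewrite /diff mulN1r subr_ge0 kelvin0.
Qed.

End MovingSpheres.

(** * Equality of values at equal heights *)

Section Invariance.
Variables (R : realType) (n : nat) (f b : R -> R) (be : bool).
Local Notation V := 'rV[R]_(n.+1).
Local Notation eN := (ebasis R (@ord_max n)).
Implicit Types (x y z : V) (W : V -> R) (D : set V) (t : R).

Lemma cont_on_dom_le W : cont_on (dom be) W -> exists M : R, forall x, dom be x -> W x <= M.
Proof.
move=> cW; have D0 : dom be eN by split; [exact: sphere_pole|rewrite xlast_pole ler01].
have [x0 _ h] := cont_on_min (@dom_compact R n be) (ex_intro _ _ D0) (cont_onZ (c := -1) cW).
by exists (W x0) => x /h; rewrite !mulN1r lerN2.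
Qed.

Lemma continuous_ge0_pos (G : R -> R) t : {within `[0, +oo[, continuous G} -> 0 < t ->
  {for t, continuous G}.
Proof. by move=> /continuous_within_itvcyP[h _] t0; apply: h; rewrite in_itv /= t0. Qed.

Hypothesis n3 : (3 <= n)%N.
Hypothesis f_cont : {within `[0, +oo[, continuous f}.
Hypothesis b_cont : {within `[0, +oo[, continuous b}.
Hypothesis h1_decr : forall s t : R, 0 < s -> s < t ->
  t `^ (- ((n%:R + 2) / (n%:R - 2))) * (f t + n%:R * (n%:R - 2) / 4 * t)
  < s `^ (- ((n%:R + 2) / (n%:R - 2))) * (f s + n%:R * (n%:R - 2) / 4 * s).
Hypothesis k1_nincr : forall s t : R, 0 < s -> s < t ->
  t `^ (- (n%:R / (n%:R - 2))) * b t <= s `^ (- (n%:R / (n%:R - 2))) * b s.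
Hypothesis k1_ge0 : forall t : R, 0 < t -> 0 <= t `^ (- (n%:R / (n%:R - 2))) * b t.
Variable u : V -> R.
Hypothesis u_cont : cont_on (dom be) u.
Hypothesis u_pos : forall x, dom be x -> 0 < u x.
Hypothesis u_lap : forall x, idom be x ->
  exists l Q, taylor (ext u) x l Q /\ 2 * \tr Q = - f (u x).
Hypothesis u_nd : be -> forall z, equator z -> nd u z (- b (u z)).

(** The reflection along p = (y - x) / |y - x| carries [x] to [y], with x.p = - |y - x| / 2; equal
    heights make [p] orthogonal to the pole. The bounds on [u], [f (u x)] and [b (u x)] come from
    compactness, as [u] has a positive minimum. *)
Lemma value_le x y : dom be x -> dom be y -> (be -> xlast x = xlast y) -> u y <= u x.
Proof.
move=> dx dy xy; have [sx _] := dx; have [sy _] := dy.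
have [-> //|nxy] := eqVneq x y.
have nyx : y - x != 0 by rewrite subr_eq0 eq_sym.
have D0 : dom be eN by split; [exact: sphere_pole|rewrite xlast_pole ler01].
have [x0 dx0 umin] := cont_on_min (@dom_compact R n be) (ex_intro _ _ D0) u_cont.
have [uM umax] := cont_on_dom_le u_cont.
have cF : cont_on (dom be) (fun x => `|f (u x) + n%:R * (n%:R - 2) / 4 * u x|).
  apply: (cont_on_comp (G := fun t => `|f t + n%:R * (n%:R - 2) / 4 * t|)) => // z dz.
  have fc := continuous_ge0_pos f_cont (u_pos dz).
  exact: (cvg_norm (cvgD fc (cvgM (cvg_cst _) cvg_id))).
have [B1 FB] := cont_on_dom_le cF.
have [B2 bB] : exists M : R, forall x, dom be x -> b (u x) <= M.
  apply: cont_on_dom_le; apply: cont_on_comp => // z dz.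
  exact: (continuous_ge0_pos b_cont (u_pos dz)).
have bounds z : dom be z -> u x0 <= u z <= uM by move=> dz; rewrite umin// umax.
have exy : edot (y - x) (y - x) = 2 - 2 * edot y x by exact: edot_sphere_sub.
have pos : 0 < edot (y - x) (y - x).
  by rewrite -enormE exprn_gt0// enorm_gt0.
have sp := nrm_sphere nyx.
have pb : be -> xlast (nrm (y - x)) = 0.
  by move=> /xy E; rewrite /nrm xlastZ !xlastE edotDl edotNl -!xlastE E subrr mulr0.
have e0 := enorm_gt0 nyx.
have xp : edot x (nrm (y - x)) = - (enorm (y - x))^-1 * (edot (y - x) (y - x) / 2).
  have sx1 : edot x x = 1 := sx.
  by rewrite /nrm edotZr exy edotDr edotNr sx1 (edotC x y); field; rewrite gt_eqF.
have := reflection_le n3 h1_decr k1_nincr k1_ge0 u_cont (u_pos dx0) bounds FB bB u_lap u_nd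
  sp pb dx.
have le0 : edot x (nrm (y - x)) <= 0.
  by rewrite xp mulNr oppr_le0 mulr_ge0 ?invr_ge0 ?(ltW e0)// divr_ge0// ltW.
move=> /(_ le0); rewrite xp /nrm scalerA.
rewrite (_ : 2 * _ * _ = -1) ?scaleN1r ?opprK ?subrKC ?[x + _]addrC ?subrK//.
have e2 : enorm (y - x) != 0 by rewrite gt_eqF.
by rewrite -enormE; field.
Qed.

Lemma value_eq x y : dom be x -> dom be y -> (be -> xlast x = xlast y) -> u x = u y.
Proof.
move=> dx dy xy; apply/eqP; rewrite eq_le !value_le// => bt.
by rewrite xy.
Qed.

End Invariance.

(** * Distance to the equator as a function of the height *)

Section EquatorDistance.
Variables (R : realType) (n : nat).
Local Notation V := 'rV[R]_(n.+1).
Local Notation eN := (ebasis R (@ord_max n)).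
Implicit Types (w z : V).
Hypothesis n1 : (1 <= n)%N.

(** Bessel's inequality for the orthonormal pair [z], [eN]. *)
Lemma edot_equator_le w z : sphere w -> equator z -> `|edot w z| <= Num.sqrt (1 - xlast w ^+ 2).
Proof.
move=> sw [sz z0]; rewrite -sqrtr_sqr ler_wsqrtr//.
have := edot_ge0 (w - edot w z *: z - xlast w *: eN).
have sw1 : edot w w = 1 := sw; have sz1 : edot z z = 1 := sz.
have zN : edot z eN = 0 by rewrite -xlastE.
have wN : edot w eN = xlast w by rewrite -xlastE.
have NN := @edot_basis_diag R n ord_max.
rewrite !edotE (edotC z w) (edotC eN z) (edotC eN w) sw1 sz1 zN wN NN => h.
by lra.
Qed.

Lemma edot_equator_max w : sphere w ->
  exists2 z, equator z & edot w z = Num.sqrt (1 - xlast w ^+ 2).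
Proof.
move=> sw; have sw1 : edot w w = 1 := sw.
pose v := w - xlast w *: eN.
have wN : edot w eN = xlast w by rewrite -xlastE.
have NN := @edot_basis_diag R n ord_max.
have vv : edot v v = 1 - xlast w ^+ 2.
  by rewrite /v !edotE (edotC eN w) sw1 wN NN; ring.
have v0 : xlast v = 0 by rewrite /v xlastE edotDl edotNl edotZl wN NN mulr1 subrr.
(* At a pole there is no nearest direction and any equator point serves; [n1] makes the first basis
   vector one. *)
have [vz|vn] := eqVneq v 0.
  have e0 : equator (ebasis R (@ord0 n)).
    split; first by rewrite /sphere /= edot_basis_diag.
    by rewrite /xlast /ebasis mxE /= -val_eqE /= eqn0Ngt n1.
  exists (ebasis R ord0) => //; rewrite -vv vz edot0l sqrtr0.
  have := edot_equator_le sw e0; rewrite -vv vz edot0l sqrtr0.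
  by rewrite normr_le0 => /eqP.
exists (nrm v).
  by split; [exact: nrm_sphere|rewrite /nrm xlastZ v0 mulr0].
have wv : edot w v = enorm v ^+ 2.
  by rewrite enormE vv /v edotDr edotNr edotZr sw1 wN expr2.
rewrite /nrm edotZr wv -vv -/(enorm v) expr2 mulKf// gt_eqF//.
exact: enorm_gt0.
Qed.

Lemma acos_anti (s t : R) : -1 <= s -> s <= t -> t <= 1 -> acos t <= acos s.
Proof.
move=> s1 st t1; rewrite leNgt; apply/negP => lt_st.
have st1 : -1 <= t <= 1 by rewrite (le_trans s1)//.
have ss1 : -1 <= s <= 1 by rewrite s1 (le_trans st).
have := @ltr_cos R (acos s) (acos t); rewrite !in_itv /= !acos_ge0// !acos_lepi//.
move=> /(_ isT isT); rewrite lt_st !acosK// ltNge st.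
by [].
Qed.

Lemma dist_equatorE w : sphere w -> dist_equator w = acos (Num.sqrt (1 - xlast w ^+ 2)).
Proof.
move=> sw; have [z ez wz] := edot_equator_max sw.
have [sz _] := ez.
have s1 : Num.sqrt (1 - xlast w ^+ 2) <= 1 by rewrite -wz edot_sphere_le.
have lbS : lbound [set gdist w z | z in @equator R n] (acos (Num.sqrt (1 - xlast w ^+ 2))).
  move=> _ [y ey <-]; have [sy _] := ey; apply: acos_anti => //.
    exact: edot_sphere_ge.
  exact: le_trans (ler_norm _) (edot_equator_le sw ey).
have S0 : [set gdist w z | z in @equator R n] (acos (Num.sqrt (1 - xlast w ^+ 2))).
  by exists z => //; rewrite /gdist wz.
apply/eqP; rewrite eq_le; apply/andP; split.
  by apply: ge_inf => //; exists (acos (Num.sqrt (1 - xlast w ^+ 2))).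
by apply: lb_le_inf => //; exists (acos (Num.sqrt (1 - xlast w ^+ 2))).
Qed.

Lemma Aset_xlast r w1 w2 : Aset r w1 -> Aset r w2 -> xlast w1 = xlast w2.
Proof.
move=> [[s1 w10] d1] [[s2 w20] d2]; move: d1; rewrite -d2 !dist_equatorE// => E.
have bd (w : V) : sphere w -> 0 <= 1 - xlast w ^+ 2.
  move=> sw; have := coord_le w ord_max; rewrite (_ : edot w w = 1)// => h.
  by rewrite subr_ge0.
have bs (w : V) : sphere w -> Num.sqrt (1 - xlast w ^+ 2) \in `[-1, 1].
  move=> sw; have [z [sz _] <-] := edot_equator_max sw.
  by rewrite in_itv /= edot_sphere_ge// edot_sphere_le.
have := congr1 cos E; rewrite !acosK ?bs// => /(congr1 (fun t => t ^+ 2)).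
rewrite !sqr_sqrtr ?bd// => /addrI/oppr_inj/eqP.
by rewrite eqrXn2// => /eqP.
Qed.

End EquatorDistance.

(** * Solutions translated into expansions and inward derivatives *)

Section Solutions.
Variables (R : realType) (n : nat) (f b : R -> R).
Local Notation V := 'rV[R]_(n.+1).
Implicit Types (x y z : V) (u : V -> R).

Lemma solution_cont u : is_solution f b u -> cont_on (dom true) u.
Proof.
move=> [_ [/subspace_continuousP uc _]]; have -> : @dom R n true = @hemi_cl R n.
  by apply/seteqP; split=> x /dom_true.
exact: uc.
Qed.

Lemma solution_lap u x : is_solution f b u -> idom true x ->
  exists l Q, taylor (ext u) x l Q /\ 2 * \tr Q = - f (u x).
Proof.
move=> [uC2 [_ [uL _]]] [sx x0]; have hx : hemi x by split=> //; exact: x0.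
have [l [Q [tl tQ]]] := C2_hemi_taylor uC2 hx.
by exists l, Q; split=> //; rewrite tQ -[LHS]opprK uL.
Qed.

Lemma solution_nd u z : is_solution f b u -> true -> equator z -> nd u z (- b (u z)).
Proof. by move=> [_ [_ [_ h]]] _; exact: h. Qed.

End Solutions.

(** * Second order behaviour at the equator when the normal derivative vanishes *)

Section RadialExpansion.
Variables (R : realType) (n : nat) (f : R -> R).
Local Notation V := 'rV[R]_(n.+1).
Local Notation eN := (ebasis R (@ord_max n)).
Implicit Types (x y z : V).
Variables (u : V -> R) (z0 : V).
Hypothesis ez0 : equator z0.
Hypothesis u_cont : cont_on (dom true) u.
Hypothesis u_radial : forall x y, dom true x -> dom true y -> xlast x = xlast y -> u x = u y.
Hypothesis u_lap : forall x, idom true x ->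
  exists l Q, taylor (ext u) x l Q /\ 2 * \tr Q = - f (u x).
Hypothesis u_nd : nd u z0 0.
Hypothesis f_cont : {for u z0, continuous f}.

(** [t] is the tangent of the latitude whose sine is [s]: this relates the straight line of the
    normal derivative to the height on the sphere. *)
Lemma meridian (s : R) : 0 <= s < 1 ->
  let t := s / Num.sqrt (1 - s ^+ 2) in
  [/\ dom true (nrm (z0 + t *: eN)), xlast (nrm (z0 + t *: eN)) = s & 0 <= t].
Proof.
move=> /andP[s0 s1]; set r := Num.sqrt _ => t.
have [sz z00] := ez0; have sz1 : edot z0 z0 = 1 := sz.
have p0 : 0 < 1 - s ^+ 2 by rewrite subr_gt0 expr_lt1.
have r0 : 0 < r by rewrite sqrtr_gt0.
have rE : r ^+ 2 = 1 - s ^+ 2 by rewrite sqr_sqrtr// ltW.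
clearbody r.
have t0 : 0 <= t by rewrite divr_ge0// ltW.
have zN : edot z0 eN = 0 by rewrite -xlastE.
have NN := @edot_basis_diag R n ord_max.
have yE : edot (z0 + t *: eN) (z0 + t *: eN) = r^-1 ^+ 2.
  rewrite !edotE (edotC eN z0) sz1 zN NN /t.
  rewrite [LHS](_ : _ = (r ^+ 2 + s ^+ 2) / r ^+ 2); last by field; rewrite gt_eqF.
  by rewrite rE subrK mul1r exprVn rE.
have eE : enorm (z0 + t *: eN) = r^-1.
  by rewrite /enorm yE sqrtr_sqr ger0_norm// invr_ge0 ltW.
have yn : z0 + t *: eN != 0.
  by apply/eqP => h; move: yE; rewrite h edot0l => /esym/eqP; rewrite sqrf_eq0 invr_eq0 gt_eqF.
have xl : xlast (nrm (z0 + t *: eN)) = s.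
  rewrite /nrm eE invrK xlastZ xlastD xlastZ xlast_pole z00 add0r mulr1 /t.
  by field; rewrite gt_eqF.
by split=> //; split=> [|_]; [exact: nrm_sphere|rewrite xl].
Qed.

(** A zero derivative at [z0] controls [u] on one meridian only; dependence on the height alone
    spreads this to all points near the equator, with t <= 2 s for heights s < 1/2. *)
Lemma radial_lipschitz (eta : R) : 0 < eta -> exists2 del : R, 0 < del &
  forall x, dom true x -> xlast x < del -> `|u x - u z0| <= eta * xlast x.
Proof.
move=> eta0.
have h : \forall t \near (0 : R)^'+, `|(ext u (z0 + t *: eN) - u z0) / t| <= eta / 2.
  have e2 : 0 < eta / 2 by rewrite divr_gt0.
  have h0 : \forall t \near (0 : R)^'+, `|0 - (ext u (z0 + t *: eN) - u z0) / t| <= eta / 2.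
    by exact: (cvgr_dist_le _ _ u_nd _ e2).
  by near=> t; rewrite -normrN -sub0r; near: t.
move: h; rewrite near_withinE => /nbhs_ballP[r /= r0 hr].
exists (Num.min (2^-1) (r / 2)); first by rewrite lt_min invr_gt0 ltr0n divr_gt0.
move=> x dx; rewrite lt_min => /andP[x1 x2].
have [sx /(_ isT) x0] := dx.
move: x0; rewrite le_eqVlt => /orP[/eqP x0|x0].
  have [sz z00] := ez0.
  rewrite -x0 mulr0 (@u_radial x z0) ?subrr ?normr0//; last by rewrite -x0.
  by split=> // _; rewrite z00.
have s01 : 0 <= xlast x < 1 by rewrite ltW//= (lt_trans x1)// invf_lt1// ltr1n.
have [dy yx t0] := meridian s01.
set q := Num.sqrt _ in dy yx t0; set t := xlast x / q in dy yx t0.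
have q_ge : 2^-1 <= q.
  rewrite -[leLHS]ger0_norm ?invr_ge0// -sqrtr_sqr ler_wsqrtr//.
  have : xlast x ^+ 2 <= 2^-1 ^+ 2 by rewrite lerXn2r ?nnegrE ?invr_ge0 ?ltW.
  have -> : (2^-1 : R) ^+ 2 = 4^-1 by field.
  by lra.
have q0 : 0 < q by apply: lt_le_trans q_ge; rewrite invr_gt0.
have t_le : t <= 2 * xlast x.
  rewrite /t ler_pdivrMr// mulrAC -[leLHS]mul1r ler_wpM2r ?(ltW x0)//.
  by lra.
have t_gt0 : 0 < t by rewrite divr_gt0.
have := hr t; rewrite /ball /= sub0r normrN (ger0_norm t0).
have tr : t < r by apply: le_lt_trans t_le _; lra.
move=> /(_ tr t_gt0).
rewrite normrM normfV (gtr0_norm t_gt0) ler_pdivrMr// extE -(u_radial dx dy) ?yx// => h.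
apply: le_trans h _.
have : eta / 2 * t <= eta / 2 * (2 * xlast x) by rewrite ler_wpM2l// divr_ge0// ltW.
by lra.
Unshelve. all: by end_near.
Qed.

(* Maximum principle on the band [0 <= s <= s1] for [W + kappa s], where [W] is
   the left-hand side below and [kappa] makes it vanish on [s = s1]: it vanishes
   on both sides of the band, is positive somewhere because [W = o(s)], and is
   strictly subharmonic. *)
Lemma radial_expansion_ge (sg eps : R) : `|sg| = 1 -> 0 < eps -> exists2 del : R, 0 < del &
  forall x, dom true x -> xlast x < del ->
    0 <= sg * (u x - u z0 + f (u z0) / 2 * xlast x ^+ 2) + eps * xlast x ^+ 2.
Proof.
move=> sg1 eps0; have [sz z00] := ez0.
pose A := sg * (f (u z0) / 2) + eps.
have AE : A = sg * (f (u z0) / 2) + eps by [].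
clearbody A.
pose D : R := `|A| + 1; have D1 : 1 <= D by rewrite lerDr.
have AD : `|A| <= D by rewrite lerDl.
clearbody D; have D0 : 0 < D by apply: lt_le_trans D1.
have [df df0 hf] : exists2 d : R, 0 < d & forall t, `|t - u z0| < d -> `|f t - f (u z0)| <= eps / 2.
  have e2 : 0 < eps / 2 by rewrite divr_gt0.
  have h : \forall t \near u z0, `|f (u z0) - f t| <= eps / 2 by exact: (cvgr_dist_le _ _ f_cont _ e2).
  move: h => /nbhs_ballP[r /= r0 hr]; exists r => // t tr.
  by rewrite distrC; apply: hr; rewrite /ball /= distrC.
have [d1 d10 hd1] := radial_lipschitz ltr01.
pose N : R := n.+1%:R.
have N1 : 1 <= N by rewrite ler1n.
have NE : N = n%:R + 1 by rewrite /N -natr1.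
clearbody N.
(* Gives [N * (D * s1) <= eps / 8], which makes the curvature terms of the Laplacian small against
   [2 * eps]. *)
pose d2 : R := eps / (8 * N * D).
have ND0 : 0 < 8 * N * D by rewrite !mulr_gt0// (lt_le_trans ltr01).
have d20 : 0 < d2 by rewrite divr_gt0.
have d2E : 8 * N * D * d2 = eps by rewrite /d2 mulrC divfK// gt_eqF.
clearbody d2.
exists (Num.min (Num.min d1 df) (Num.min 2^-1 d2)).
  by rewrite !lt_min d10 df0 d20 invr_gt0 ltr0n.
move=> x1 dx1; rewrite !lt_min => /andP[/andP[x1d1 x1df] /andP[x1h x1d2]].
have [sx1 /(_ isT)] := dx1; rewrite le_eqVlt => /orP[/eqP x10|x10].
  rewrite -x10 expr0n /= !mulr0 !addr0 (@u_radial x1 z0)//; last by rewrite -x10.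
    by rewrite subrr mulr0.
  by split=> // _; rewrite z00.
set s1 := xlast x1 in x10 x1d1 x1df x1h x1d2 *.
pose W x := sg * (u x - u z0 + f (u z0) / 2 * xlast x ^+ 2) + eps * xlast x ^+ 2.
rewrite -[leRHS]/(W x1) leNgt; apply/negP => Wneg.
pose ka : R := - W x1 / s1.
have kaE : ka * s1 = - W x1 by rewrite /ka divfK// gt_eqF.
have ka0 : 0 < ka by rewrite /ka divr_gt0// oppr_gt0.
clearbody ka.
pose G (s : R) := A * (s * s) + ka * s - sg * u z0.
pose H x := -1 * (sg * u x + G (edot x eN)).
have HE x : H x = - (W x + ka * xlast x).
  by rewrite /H /G /W -xlastE AE; ring.
pose K : set V := [set x | dom true x /\ edot x eN <= s1].
have Kd : K `<=` dom true by move=> x [].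
have cK : compact K by apply: compact_closedI; [exact: dom_compact|exact: closed_edot_le].
have Kx1 : K x1 by split=> //; rewrite -xlastE.
have Hc : cont_on K H.
  apply: cont_onZ; apply: cont_onD; first exact: cont_onZ (cont_onW Kd u_cont).
  apply: cont_onT => y; rewrite /G; have c := @edot_continuous R n eN y.
  exact: (cvgB (cvgD (cvgM (cvg_cst _) (cvgM c c)) (cvgM (cvg_cst _) c)) (cvg_cst _)).
have [x [dx xs1] xmin] := cont_on_min cK (ex_intro _ _ Kx1) Hc.
have Hx : H x < 0.
  have ka4 : 0 < ka / 4 by rewrite divr_gt0.
  have [d3 d30 hd3] := radial_lipschitz ka4.
  pose s := Num.min (s1 / 2) (Num.min (d3 / 2) (ka / (4 * D))).
  have s0 : 0 < s by rewrite !lt_min !divr_gt0// mulr_gt0.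
  have ss1 : s <= s1 / 2 by rewrite ge_min lexx.
  have sd3 : s <= d3 / 2 by rewrite !ge_min lexx orbT.
  have ska : s <= ka / (4 * D) by rewrite !ge_min lexx !orbT.
  clearbody s.
  have s01 : 0 <= s < 1 by rewrite ltW//=; lra.
  have [dy ys _] := meridian s01.
  set y := nrm _ in dy ys.
  have Ky : K y by split=> //; rewrite -xlastE ys; lra.
  apply: le_lt_trans (xmin y Ky) _; rewrite HE oppr_lt0 ys.
  have h1 := hd3 y dy; rewrite ys in h1.
  have {}h1 : `|sg * (u y - u z0)| <= ka / 4 * s by rewrite normrM sg1 mul1r; apply: h1; lra.
  have h2 : `|A * s ^+ 2| <= ka / 4 * s.
    rewrite normrM (ger0_norm (sqr_ge0 _)) expr2 mulrA ler_wpM2r ?(ltW s0)//.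
    apply: le_trans (_ : D * (ka / (4 * D)) <= _); first by apply: ler_pM => //; exact: ltW.
    by rewrite le_eqVlt; apply/orP; left; apply/eqP; field; rewrite gt_eqF.
  have -> : W y = sg * (u y - u z0) + A * s ^+ 2 by rewrite /W ys AE; ring.
  have := mulr_gt0 ka0 s0.
  by move: h1 h2; rewrite !ler_norml => /andP[h1 _] /andP[h2 _]; lra.
have [sx /(_ isT) x0] := dx.
have x0' : 0 < xlast x.
  rewrite lt_neqAle x0 andbT; apply/eqP => E; move: Hx.
  rewrite HE /W -E (@u_radial x z0)//; last 2 first.
  - by split=> // _; rewrite z00.
  - by rewrite -E.
  by rewrite subrr expr0n /= !mulr0 !addr0 mulr0 oppr0 ltxx.
have xs1' : xlast x < s1.
  rewrite lt_neqAle -xlastE in xs1 *; rewrite xs1 andbT; apply/eqP => E; move: Hx.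
  by rewrite HE /W E (u_radial dx dx1 E) -[_ + eps * _]/(W x1) kaE subrr oppr0 ltxx.
have ix : idom true x by split.
have [l [Q [tl tQ]]] := u_lap ix.
have pG : peano (fun h => G (edot x eN + h)) (G (edot x eN)) (2 * A * edot x eN + ka) A.
  by exists (fun=> A); [exact: cvg_cst|move=> t; rewrite /G; ring].
have lH := has_lapZ (-1) (has_lapD (has_lapZ sg (taylor_has_lap sx tl)) (has_lap_edot sx pG)).
have nxK : \forall y \near x, sphere y -> H x <= H y.
  have ni := near_idom ix.
  have nt : \forall y \near x, edot y eN < s1.
    by apply: (cvgr_lt _ (@edot_continuous R n eN x)); rewrite -xlastE.
  near=> y => sy; apply: xmin; split; last by apply: ltW; near: y.
  by apply: idom_dom; move: sy; near: y.
have := lap_min sx nxK lH.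
rewrite tQ edot_basis_diag -xlastE; set s := xlast x in x0 x0' xs1'.
rewrite leNgt => /negP; apply.
rewrite mulN1r oppr_lt0.
have ux : `|u x - u z0| < df.
  apply: le_lt_trans (hd1 x dx (lt_trans xs1' x1d1)) _.
  by rewrite mul1r (lt_trans xs1').
have h1 : `|sg * (f (u z0) - f (u x))| <= eps / 2 by rewrite normrM sg1 mul1r distrC hf.
have sq (s' : R) : 0 <= s' -> s' <= s1 -> `|A * s' ^+ 2| <= D * s1.
  move=> s0 s's1; rewrite normrM (ger0_norm (sqr_ge0 _)) ler_pM ?sqr_ge0//.
  rewrite expr2 -[leRHS]mul1r ler_pM//; lra.
have h2 := sq _ (ltW x0') (ltW xs1').
have h3 := sq _ (ltW x10) (lexx s1).
have h4 : `|sg * (u x1 - u z0)| <= s1.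
  by rewrite normrM sg1 mul1r; have := hd1 x1 dx1 x1d1; rewrite mul1r.
have WE : W x1 = sg * (u x1 - u z0) + A * s1 ^+ 2 by rewrite /W -/s1 AE; ring.
have h5 : ka * s <= s1 + D * s1.
  apply: le_trans (_ : ka * s1 <= _); first by rewrite ler_wpM2l ?ltW.
  rewrite kaE WE; move: h3 h4; rewrite !ler_norml => /andP[h3 _] /andP[h4 _]; lra.
have DS : N * (D * s1) <= eps / 8.
  rewrite -d2E (_ : _ / 8 = N * (D * d2)); last by field.
  by rewrite !ler_wpM2l ?(ltW D0) ?(ltW x1d2)// (le_trans ler01).
have h6 : s1 <= D * s1 by rewrite -[leLHS]mul1r ler_wpM2r ?(ltW x10).
have nE : n%:R = N - 1 :> R by rewrite NE addrK.
have n0 : 0 <= N - 1 by rewrite subr_ge0.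
have h7 : (N - 1) * (ka * s) <= eps / 4.
  apply: le_trans (_ : (N - 1) * (2 * (D * s1)) <= _); first by rewrite ler_wpM2l//; lra.
  have : 0 <= D * s1 by rewrite mulr_ge0 ?ltW.
  by lra.
have h8 : N * (A * s ^+ 2) <= eps / 8.
  apply: le_trans DS; rewrite ler_wpM2l ?(le_trans ler01)//.
  by apply: le_trans h2; exact: ler_norm.
(* The Laplacian of [W + ka s]: the [f] terms cancel up to eps / 2 by continuity, and the last two
   terms cost at most eps / 4 each, so it is positive. *)
rewrite (_ : sg * _ + _ = sg * (f (u z0) - f (u x)) + 2 * eps - 2 * (N * (A * s ^+ 2)) - (N - 1) * (ka * s)).
  by move: h1; rewrite ler_norml => /andP[h1 _]; lra.
by rewrite nE AE -/s; field.
Unshelve. all: by end_near. Qed.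

Lemma radial_expansion (eps : R) : 0 < eps -> exists2 del : R, 0 < del &
  forall x, dom true x -> xlast x < del ->
    `|u x - u z0 + f (u z0) / 2 * xlast x ^+ 2| <= eps * xlast x ^+ 2.
Proof.
move=> eps0.
have [d1 d10 h1] := radial_expansion_ge (normr1 R) eps0.
have [|d2 d20 h2] := @radial_expansion_ge (-1) eps _ eps0; first by rewrite normrN normr1.
exists (Num.min d1 d2) => [|x dx]; first by rewrite lt_min d10.
rewrite lt_min => /andP[x1 x2]; have := h1 x dx x1; have := h2 x dx x2.
by rewrite ler_norml => k1 k2; apply/andP; split; lra.
Qed.

End RadialExpansion.

(** * The even extension solves the equation across the equator *)

Section EvenExtension.
Variables (R : realType) (n : nat) (f : R -> R).
Local Notation V := 'rV[R]_(n.+1).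
Local Notation eN := (ebasis R (@ord_max n)).
Implicit Types (x y z k l : V) (U : V -> R) (Q : 'M[R]_n.+1).

Variables (u : V -> R) (u0 : R).
Hypothesis u_lap : forall x, idom true x ->
  exists l Q, taylor (ext u) x l Q /\ 2 * \tr Q = - f (u x).
Hypothesis u_equator : forall z, equator z -> u z = u0.
Hypothesis u_expansion : forall eps : R, 0 < eps -> exists2 del : R, 0 < del &
  forall x, dom true x -> xlast x < del ->
    `|u x - u0 + f u0 / 2 * xlast x ^+ 2| <= eps * xlast x ^+ 2.

Definition even_ext x : R := u (if 0 <= xlast x then x else refl eN x).

Lemma xlast_refl x : xlast (refl eN x) = - xlast x.
Proof. by rewrite /refl xlastD -scaleNr xlastZ xlast_pole -xlastE; ring. Qed.

Lemma even_ext_fold x : sphere x -> exists y, [/\ dom true y, even_ext x = u y & xlast y = `|xlast x|].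
Proof.
move=> sx; rewrite /even_ext; case: (leP 0 (xlast x)) => x0.
  by exists x; split=> //; rewrite ger0_norm.
exists (refl eN x); rewrite xlast_refl ltr0_norm//; split=> //.
by split=> [|_]; [rewrite /sphere /= edot_refl ?edot_basis_diag|rewrite xlast_refl oppr_ge0 ltW].
Qed.

(** Being insensitive to the sign of the height s, u0 - f(u0) s^2 / 2 + o(s^2) describes the
    extension on both sides. Its quadratic form lives in the normal direction alone, and its trace
    gives the equation. *)
Lemma even_ext_taylor_equator z : equator z ->
  exists l Q, taylor (ext even_ext) z l Q /\ 2 * \tr Q = - f (even_ext z).
Proof.
move=> ez; have [sz z00] := ez.
have uz : even_ext z = u0 by rewrite /even_ext z00 lexx u_equator.
pose Q : 'M[R]_n.+1 := (- (f u0 / 2)) *: delta_mx ord_max ord_max.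
have trQ : \tr Q = - (f u0 / 2).
  rewrite mxtraceZ /mxtrace (bigD1 ord_max)//= big1 ?addr0.
    by rewrite mxE !eqxx mulr1.
  by move=> i /negPf im; rewrite mxE im.
have bfQ k : bf Q k k = - (f u0 / 2) * xlast k ^+ 2.
  rewrite bfZ /bf (_ : k *m delta_mx ord_max ord_max = xlast k *: eN).
    by rewrite edotZl edotC -xlastE; ring.
  apply/rowP => j; rewrite !mxE (bigD1 ord_max)//= big1 ?addr0; last first.
    by move=> i /negPf im; rewrite mxE im mulr0.
  by rewrite mxE eqxx.
exists 0, Q; split; last by rewrite trQ uz; field.
apply: taylor_intro => eps eps0.
have eps8 : 0 < eps / 8 by rewrite divr_gt0.
have [del del0 hdel] := u_expansion eps8.
pose B : R := `|f u0 / 2| + 1.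
have B1 : 1 <= B by rewrite lerDr.
have Bf : `|f u0 / 2| <= B by rewrite lerDl.
clearbody B; have B0 : 0 < B by apply: lt_le_trans B1.
have cl : z + k @[k --> (0 : V)] --> z.
  have c : z + k @[k --> (0 : V)] --> z + 0 by exact: (cvgD (cvg_cst _) cvg_id).
  by rewrite addr0 in c.
have nz : \forall k \near (0 : V), z + k != 0.
  by exact: (near_neq0 (sphere_neq0 sz) cl).
have c1 : edot (nrm (z + k)) eN @[k --> (0 : V)] --> edot z eN.
  exact: (cvg_edot (cvg_nrm_sphere sz cl) (cvg_cst _)).
have c2 : enorm (z + k) @[k --> (0 : V)] --> enorm z by exact: (cvg_enorm cl).
rewrite (enorm_sphere sz) in c2.
have c3 : (enorm (z + k))^-1 ^+ 2 @[k --> (0 : V)] --> (1 : R).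
  have c4 : (enorm (z + k))^-1 @[k --> (0 : V)] --> (1^-1 : R) by exact: (cvgV (oner_neq0 _) c2).
  have c5 : (enorm (z + k))^-1 ^+ 2 @[k --> (0 : V)] --> (1^-1 * 1^-1 : R) by exact: (cvgM c4 c4).
  by rewrite invr1 mulr1 in c5.
have n1 : \forall k \near (0 : V), `|edot z eN - edot (nrm (z + k)) eN| < del.
  exact: (cvgr_dist_lt _ _ c1 _ del0).
have eB : 0 < eps / (2 * B) by rewrite divr_gt0// mulr_gt0.
have n2 : \forall k \near (0 : V), `|1 - (enorm (z + k))^-1 ^+ 2| <= eps / (2 * B).
  exact: (cvgr_dist_le _ _ c3 _ eB).
have one : 0 < (1 : R) by [].
have n3 : \forall k \near (0 : V), `|1 - (enorm (z + k))^-1 ^+ 2| <= 1.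
  exact: (cvgr_dist_le _ _ c3 _ one).
near=> k.
have zk : z + k != 0 by near: k.
have h1 : `|edot z eN - edot (nrm (z + k)) eN| < del by near: k.
have h2 : `|1 - (enorm (z + k))^-1 ^+ 2| <= eps / (2 * B) by near: k.
have h3 : `|1 - (enorm (z + k))^-1 ^+ 2| <= 1 by near: k.
rewrite -!xlastE z00 sub0r normrN in h1.
have [y [dy ye ys]] := even_ext_fold (nrm_sphere zk).
rewrite edot0l subr0 bfQ !extE (nrm_id sz) uz ye.
have := hdel y dy; rewrite ys => /(_ h1).
rewrite real_normK ?num_real// /nrm xlastZ xlastD z00 add0r exprMn.
have kk : xlast k ^+ 2 <= edot k k by exact: coord_le.
(* The normalised point has squared height [E * K], not [K]. Replacing [E] by 1 costs eps / 2, and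
   [E <= 2] turns the expansion error eps / 8 into eps / 4. *)
set E := (enorm (z + k))^-1 ^+ 2 in h2 h3 *; set K := xlast k ^+ 2 in kk *.
have K0 : 0 <= K by rewrite sqr_ge0.
set w := u y => h4.
have E2 : 0 <= E <= 2 by rewrite sqr_ge0/=; move: h3; rewrite ler_norml => /andP[]; lra.
have h5 : eps / 8 * (E * K) <= eps / 4 * K.
  rewrite mulrA ler_wpM2r//; case/andP: E2 => _ E2.
  have : eps / 8 * E <= eps / 8 * 2 by rewrite ler_wpM2l// ltW.
  by lra.
have h6 : `|f u0 / 2 * (1 - E) * K| <= eps / 2 * K.
  rewrite normrM (ger0_norm K0) ler_wpM2r// normrM.
  apply: le_trans (ler_pM _ _ Bf h2) _ => //.
  by rewrite le_eqVlt; apply/orP; left; apply/eqP; field; rewrite gt_eqF.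
rewrite (_ : w - u0 - _ = (w - u0 + f u0 / 2 * (E * K)) + f u0 / 2 * (1 - E) * K); last by ring.
apply: le_trans (ler_normD _ _) _.
have h7 : eps * K <= eps * edot k k by rewrite ler_wpM2l// ltW.
have h8 : 0 <= eps * K by rewrite mulr_ge0// ltW.
by lra.
Unshelve. all: by end_near. Qed.

Lemma even_ext_taylor x : sphere x ->
  exists l Q, taylor (ext even_ext) x l Q /\ 2 * \tr Q = - f (even_ext x).
Proof.
move=> sx; have [x0|x0|x0] := ltgtP 0 (xlast x).
- have [l [Q [tl tQ]]] : exists l Q, taylor (ext u) x l Q /\ 2 * \tr Q = - f (u x).
    by apply: u_lap; split.
  exists l, Q; split; last by rewrite tQ /even_ext (ltW x0).
  apply: taylor_near tl.
  have h : \forall y \near x, 0 < edot y eN.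
    by apply: (cvgr_gt _ (@edot_continuous R n eN x)); rewrite -xlastE.
  near=> y; rewrite !extE /even_ext.
  have y0 : 0 < xlast y by rewrite xlastE; near: y.
  by rewrite /nrm xlastZ mulr_ge0 ?invr_ge0 ?sqrtr_ge0 ?ltW.
- have ix : idom true (refl eN x).
    by split=> [|_]; [rewrite /sphere /= edot_refl ?edot_basis_diag|rewrite xlast_refl oppr_gt0].
  have [l [Q [tl tQ]]] := u_lap ix.
  have [l' [Q' [tl' tQ']]] := taylor_refl (edot_basis_diag _ _) tl.
  exists l', Q'; split; last by rewrite tQ' tQ /even_ext leNgt x0.
  apply: taylor_near tl'.
  have h : \forall y \near x, edot y eN < 0.
    by apply: (cvgr_lt _ (@edot_continuous R n eN x)); rewrite -xlastE.
  near=> y; rewrite !extE /even_ext.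
  have y0 : xlast y < 0 by rewrite xlastE; near: y.
  have ey : 0 < enorm y.
    by apply: enorm_gt0; apply/eqP => E; move: y0; rewrite E /xlast mxE ltxx.
  rewrite {2}/nrm xlastZ pmulr_rge0 ?invr_gt0// leNgt y0 /=.
  by rewrite /nrm reflZ /enorm edot_refl ?edot_basis_diag.
- by apply: even_ext_taylor_equator; split.
Unshelve. all: by end_near. Qed.

Lemma even_ext_cont : cont_on (dom false) even_ext.
Proof.
move=> x [sx _]; have [l [Q [tl _]]] := even_ext_taylor sx.
have := taylor_continuous tl => c.
have {}c : ext even_ext y @[y --> within (dom false) (nbhs x)] --> even_ext x.
  by rewrite -(ext_sphere even_ext sx); apply: cvg_within_filter; exact: c.
apply: cvg_trans c; apply: near_eq_cvg.
have : \forall y \near within (dom false) (nbhs x), dom false y by exact: withinT.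
by apply: filterS => y [sy _]; rewrite ext_sphere.
Qed.

End EvenExtension.

(** * Symmetry, positivity and nonexistence for solutions on the hemisphere *)

Section Hemisphere.
Variables (R : realType) (n : nat) (f b : R -> R).
Local Notation V := 'rV[R]_(n.+1).
Local Notation eN := (ebasis R (@ord_max n)).
Implicit Types (x y z : V) (u : V -> R) (t : R).
Hypothesis n3 : (3 <= n)%N.
Hypothesis f_cont : {within `[0, +oo[, continuous f}.
Hypothesis b_cont : {within `[0, +oo[, continuous b}.
Hypothesis h1_decr : forall s t : R, 0 < s -> s < t ->
  t `^ (- ((n%:R + 2) / (n%:R - 2))) * (f t + n%:R * (n%:R - 2) / 4 * t)
  < s `^ (- ((n%:R + 2) / (n%:R - 2))) * (f s + n%:R * (n%:R - 2) / 4 * s).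
Hypothesis k1_nincr : forall s t : R, 0 < s -> s < t ->
  t `^ (- (n%:R / (n%:R - 2))) * b t <= s `^ (- (n%:R / (n%:R - 2))) * b s.
Hypothesis k1_ge0 : forall t : R, 0 < t -> 0 <= t `^ (- (n%:R / (n%:R - 2))) * b t.

Lemma solution_concl u : is_solution f b u -> (forall x, hemi_cl x -> 0 < u x) -> concl_i b u.
Proof.
move=> su upos.
have u_pos x : dom true x -> 0 < u x by move=> /dom_true; exact: upos.
have radial x y : dom true x -> dom true y -> xlast x = xlast y -> u x = u y.
  move=> dx dy xy; apply: (value_eq n3 f_cont b_cont h1_decr k1_nincr k1_ge0
    (solution_cont su) u_pos (fun z => @solution_lap _ _ _ _ _ z su)
    (fun bt z => @solution_nd _ _ _ _ _ z su bt) dx dy (fun=> xy)).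
split=> [r _ w1 w2 A1 A2|[z0 [ez0 bz0]]].
  apply: radial; [by apply/dom_true; case: A1|by apply/dom_true; case: A2|].
  by apply: (Aset_xlast _ A1 A2); exact: leq_trans n3.
have [sz0 z00] := ez0.
have dom_eq z : equator z -> dom true z by move=> [sz z_0]; split=> // _; rewrite z_0.
have u_eq z : equator z -> u z = u z0.
  by move=> ez; apply: radial; [exact: dom_eq|exact: dom_eq|case: ez => _ ->].
have nd0 : nd u z0 0 by have := @solution_nd _ _ _ _ _ z0 su isT ez0; rewrite bz0 oppr0.
have lap x : idom true x -> exists l Q, taylor (ext u) x l Q /\ 2 * \tr Q = - f (u x).
  by move=> ix; exact: solution_lap su ix.
have fc := continuous_ge0_pos f_cont (u_pos _ (dom_eq _ ez0)).
have expn := radial_expansion ez0 (solution_cont su) radial lap nd0 fc.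
have ext_pos x : dom false x -> 0 < even_ext u x.
  by move=> [sx _]; have [y [dy -> _]] := even_ext_fold u sx; exact: u_pos.
exists (u z0) => x [sx x0].
have vx : even_ext u x = u x by rewrite /even_ext ltW.
have vz : even_ext u z0 = u z0 by rewrite /even_ext z00 lexx.
rewrite -vx -vz.
(* With [be = false] the boundary condition and the requirement of equal heights are vacuous, so any
   two points are comparable. *)
apply: (value_eq (be := false) n3 f_cont b_cont h1_decr k1_nincr k1_ge0 (even_ext_cont lap u_eq expn)
  ext_pos) => //.
by move=> y [sy _]; exact: (even_ext_taylor lap u_eq expn sy).
Qed.

Hypothesis F_ge0 : forall t : R, 0 <= t -> 0 <= f t + n%:R * (n%:R - 2) / 4 * t.

(** The sign of [k1] says nothing at 0, which a nonnegative solution may attain; right continuity of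
    [b] fills the gap. *)
Lemma boundary_term_ge0 t : 0 <= t -> 0 <= b t.
Proof.
rewrite le_eqVlt => /orP[/eqP <-|]; last exact: (b_ge0 k1_ge0).
have [_ c] := (continuous_within_itvcyP _ _).1 b_cont.
rewrite -(cvg_lim _ c)//; apply: limr_ge; first by apply/cvg_ex; exists (b 0).
near=> s; apply: (b_ge0 k1_ge0); near: s; exact: nbhs_right_gt.
Unshelve. all: by end_near. Qed.

Lemma solution_dichotomy u : is_solution f b u -> (forall x, hemi_cl x -> 0 <= u x) ->
  (forall x, hemi_cl x -> u x = 0) \/ (forall x, hemi_cl x -> 0 < u x).
Proof.
move=> su u_ge0; have [|/existsNP[x /not_implyP[hx ux]]] := pselect (forall x, hemi_cl x -> u x = 0).
  by left.
right=> y hy.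
have ux0 : 0 < u x by rewrite lt_neqAle eq_sym u_ge0// andbT; apply/eqP.
have uc := solution_cont su.
(* [x] may lie on the equator, while [strong_min] needs a centre strictly inside: move along the
   inward normal. *)
have [x1 hx1 ux1] : exists2 x1, hemi x1 & 0 < u x1.
  have [sx x0] := hx.
  have sN := @sphere_pole R n.
  have nx : \forall z \near x, dom true z -> 0 < u z.
    apply: (cont_on_near (P := fun t => 0 < t) uc); first exact/dom_true.
    exact: (cvgr_gt _ (@cvg_id _ (nbhs _)) _ ux0).
  have h : \forall t \near (0 : R)^'+, dom true (nrm (x + t *: eN)) -> 0 < u (nrm (x + t *: eN)).
    have c : nrm (x + t *: eN) @[t --> (0 : R)^'+] --> x.
      by apply: cvg_within_filter; exact: (cvg_nrm_sphere sx (@cvg_line _ _ x eN)).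
    exact: (c _ nx).
  have h2 : \forall t \near (0 : R)^'+, x + t *: eN != 0.
    by rewrite near_withinE; apply: filterS (line_neq0 eN sx).
  have [t [ht hemit]] : exists t, (dom true (nrm (x + t *: eN)) -> 0 < u (nrm (x + t *: eN))) /\
      hemi (nrm (x + t *: eN)).
    have : \forall t \near (0 : R)^'+, (dom true (nrm (x + t *: eN)) -> 0 < u (nrm (x + t *: eN))) /\
      hemi (nrm (x + t *: eN)).
      near=> t; split; first by near: t.
      have xt : x + t *: eN != 0 by near: t.
      split; first exact: nrm_sphere.
      rewrite /nrm xlastZ xlastD xlastZ xlast_pole mulr1 mulr_gt0 ?invr_gt0 ?enorm_gt0//.
      by rewrite ltr_wpDl//; near: t; exact: nbhs_right_gt.
    by move=> /(@filter_ex _ _ (at_right_proper_filter 0)).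
  exists (nrm (x + t *: eN)) => //; apply: ht.
  by case: hemit => s1 s2; split=> // _; exact: ltW.
have [sx1 x10] := hx1; have [sy y0] := hy.
(* With [tau0 = -1] the cap is the whole closed hemisphere; the strict inequality fails only at
   [- x1], which lies below the equator. *)
apply: (strong_min hx1 (_ : -1 <= -1 < 1) (ltW (c0_gt0 R n3))).
- by rewrite lexx (lt_trans (ltrN10 R) ltr01).
- by apply: cont_onW uc => z [].
- by move=> z [/dom_true dz _]; exact: u_ge0.
- exact: ux1.
- move=> z [dz _] iz; have [l [Q [tl tQ]]] := solution_lap su iz; have [sz _] := iz.
  exists (- f (u z)); first by rewrite -tQ; exact: (taylor_has_lap sz tl).
  by have := F_ge0 (u_ge0 z ((dom_true z).1 dz)); lra.
- move=> z [dz _] ez; exists (- b (u z)); first exact: (solution_nd su isT).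
  by rewrite oppr_le0 boundary_term_ge0// u_ge0//; apply/dom_true.
- by split; [exact/dom_true|exact: edot_sphere_ge].
- rewrite lt_neqAle edot_sphere_ge// andbT; apply/eqP => E.
  have sNx : sphere (- x1) by rewrite /sphere /= edotNl edotNr opprK.
  have yx : y = - x1 by apply: edot_sphere_eq1 => //; rewrite edotNr -E opprK.
  by move: y0; rewrite yx xlastE edotNl -xlastE oppr_ge0 leNgt x10.
Unshelve. all: by end_near. Qed.

Lemma no_positive_solution u : (forall t : R, 0 < t -> (n%:R - 2) / 2 * t <= b t) ->
  is_solution f b u -> ~ (forall x, hemi_cl x -> 0 < u x).
Proof.
move=> b_ge su upos; set a : R := (n%:R - 2) / 2; set c0 : R := n%:R * (n%:R - 2) / 4.
have a0 : 0 < a := weight_gt0 R n3.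
have c00 : 0 < c0 := c0_gt0 R n3.
have c0E : c0 = a * (a + 1) := c0_weight R n.
have nE : n%:R = 2 * (a + 1) := weight_dim R n.
have u_pos x : dom true x -> 0 < u x by move=> /dom_true; exact: upos.
have uc := solution_cont su.
(* Nonnegativity at t + 1 and the strict decrease of [h1] force strict positivity at t. *)
have F_gt0 t : 0 < t -> 0 < f t + c0 * t.
  move=> t0; have t1 : t < t + 1 by rewrite ltrDl.
  have := h1_decr t0 t1; rewrite -(pmulr_rgt0 _ (powR_gt0 (- ((n%:R + 2) / (n%:R - 2))) t0)).
  by apply: le_lt_trans; rewrite mulr_ge0 ?powR_ge0// F_ge0// addr_ge0 ?ltW.
have D0 : dom true eN by split; [exact: sphere_pole|rewrite xlast_pole ler01].
have qc : cont_on (dom true) (fun x => (f (u x) + c0 * u x) / u x).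
  apply: (cont_on_comp (G := fun t => (f t + c0 * t) / t)) => // z dz.
  have uz0 := u_pos _ dz; have fc := continuous_ge0_pos f_cont uz0.
  exact: (cvgM (cvgD fc (cvgM (cvg_cst _) cvg_id)) (cvgV (lt0r_neq0 uz0) cvg_id)).
have [xm dxm xm_min] := cont_on_min (@dom_compact R n true) (ex_intro _ _ D0) qc.
set m := (f (u xm) + _) / _ in xm_min.
have m0 : 0 < m by rewrite divr_gt0// ?F_gt0// u_pos.
clearbody m.
have F_ge x : dom true x -> m * u x <= f (u x) + c0 * u x.
  by move=> dx; rewrite -ler_pdivlMr ?u_pos// xm_min.
pose k : R := 2 `^ (- a).
have k0 : 0 < k by rewrite powR_gt0.
(* At an interior minimum of [u / g] the shift by [eps] costs [c0 * eps = m * k / 2] per unit of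
   [z0], while the strict positivity of [f t + c0 t] gains more than [m * k]; [k] bounds (1 + s)^-a
   from below. *)
pose eps := m * k / (2 * c0).
have eps0 : 0 < eps by rewrite divr_gt0// mulr_gt0.
have epsE : c0 * eps = m * k / 2 by rewrite /eps; field; rewrite gt_eqF.
clearbody eps.
(* [(1 + s)^-a] has Laplacian [c0 (1 + s)^-a] and outward normal derivative [a] on
   the equator, so [eps] makes both comparisons strict. *)
pose G (s : R) := (1 + s) `^ (- a) + eps.
pose g x := G (edot x eN).
have x1 x : dom true x -> 0 <= edot x eN <= 1.
  by move=> [sx /(_ isT) x0]; rewrite -xlastE x0 xlastE edot_sphere_le//; exact: sphere_pole.
have g_ge x : dom true x -> k <= (1 + edot x eN) `^ (- a).
  move=> /x1 /andP[s0 s1]; rewrite /k !powRN lef_pV2 ?posrE ?powR_gt0//; last by lra.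
  by apply: ge0_ler_powR; rewrite ?nnegrE; lra.
have g0 x : dom true x -> 0 < g x.
  by move=> dx; rewrite addr_gt0// (lt_le_trans k0)// g_ge.
have pG x : dom true x -> peano (fun h => G (edot x eN + h)) (G (edot x eN))
   (- a * (1 + edot x eN) `^ (- a - 1)) (- a * (- a - 1) / 2 * (1 + edot x eN) `^ (- a - 2)).
  move=> /x1 /andP[s0 s1]; have s10 : 0 < 1 + edot x eN by lra.
  have := peanoD (peano_powR (- a) s10) (peano_cst eps); rewrite !addr0.
  by apply: peano_ext => h; rewrite /G addrA.
have gc : cont_on (dom true) g.
  have G_cont x : dom true x -> {for edot x eN, continuous G}.
    move=> /x1 /andP[s0 s1]; have s10 : 0 < 1 + edot x eN by lra.
    have c1 : 1 + s @[s --> edot x eN] --> 1 + edot x eN by exact: (cvgD (cvg_cst _) cvg_id).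
    have c2 : (1 + s) `^ (- a) @[s --> edot x eN] --> (1 + edot x eN) `^ (- a).
      have pc : {for 1 + edot x eN, continuous (fun y : R => y `^ (- a))} by exact: powR_continuous.
      exact: (@cvg_comp _ _ _ (fun s => 1 + s) (fun y : R => y `^ (- a)) _ _ _ c1 pc).
    exact: (cvgD c2 (cvg_cst _)).
  have ec : cont_on (dom true) (fun x => edot x eN) by apply: cont_onT; exact: edot_continuous.
  exact: (cont_on_comp ec G_cont).
have [x0 [dx0 x0min test]] := min_ratio (fun _ => id) (@dom_compact R n true)
  (ex_intro _ _ D0) uc gc g0.
have {test} [|test_lap test_nd] := test; first by near=> y.
set z0 := u x0 / g x0 in test_lap test_nd.
have uE : u x0 = z0 * g x0 by rewrite divfK// gt_eqF// g0.
have z00 : 0 < z0 by rewrite divr_gt0 ?u_pos// g0.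
clearbody z0.
set s := edot x0 eN in pG *.
have [ix|[_ ex]] := dom_cases dx0.
- have [sx _] := ix; have [l [Q [tl tQ]]] := solution_lap su ix.
  have := test_lap _ _ ix (taylor_has_lap sx tl) (has_lap_edot sx (pG _ dx0)).
  rewrite tQ leNgt => /negP; apply.
  have /andP[s0 s1] := x1 _ dx0; rewrite -/s in s0 s1.
  have s10 : 0 < 1 + s by lra.
  have nz : 1 + s != 0 by rewrite gt_eqF.
  have pE1 : (1 + s) `^ (- a - 1) = (1 + s) `^ (- a) / (1 + s).
    by rewrite powRD; [rewrite (powRN _ 1) powRr1// ltW|rewrite nz implybT].
  have pE2 : (1 + s) `^ (- a - 2) = (1 + s) `^ (- a) / (1 + s) ^+ 2.
    by rewrite powRD; [rewrite (powRN _ 2) (powR_mulrn 2 (ltW s10))|rewrite nz implybT].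
  rewrite -/s pE1 pE2 edot_basis_diag nE.
  have := g_ge _ dx0; have := F_ge _ dx0; move: uE; rewrite /g /G -/s.
  set w := (1 + s) `^ (- a) => uE FF kw.
  rewrite (_ : 2 * _ - _ = c0 * w); last by rewrite c0E; field; rewrite gt_eqF.
  have h1 : z0 * k <= z0 * w by rewrite ler_wpM2l// ltW.
  have h2 : m * (z0 * k) <= m * (z0 * w) by rewrite ler_wpM2l// ltW.
  have h3 : 0 < m * (z0 * eps) by rewrite !mulr_gt0.
  have h4 : 0 < m * (z0 * k) by rewrite !mulr_gt0.
  have h5 : z0 * (c0 * eps) = z0 * (m * k / 2) by rewrite epsE.
  by move: FF; rewrite uE; lra.
- have := test_nd _ _ isT ex (solution_nd su isT ex) (nd_edot ex (pG _ dx0)).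
  rewrite leNgt => /negP; apply.
  have s0 : s = 0 by rewrite /s -xlastE; case: ex.
  have := b_ge _ (u_pos _ dx0); rewrite -/a uE /g /G -/s s0 addr0 !powR1 xlast_pole => bu.
  have h1 : 0 < a * (z0 * eps) := mulr_gt0 a0 (mulr_gt0 z00 eps0).
  by lra.
Unshelve. all: by end_near. Qed.

End Hemisphere.

Theorem theorem1p1 (R : realType) (n : nat) (f b : R -> R) :
  (3 <= n)%N ->
  {within `[0, +oo[, continuous f} ->
  {within `[0, +oo[, continuous b} ->
  (* h1 decreasing on (0, +oo) *)
  (forall s t : R, 0 < s -> s < t ->
     t `^ (- ((n%:R + 2) / (n%:R - 2))) * (f t + n%:R * (n%:R - 2) / 4 * t)
     < s `^ (- ((n%:R + 2) / (n%:R - 2))) * (f s + n%:R * (n%:R - 2) / 4 * s)) ->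
  (* k1 nonincreasing and nonnegative on (0, +oo) *)
  (forall s t : R, 0 < s -> s < t ->
     t `^ (- (n%:R / (n%:R - 2))) * b t <= s `^ (- (n%:R / (n%:R - 2))) * b s) ->
  (forall t : R, 0 < t -> 0 <= t `^ (- (n%:R / (n%:R - 2))) * b t) ->
  (* (i) *)
  (forall u : 'rV[R]_(n.+1) -> R,
     is_solution f b u -> (forall x, hemi_cl x -> 0 < u x) -> concl_i b u) /\
  (* (ii) *)
  ((forall t : R, 0 <= t -> 0 <= f t + n%:R * (n%:R - 2) / 4 * t) ->
     (forall u : 'rV[R]_(n.+1) -> R,
        is_solution f b u -> (forall x, hemi_cl x -> 0 <= u x) ->
        (forall x, hemi_cl x -> u x = 0) \/
        ((forall x, hemi_cl x -> 0 < u x) /\ concl_i b u)) /\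
     ((forall t : R, 0 < t -> (n%:R - 2) / 2 * t <= b t) ->
        forall u : 'rV[R]_(n.+1) -> R,
          is_solution f b u -> ~ (forall x, hemi_cl x -> 0 < u x))).
Proof.
move=> n3 f_cont b_cont h1_decr k1_nincr k1_ge0.
have concl u := @solution_concl R n f b n3 f_cont b_cont h1_decr k1_nincr k1_ge0 u.
split; first exact: concl.
move=> F_ge0; split=> [u su u_ge0|b_ge u]; last exact: no_positive_solution.
have [u_zero|u_pos] := solution_dichotomy n3 b_cont k1_ge0 F_ge0 su u_ge0; first by left.
by right; split=> //; exact: concl.
Qed.
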